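(* Let $G$ be a totally disconnected locally compact group and let $\mathcal{T}$ be a tree acted on by $G$ with open stabilisers. Then, for every discrete $\mathbb{Q}[G]$-module $M$, there are long exact sequences $$\cdots\to\prod_{v\in\mathcal{V}}\mathrm{dH}^n(G_v,M)\to\prod_{e\in\mathcal{E}}\mathrm{dH}^n(G_e,M)\to\mathrm{dH}^{n+1}(G,M)\to\cdots$$ and $$\cdots\to\bigoplus_{e\in\mathcal{E}}\mathrm{dH}_n(G_e,M)\to\bigoplus_{v\in\mathcal{V}}\mathrm{dH}_n(G_v,M)\to\mathrm{dH}_n(G,M)\to\cdots,$$ where $\mathcal{V}$ and $\mathcal{E}$ are arbitrary sets of representatives of the $G$-orbits on the vertices and on the edges of $\mathcal{T}$, respectively, and $G_v$ and $G_e$ denote the stabilisers of $v$ and $e$ in $G$, respectively.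
   Context: For a totally disconnected locally compact group $G$, a discrete $\mathbb{Q}[G]$-module is a left $\mathbb{Q}[G]$-module on which $G$ acts continuously when the module carries the discrete topology (i.e. with open point stabilisers). The category of discrete $\mathbb{Q}[G]$-modules is abelian with enough injectives and enough projectives. Rational discrete cohomology $\mathrm{dH}^n(G,-)$ is the $n$-th right derived functor of $\mathrm{Hom}_{\mathbb{Q}[G]}(\mathbb{Q},-)$ on this category, where $\mathbb{Q}$ is the trivial module; rational discrete homology is $\mathrm{dH}_n(G,M)=\mathrm{H}_n(P_\bullet\otimes_G M)$ for a projective resolution $P_\bullet\to\mathbb{Q}$ in this category (with $P_\bullet$ regarded as right modules via inversion).
   Formalization: The action on the tree is assumed to be without inversion (no element swaps the endpoints of an edge), and edges are unoriented; otherwise the claim fails, e.g. for Z/2 flipping a segment with M = Q. *)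

(* Defs.v *)
From HB Require Import structures.
From mathcomp Require Import all_boot all_algebra finmap.
From mathcomp Require Import all_classical topology.

Set Implicit Arguments.
Unset Strict Implicit.
Unset Printing Implicit Defensive.

Import GRing.Theory.
Local Open Scope classical_set_scope.
Local Open Scope ring_scope.

Record submod (R : nzRingType) (V : lmodType R) := Submod {
  submod_set :> set V;
  submod0 : submod_set 0;
  submodP : forall (a : R) u v,
    submod_set u -> submod_set v -> submod_set (a *: u + v) }.

Section SubQuotient.
Variables (R : nzRingType) (V : lmodType R) (S : submod V).

Definition submod_pred : {pred V} := mem (S : set V).

Lemma submod_pred_closed : subsemimod_closed submod_pred.
Proof.
have S0 := submod0 S; split; first split.
- by rewrite inE.
- move=> u v; rewrite !inE => Su Sv; rewrite -[u]scale1r; exact: submodP.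
- by move=> a u; rewrite !inE => Su; rewrite -[_ *: _]addr0; exact: submodP.
Qed.

HB.instance Definition _ :=
  GRing.isSubmodClosed.Build R V submod_pred submod_pred_closed.

Record submod_type := SubmodElt {
  submod_val : V; _ : submod_val \in submod_pred }.

HB.instance Definition _ := [isSub for submod_val].
HB.instance Definition _ := [Choice of submod_type by <:].
HB.instance Definition _ := [SubChoice_isSubLmodule of submod_type by <:].

Definition quot_mod := Quotient.quot submod_pred.
HB.instance Definition _ := GRing.Zmodule.on quot_mod.

Definition quot_pi (v : V) : quot_mod := \pi_(Quotient.quot submod_pred)%qT v.
Definition quot_repr (x : quot_mod) : V := repr (x : Quotient.quot submod_pred).

Lemma quot_reprK : cancel quot_repr quot_pi.
Proof. by move=> x; exact: reprK. Qed.


Lemma quot_piP u v : quot_pi u = quot_pi v <-> (S : set V) (u - v).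
Proof.
split=> [/eqP|Suv].
  by rewrite -(Quotient.idealrBE submod_pred) => /set_mem.
by apply/eqP; rewrite -(Quotient.idealrBE submod_pred); exact/mem_set.
Qed.

Lemma quot_piB : {morph quot_pi : u v / u - v}.
Proof. by move=> u v; rewrite /quot_pi raddfB. Qed.

Lemma quot_piD : {morph quot_pi : u v / u + v}.
Proof. by move=> u v; rewrite /quot_pi raddfD. Qed.

Definition quot_scale (a : R) (x : quot_mod) : quot_mod :=
  quot_pi (a *: quot_repr x).

Lemma quot_piZ a v : quot_pi (a *: v) = quot_scale a (quot_pi v).
Proof.
apply/quot_piP; rewrite -scalerBr -[_ *: _]addr0.
apply: submodP (submod0 S); apply/quot_piP.
by rewrite quot_reprK.
Qed.

Lemma quot_scaleA a b x : quot_scale a (quot_scale b x) = quot_scale (a * b) x.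
Proof. by rewrite -[x]quot_reprK -!quot_piZ scalerA. Qed.

Lemma quot_scale1 : left_id 1 quot_scale.
Proof. by move=> x; rewrite -[x]quot_reprK -quot_piZ scale1r. Qed.

Lemma quot_scaleDr : right_distributive quot_scale +%R.
Proof.
move=> a x y; rewrite -[x]quot_reprK -[y]quot_reprK.
by rewrite -quot_piD -!quot_piZ -quot_piD scalerDr.
Qed.

Lemma quot_scaleDl x : {morph quot_scale^~ x : a b / a + b}.
Proof.
move=> a b; rewrite -[x]quot_reprK.
by rewrite -!quot_piZ -quot_piD scalerDl.
Qed.

HB.instance Definition _ := GRing.Zmodule_isLmodule.Build R quot_mod
  quot_scaleA quot_scale1 quot_scaleDr quot_scaleDl.

Lemma quot_pi_linear : linear quot_pi.
Proof. by move=> a u v; rewrite quot_piD quot_piZ. Qed.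

HB.instance Definition _ :=
  GRing.isLinear.Build R V quot_mod *:%R quot_pi quot_pi_linear.

End SubQuotient.

Section QuotLift.
Variables (R : nzRingType) (V W : lmodType R) (S : submod V).
Variable f : {linear V -> W}.

(* [quot_lift] does not depend on the choice of [quot_repr], by [quot_liftE]. *)
Definition quot_lift (f0 : forall v, (S : set V) v -> f v = 0)
  (x : quot_mod S) : W := f (quot_repr x).

Variable f0 : forall v, (S : set V) v -> f v = 0.

Lemma quot_liftE v : quot_lift f0 (quot_pi S v) = f v.
Proof.
apply/eqP; rewrite -subr_eq0 -raddfB; apply/eqP/f0/quot_piP.
exact: quot_reprK.
Qed.

Lemma quot_lift_linear : linear (quot_lift f0).
Proof.
move=> a x y; rewrite -[x]quot_reprK -[y]quot_reprK.
by rewrite -linearP !quot_liftE linearP.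
Qed.

HB.instance Definition _ :=
  GRing.isLinear.Build R (quot_mod S) W *:%R (quot_lift f0) quot_lift_linear.

End QuotLift.

Local Obligation Tactic := idtac.

Section Submods.
Variables (R : nzRingType) (V W : lmodType R).

Program Definition zero_submod : submod V := @Submod R V [set 0] _ _.
Next Obligation. by []. Qed.
Next Obligation. by move=> a u v -> ->; rewrite scaler0 addr0. Qed.

Program Definition full_submod : submod V := @Submod R V setT _ _.
Next Obligation. by []. Qed.
Next Obligation. by []. Qed.

Program Definition ker_submod (f : {linear V -> W}) : submod V :=
  @Submod R V [set v | f v = 0] _ _.
Next Obligation. by move=> f; exact: linear0. Qed.
Next Obligation. by move=> f a u v /= fu fv; rewrite linearP fu fv scaler0 addr0. Qed.

Program Definition im_submod (f : {linear V -> W}) : submod W :=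
  @Submod R W (range f) _ _.
Next Obligation. by move=> f; exists 0; rewrite ?linear0. Qed.
Next Obligation.
by move=> f a _ _ [u' _ <-] [v' _ <-]; exists (a *: u' + v'); rewrite ?linearP.
Qed.

Program Definition span_submod (A : set V) : submod V :=
  @Submod R V [set v | forall S : submod V, A `<=` S -> (S : set V) v] _ _.
Next Obligation. by move=> A S _; exact: submod0. Qed.
Next Obligation.
by move=> A a u v Su Sv S AS; apply: submodP; [exact: Su|exact: Sv].
Qed.

End Submods.

(* [Z / (B `&` Z)]; for the (co)cycles [Z] and (co)boundaries [B] of a complex,
   [B `<=` Z] and this is [Z / B]. *)
Section Subquotient.
Variables (R : nzRingType) (V : lmodType R) (Z B : submod V).

Program Definition restrict_submod : submod (submod_type Z) :=
  @Submod R (submod_type Z) [set z | (B : set V) (val z)] _ _.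
Next Obligation. exact: submod0. Qed.
Next Obligation. by move=> a u v; exact: submodP. Qed.

Definition subquot : lmodType R := quot_mod restrict_submod.

End Subquotient.

Section DirectProductSum.
Variables (R : nzRingType) (I : Type) (F : I -> lmodType R).

Definition dirprod := forall i, F i.
HB.instance Definition _ := gen_eqMixin dirprod.
HB.instance Definition _ := gen_choiceMixin dirprod.

Definition dirprod_add (f g : dirprod) : dirprod := fun i => f i + g i.
Definition dirprod_opp (f : dirprod) : dirprod := fun i => - f i.
Definition dirprod_zero : dirprod := fun i => 0.
Definition dirprod_scale (a : R) (f : dirprod) : dirprod := fun i => a *: f i.

Lemma dirprod_addA : associative dirprod_add.
Proof. by move=> f g h; apply: functional_extensionality_dep => i; exact: addrA. Qed.
Lemma dirprod_addC : commutative dirprod_add.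
Proof. by move=> f g; apply: functional_extensionality_dep => i; exact: addrC. Qed.
Lemma dirprod_add0 : left_id dirprod_zero dirprod_add.
Proof. by move=> f; apply: functional_extensionality_dep => i; exact: add0r. Qed.
Lemma dirprod_addN : left_inverse dirprod_zero dirprod_opp dirprod_add.
Proof. by move=> f; apply: functional_extensionality_dep => i; exact: addNr. Qed.

HB.instance Definition _ :=
  GRing.isZmodule.Build dirprod dirprod_addA dirprod_addC dirprod_add0 dirprod_addN.

Lemma dirprod_scaleA a b f : dirprod_scale a (dirprod_scale b f) = dirprod_scale (a * b) f.
Proof. by apply: functional_extensionality_dep => i; exact: scalerA. Qed.
Lemma dirprod_scale1 : left_id 1 dirprod_scale.
Proof. by move=> f; apply: functional_extensionality_dep => i; exact: scale1r. Qed.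
Lemma dirprod_scaleDr : right_distributive dirprod_scale +%R.
Proof. by move=> a f g; apply: functional_extensionality_dep => i; exact: scalerDr. Qed.
Lemma dirprod_scaleDl f : {morph dirprod_scale^~ f : a b / a + b}.
Proof. by move=> a b; apply: functional_extensionality_dep => i; exact: scalerDl. Qed.

HB.instance Definition _ := GRing.Zmodule_isLmodule.Build R dirprod
  dirprod_scaleA dirprod_scale1 dirprod_scaleDr dirprod_scaleDl.

Program Definition dirsum_submod : submod dirprod :=
  @Submod R dirprod [set f : dirprod | finite_set [set i | f i <> 0]] _ _.
Next Obligation.
by apply: sub_finite_set (finite_set0 I) => i; apply.
Qed.
Next Obligation.
move=> a u v fu fv; apply: sub_finite_set (_ : finite_set ([set i | u i <> 0] `|` [set i | v i <> 0])).
  move=> i /= h; have [u0|] := pselect (u i = 0); last by left.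
  right=> v0; apply: h.
  by rewrite /GRing.add/= /dirprod_add /GRing.scale/= /dirprod_scale u0 v0 scaler0 addr0.
by rewrite finite_setU.
Qed.

Definition dirsum : lmodType R := submod_type dirsum_submod.

End DirectProductSum.


Section Free.
Variables (R : nzRingType) (X : Type).

Definition free_mod : lmodType R := dirsum (fun _ : X => R^o : lmodType R).
Definition free_coef (u : free_mod) : X -> R := val u.

Lemma free_coef_finite (u : free_mod) : finite_set [set x | free_coef u x <> 0].
Proof. exact: set_mem (valP u). Qed.

Lemma free_coefP a (u v : free_mod) x :
  free_coef (a *: u + v) x = a * free_coef u x + free_coef v x.
Proof. by []. Qed.

Lemma free_delta_finite (x : X) :
  (dirsum_submod (fun _ : X => R^o : lmodType R) : set _)
    (fun y => if `[< y = x >] then 1 else 0).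
Proof. by apply: sub_finite_set (finite_set1 x) => y /=; case: asboolP. Qed.

Definition free_delta (x : X) : free_mod :=
  SubmodElt (mem_set (free_delta_finite x)).

Variables (W : lmodType R) (h : X -> W).

Definition free_lift (u : free_mod) : W :=
  \sum_(x \in [set: {classic X}]) free_coef u x *: h x.

Lemma free_lift_fset (A : {fset {classic X}}) (u : free_mod) :
  [set x | free_coef u x <> 0] `<=` [set` A] ->
  free_lift u = \sum_(x <- A) free_coef u x *: h x.
Proof.
move=> uA; apply: fsbigTE => x xA; have [->|u0] := pselect (free_coef u x = 0).
  exact: scale0r.
by move: xA; rewrite [x \in A]uA.
Qed.

Lemma free_lift_linear : linear free_lift.
Proof.
move=> a u v.
have [A uA] := (@finite_fsetP {classic X} _).1 (free_coef_finite u).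
have [B vB] := (@finite_fsetP {classic X} _).1 (free_coef_finite v).
have sA w : [set x | free_coef w x <> 0] `<=`
    [set x | free_coef u x <> 0] `|` [set x | free_coef v x <> 0] ->
    free_lift w = \sum_(x <- (A `|` B : {fset {classic X}})%fset) free_coef w x *: h x.
  by move=> wuv; apply: free_lift_fset; rewrite set_fsetU -uA -vB.
have su := sA u (@subsetUl _ _ _); have sv := sA v (@subsetUr _ _ _).
rewrite su sv sA; last first.
  move=> x /= w0; have [u0|] := pselect (free_coef u x = 0); last by left.
  by right=> v0; apply: w0; rewrite free_coefP u0 v0 mulr0 addr0.
rewrite scaler_sumr -big_split /=; apply: eq_bigr => x _.
by rewrite free_coefP scalerDl scalerA.
Qed.

HB.instance Definition _ := GRing.isLinear.Build R free_mod W *:%R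
  free_lift free_lift_linear.

Lemma free_lift_delta x : free_lift (free_delta x) = h x.
Proof.
have coefE y : free_coef (free_delta x) y = if `[< y = x >] then 1 else 0 by [].
rewrite (@free_lift_fset [fset (x : {classic X})]%fset).
  by rewrite big_seq_fset1 coefE asboolT ?scale1r.
by move=> y /=; rewrite coefE; case: asboolP => // -> _; rewrite inE.
Qed.

End Free.

HB.mixin Record isTopologicalGroup G of Group G & Topological G := {
  mulg_continuous : continuous (fun xy : G * G => (xy.1 * xy.2)%g);
  invg_continuous : continuous (fun x : G => x^-1%g) }.

#[short(type="topGroupType")]
HB.structure Definition TopologicalGroup :=
  {G of isTopologicalGroup G & Group G & Topological G}.

(* A totally disconnected group is T1, hence Hausdorff. *)
Definition tdlc (G : topGroupType) :=
  locally_compact [set: G] /\ totally_disconnected [set: G].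

Record subgroup (G : groupType) := Subgroup {
  subgroup_set : set G;
  subgroup1 : subgroup_set 1%g;
  subgroup_div : forall x y,
    subgroup_set x -> subgroup_set y -> subgroup_set (x / y)%g }.

Section SubgroupType.
Variables (G : topGroupType) (H : subgroup G).

Definition subgroup_pred : {pred G} := mem (subgroup_set H).

Lemma subgroup_pred_closed : group_closed subgroup_pred.
Proof.
split; first by rewrite inE; exact: subgroup1.
by move=> x y; rewrite !inE; exact: subgroup_div.
Qed.

Record subgroup_type := SubgroupElt {
  subgroup_val : G; _ : subgroup_val \in subgroup_pred }.

HB.instance Definition _ := [isSub for subgroup_val].
HB.instance Definition _ := [Choice of subgroup_type by <:].
HB.instance Definition _ := SubChoice_isSubGroup.Build G subgroup_pred
  subgroup_type subgroup_pred_closed.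
HB.instance Definition _ :=
  Topological.copy subgroup_type (initial_topology subgroup_val).

Lemma subgroup_val_continuous : continuous subgroup_val.
Proof. exact: initial_continuous. Qed.

Lemma subgroup_mul_continuous :
  continuous (fun xy : subgroup_type * subgroup_type => (xy.1 * xy.2)%g).
Proof.
apply: continuous_comp_initial => -[x y].
apply: (@continuous_comp _ _ _
  (fun xy : subgroup_type * subgroup_type => (subgroup_val xy.1, subgroup_val xy.2))
  (fun xy : G * G => (xy.1 * xy.2)%g)); last exact: mulg_continuous.
apply: cvg_pair.
  apply: (@continuous_comp _ _ _ fst subgroup_val (x, y)).
    exact: cvg_fst.
  exact: subgroup_val_continuous.
apply: (@continuous_comp _ _ _ snd subgroup_val (x, y)); first exact: cvg_snd.
exact: subgroup_val_continuous.
Qed.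

Lemma subgroup_inv_continuous : continuous (fun x : subgroup_type => x^-1%g).
Proof.
apply: continuous_comp_initial => x.
apply: (@continuous_comp _ _ _ subgroup_val (fun x : G => x^-1%g)).
  exact: subgroup_val_continuous.
exact: invg_continuous.
Qed.

HB.instance Definition _ := isTopologicalGroup.Build subgroup_type
  subgroup_mul_continuous subgroup_inv_continuous.

End SubgroupType.

Coercion subgroup_type : subgroup >-> Sortclass.

Record gaction (G : groupType) (X : Type) := Gaction {
  gact :> G -> X -> X;
  gact1 : forall x, gact 1%g x = x;
  gactM : forall g h x, gact (g * h)%g x = gact g (gact h x) }.

Section Actions.
Variables (G : groupType) (X : Type) (a : gaction G X).

Lemma stab_div x g h : a g x = x -> a h x = x -> a (g / h)%g x = x.
Proof.
move=> gx hx; have hVx : a h^-1%g x = x by rewrite -{1}hx -gactM mulVg gact1.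
by rewrite gactM hVx.
Qed.

Definition stab (x : X) : subgroup G :=
  @Subgroup G [set g | a g x = x] (gact1 a x) (@stab_div x).

Lemma set_gact1 (Y : set X) : a 1%g @` Y = Y.
Proof. by rewrite (_ : a 1%g = id) ?image_id //; apply/funext => x; exact: gact1. Qed.

Lemma set_gactM g h (Y : set X) : a (g * h)%g @` Y = a g @` (a h @` Y).
Proof.
by rewrite image_comp; congr image; apply/funext => x; exact: gactM.
Qed.

Definition set_gaction : gaction G (set X) := 
  @Gaction G (set X) (fun g Y => a g @` Y) set_gact1 set_gactM.

Definition orbit_representatives (Y S : set X) :=
  S `<=` Y /\ forall y, Y y -> exists! s, S s /\ exists g, a g s = y.

End Actions.

Record graph := Graph {
  vertex : choiceType;
  adj : rel vertex;
  adj_sym : symmetric adj;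
  adj_irrefl : irreflexive adj }.

Section Graphs.
Variable T : graph.

(* Edges are unordered pairs of vertices; [stab (set_gaction a) e] is the
   setwise stabiliser of [e]. *)
Definition edges : set (set (vertex T)) :=
  [set e | exists x y, adj x y /\ e = [set x; y]].

Definition is_tree :=
  [/\ inhabited (vertex T),
      forall x y : vertex T, exists s, path (@adj T) x s /\ last x s = y &
      forall s : seq (vertex T), (2 < size s)%N -> ~ ucycle (@adj T) s].

Variable G : topGroupType.

Definition graph_action (a : gaction G (vertex T)) :=
  forall g x y, adj (a g x) (a g y) = adj x y.

Definition without_inversion (a : gaction G (vertex T)) :=
  forall g x y, adj x y -> ~ (a g x = y /\ a g y = x).

Definition open_stabilisers (a : gaction G (vertex T)) :=
  (forall v, open (subgroup_set (stab a v))) /\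
  (forall e, edges e -> open (subgroup_set (stab (set_gaction a) e))).

End Graphs.

(* Discrete Q[G]-modules, as Q-vector spaces with a linear action of G. *)
Record dmod (G : topGroupType) := Dmod {
  dmod_sort :> lmodType rat;
  dact : gaction G dmod_sort;
  dact_linear : forall g, linear (dact g);
  dact_open : forall m, open (subgroup_set (stab dact m)) }.

HB.instance Definition _ (G : topGroupType) (M : dmod G) (g : G) :=
  GRing.isLinear.Build rat M M *:%R (dact M g) (dact_linear g).

Section Restriction.
Variables (G : topGroupType) (M : dmod G) (H : subgroup G).

Definition res_act (h : H) : M -> M := dact M (val h).

Lemma res_act1 m : res_act 1%g m = m. Proof. exact: gact1. Qed.

Lemma res_actM g h m : res_act (g * h)%g m = res_act g (res_act h m).
Proof. exact: gactM. Qed.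

Definition res_action : gaction H M := Gaction res_act1 res_actM.

Lemma res_open m : open (subgroup_set (stab res_action m)).
Proof.
exact: open_comp (fun h _ => @subgroup_val_continuous G H h) (dact_open m).
Qed.

Definition res : dmod H :=
  @Dmod H M res_action (fun h => dact_linear (val h)) res_open.

End Restriction.

Section Trivial.
Variable G : topGroupType.

Definition triv_action : gaction G rat^o :=
  @Gaction G rat^o (fun _ m => m) (fun _ => erefl) (fun _ _ _ => erefl).

Lemma triv_open m : open (subgroup_set (stab triv_action m)).
Proof.
rewrite (_ : subgroup_set _ = setT); first exact: openT.
by apply/seteqP; split.
Qed.

Definition triv : dmod G :=
  @Dmod G (rat^o : lmodType rat) triv_action (fun _ _ _ _ => erefl) triv_open.

End Trivial.

Section Hom.
Variables (G : topGroupType) (A B : dmod G).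

Program Definition hom_submod : submod (A -> B : lmodType rat) :=
  @Submod rat (A -> B) [set f : A -> B |
    linear f /\ forall g x, f (dact A g x) = dact B g (f x)] _ _.
Next Obligation.
split=> [a x y|g x]; first by rewrite scaler0 addr0.
by rewrite linear0.
Qed.
Next Obligation.
move=> a u v [ul uG] [vl vG]; split=> [b x y|g x].
  rewrite -![(a *: u + v) _]/(a *: u _ + v _) ul vl.
  by rewrite !scalerDr !scalerA [b * a]mulrC addrACA.
by rewrite -![(a *: u + v) _]/(a *: u _ + v _) uG vG linearP.
Qed.

Definition hom : lmodType rat := submod_type hom_submod.
Definition hom_fun (f : hom) : A -> B := val f.

Lemma hom_linear (f : hom) : linear (hom_fun f).
Proof. by have /set_mem[] := valP f. Qed.

Lemma hom_equivariant (f : hom) g x :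
  hom_fun f (dact A g x) = dact B g (hom_fun f x).
Proof. by have /set_mem[_] := valP f. Qed.

HB.instance Definition _ f :=
  GRing.isLinear.Build rat A B *:%R (hom_fun f) (hom_linear f).

End Hom.

Section HomPost.
Variables (G : topGroupType) (A B C : dmod G) (f : hom B C).

Lemma hom_post_subproof (u : hom A B) :
  (hom_submod A C : set _) (hom_fun f \o hom_fun u).
Proof.
by split=> [a x y|g x] /=; rewrite ?linearP// !hom_equivariant.
Qed.

Definition hom_post (u : hom A B) : hom A C :=
  SubmodElt (mem_set (hom_post_subproof u)).

Lemma hom_post_linear : linear hom_post.
Proof.
move=> a u v; apply/val_inj/funext => x.
exact: (linearP (hom_fun f)).
Qed.

HB.instance Definition _ :=
  GRing.isLinear.Build rat (hom A B) (hom A C) *:%R hom_post hom_post_linear.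

End HomPost.

Arguments hom_post {G} A {B C} f _.

Section Tensor.
Variables (G : topGroupType) (M : dmod G).

(* [P] is a right module through [p * g := g^-1 * p]. *)
Inductive tensor_rel (P : dmod G) : set (free_mod rat (P * M)) :=
| tensor_addl p q m : tensor_rel
    (free_delta rat (p + q, m) - (free_delta rat (p, m) + free_delta rat (q, m)))
| tensor_addr p m n : tensor_rel
    (free_delta rat (p, m + n) - (free_delta rat (p, m) + free_delta rat (p, n)))
| tensor_scalel a p m : tensor_rel
    (free_delta rat (a *: p, m) - a *: free_delta rat (p, m))
| tensor_scaler a p m : tensor_rel
    (free_delta rat (p, a *: m) - a *: free_delta rat (p, m))
| tensor_balanced g p m : tensor_rel
    (free_delta rat (dact P g^-1%g p, m) - free_delta rat (p, dact M g m)).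

Definition tensor (P : dmod G) : lmodType rat :=
  quot_mod (span_submod (@tensor_rel P)).

Definition tens (P : dmod G) (p : P) (m : M) : tensor P :=
  quot_pi (span_submod (@tensor_rel P)) (free_delta rat (p, m)).

Lemma tensor_eq (P : dmod G) u v : tensor_rel (u - v) ->
  quot_pi (span_submod (@tensor_rel P)) u = quot_pi (span_submod (@tensor_rel P)) v.
Proof. by move=> uv; apply/quot_piP => S; apply. Qed.

Lemma tensDl (P : dmod G) (p q : P) m : tens (p + q) m = tens p m + tens q m.
Proof. by rewrite -linearD; exact/tensor_eq/tensor_addl. Qed.

Lemma tensDr (P : dmod G) (p : P) m n : tens p (m + n) = tens p m + tens p n.
Proof. by rewrite -linearD; exact/tensor_eq/tensor_addr. Qed.

Lemma tensZl (P : dmod G) a (p : P) m : tens (a *: p) m = a *: tens p m.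
Proof. by rewrite -linearZ; exact/tensor_eq/tensor_scalel. Qed.

Lemma tensZr (P : dmod G) a (p : P) m : tens p (a *: m) = a *: tens p m.
Proof. by rewrite -linearZ; exact/tensor_eq/tensor_scaler. Qed.

Lemma tens_balanced (P : dmod G) g (p : P) m :
  tens (dact P g^-1%g p) m = tens p (dact M g m).
Proof. by exact/tensor_eq/tensor_balanced. Qed.

Section TensorMap.
Variables (P Q : dmod G) (f : hom P Q).

Definition tensor_pre : {linear free_mod rat (P * M) -> tensor Q} :=
  free_lift (fun pm : P * M => tens (hom_fun f pm.1) pm.2).

Lemma tensor_pre0 v :
  (span_submod (@tensor_rel P) : set _) v -> tensor_pre v = 0.
Proof.
apply: (_ : (span_submod (@tensor_rel P) : set _) v ->
            (ker_submod tensor_pre : set _) v); apply => {v} _ [] * /=.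
all: rewrite linearB ?linearD ?linearZ /= !free_lift_delta /=.
- by rewrite (linearD (hom_fun f)) tensDl -opprD subrr.
- by rewrite tensDr -opprD subrr.
- by rewrite [hom_fun f _]linearZ /= tensZl scalerN subrr.
- by rewrite tensZr scalerN subrr.
- by rewrite hom_equivariant tens_balanced subrr.
Qed.

Definition tensor_map : {linear tensor P -> tensor Q} :=
  quot_lift tensor_pre0.

End TensorMap.
End Tensor.

Section Complexes.
Variable R : nzRingType.

Definition is_exact (U V W : lmodType R)
    (f : {linear U -> V}) (g : {linear V -> W}) :=
  range f = g @^-1` [set 0].

Definition coboundaries (C : nat -> lmodType R)
    (d : forall n, {linear C n -> C n.+1}) (n : nat) : submod (C n) :=
  match n with 0%N => zero_submod (C 0%N) | m.+1 => im_submod (d m) end.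

Definition cohomology (C : nat -> lmodType R)
    (d : forall n, {linear C n -> C n.+1}) (n : nat) : lmodType R :=
  subquot (ker_submod (d n)) (coboundaries d n).

Definition cycles (C : nat -> lmodType R)
    (d : forall n, {linear C n.+1 -> C n}) (n : nat) : submod (C n) :=
  match n with 0%N => full_submod (C 0%N) | m.+1 => ker_submod (d m) end.

Definition homology (C : nat -> lmodType R)
    (d : forall n, {linear C n.+1 -> C n}) (n : nat) : lmodType R :=
  subquot (cycles d n) (im_submod (d n)).

End Complexes.

Section DerivedFunctors.
Variable G : topGroupType.

Definition injective_object (I : dmod G) :=
  forall (A B : dmod G) (i : hom A B) (f : hom A I), injective (hom_fun i) ->
  exists h : hom B I, hom_fun h \o hom_fun i = hom_fun f.

Definition projective_object (P : dmod G) :=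
  forall (A B : dmod G) (p : hom A B) (f : hom P B),
  (forall b, exists a, hom_fun p a = b) ->
  exists h : hom P A, hom_fun p \o hom_fun h = hom_fun f.

Record injective_resolution (M : dmod G) := InjectiveResolution {
  ires :> nat -> dmod G;
  ires_aug : hom M (ires 0%N);
  ires_d : forall n, hom (ires n) (ires n.+1);
  ires_injective : forall n, injective_object (ires n);
  ires_aug_inj : injective (hom_fun ires_aug);
  ires_exact0 : is_exact (hom_fun ires_aug) (hom_fun (ires_d 0%N));
  ires_exact : forall n, is_exact (hom_fun (ires_d n)) (hom_fun (ires_d n.+1)) }.

Record projective_resolution (M : dmod G) := ProjectiveResolution {
  pres :> nat -> dmod G;
  pres_aug : hom (pres 0%N) M;
  pres_d : forall n, hom (pres n.+1) (pres n);
  pres_projective : forall n, projective_object (pres n);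
  pres_aug_surj : forall m, exists x, hom_fun pres_aug x = m;
  pres_exact0 : is_exact (hom_fun (pres_d 0%N)) (hom_fun pres_aug);
  pres_exact : forall n, is_exact (hom_fun (pres_d n.+1)) (hom_fun (pres_d n)) }.

(* dH^n(G, M), the n-th right derived functor of Hom_{Q[G]}(Q, -) at [M],
   computed with the injective resolution [I]; unique up to isomorphism. *)
Definition dcohomology (M : dmod G) (I : injective_resolution M) (n : nat) :
    lmodType rat :=
  cohomology (fun k => hom_post (triv G) (ires_d I k) : {linear _ -> _}) n.

(* dH_n(G, M), computed with the projective resolution [P] of Q; unique up to
   isomorphism. *)
Definition dhomology (P : projective_resolution (triv G)) (M : dmod G) (n : nat) :
    lmodType rat :=
  homology (fun k => tensor_map M (pres_d P k)) n.

End DerivedFunctors.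

(* Main.v *)
(* A tree gives, for every discrete module P, an exact sequence
   0 -> P[E] -> P[V] -> P -> 0 of finitely supported chains; the orientation of
   the edges can be chosen equivariantly because there are no inversions.

   Cohomology: for P = Q, applying Hom_G(-, I^k) to it for an injective
   resolution I of M gives a short exact sequence of complexes, whose middle and
   last terms are by Frobenius reciprocity the products over the orbit
   representatives of Hom_{G_x}(Q, I^k).  Open subgroups have an exact induction
   functor, so I is also an injective resolution over G_x.

   Homology: for P = P_k in a projective resolution of Q, the sequence splits, so
   it stays exact after applying - (x)_G M, and P_k[X] (x)_G M is the direct sum
   of the P_k (x)_{G_x} M over the orbit representatives x.  That P_k is
   projective over G_x uses a compact open subgroup U of G (van Dantzig):
   averaging over U shows that the projective modules are the retracts of
   permutation modules with compact open stabilisers. *)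
Require Import Defs.
From HB Require Import structures.
From mathcomp Require Import all_boot all_algebra finmap.
From mathcomp Require Import all_classical topology.

(* all_algebra shadows [hom]. *)
Import Defs.

Set Implicit Arguments.
Unset Strict Implicit.
Unset Printing Implicit Defensive.

Import GRing.Theory.
Local Open Scope classical_set_scope.
Local Open Scope ring_scope.

(** * Linear maps and subquotients *)

(** The resolutions over [G] and over the stabilisers are given independently of each other, so each
    term of the sequences has to be identified with the prescribed one through the comparison
    theorem for resolutions. In homology the derived variable is the trivial module, which is why a
    whole projective resolution is spread over the tree, every [P_k[X]] with the diagonal action.
    Restriction has induction as left adjoint; since induction preserves injections, this settles
    injective modules, but it says nothing about projective ones. Those are described instead by a
    property that is visibly stable under restriction: the same permutation module serves, and point
    stabilisers are merely intersected with the open subgroup. Rational coefficients enter when a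
    sum over a finite orbit is divided by its size; finiteness of these orbits is the only
    consequence of compactness kept from van Dantzig's theorem. The tree itself enters twice:
    removing an edge disconnects its ends, which gives exactness at the edges, and paths to a base
    vertex give exactness at the vertices. *)

Section LinearMaps.
Variable R : nzRingType.
Implicit Types U V W : lmodType R.

(** The proof of linearity is kept as an argument, so that a bare function together with such a
    proof can be given a canonical linear structure. *)
Definition linear_fun U V (f : U -> V) of linear f := f.

HB.instance Definition _ U V (f : U -> V) (fl : linear f) :=
  GRing.isLinear.Build R U V *:%R (linear_fun fl) fl.

(** Two values related to the same vector differ by a value related to [0], so a total linear
    relation of this kind is a graph. This yields linear maps that are defined through choices, such
    as inverses and connecting maps. *)
Lemma linear_of_rel V W (r : V -> W -> Prop) :
  (forall a v w v' w', r v w -> r v' w' -> r (a *: v + v') (a *: w + w')) ->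
  (forall v, exists w, r v w) -> (forall w, r 0 w -> w = 0) ->
  exists f : {linear V -> W}, forall v, r v (f v).
Proof.
move=> rl /choice[f rf] r0.
have fl : linear f.
  move=> a u v; apply/esym/eqP; rewrite -subr_eq0 -scaleN1r; apply/eqP/r0.
  have := rl (-1) _ _ _ _ (rf (a *: u + v)) (rl a _ _ _ _ (rf u) (rf v)).
  by rewrite [X in X + _]scaleN1r addNr [X in r 0 X]addrC.
by exists (linear_fun fl).
Qed.

Definition lmod_iso U V := exists (f : {linear U -> V}) (g : {linear V -> U}),
  cancel f g /\ cancel g f.

Lemma bij_lmod_iso U V (f : {linear U -> V}) :
  (forall u, f u = 0 -> u = 0) -> (forall v, exists u, f u = v) -> lmod_iso U V.
Proof.
move=> f0 fs.
have [a v w v' w' <- <-|//|w|g gP] := @linear_of_rel _ _ (fun v u => f u = v).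
- by rewrite linearP.
- exact: f0.
exists f, g; split=> // u; apply/eqP; rewrite -subr_eq0; apply/eqP/f0.
by rewrite linearB gP subrr.
Qed.

Lemma lmod_iso_trans U V W : lmod_iso U V -> lmod_iso V W -> lmod_iso U W.
Proof.
case=> f [g [fg gf]] [f' [g' [fg' gf']]].
exists (f' \o f : {linear _ -> _}), (g \o g' : {linear _ -> _}).
by split=> x /=; rewrite ?fg' ?fg ?gf ?gf'.
Qed.

Lemma exactP U V W (f : {linear U -> V}) (g : {linear V -> W}) :
  is_exact f g <-> (forall u, g (f u) = 0) /\
                   (forall v, g v = 0 -> exists u, f u = v).
Proof.
split=> [e|[gf ex]].
  split=> [u|v gv0]; first by have : range f (f u) by []; rewrite e.
  have : (g @^-1` [set 0]) v by [].
  by rewrite -e => -[u _ <-]; exists u.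
apply/seteqP; split=> [_ [u _ <-]|v /ex[u <-]]; first exact: gf.
by exists u.
Qed.

Lemma exact_comp U V V' W (f : {linear U -> V}) (g : {linear V -> W})
    (h : {linear V -> V'}) (k : {linear V' -> V}) :
  cancel h k -> cancel k h ->
  is_exact f g -> is_exact (h \o f : {linear _ -> _}) (g \o k : {linear _ -> _}).
Proof.
move=> hk kh /exactP[gf ex]; apply/exactP; split=> [u|v /= /ex[u fu]] /=.
  by rewrite hk gf.
by exists u; rewrite fu kh.
Qed.

Lemma exact_compl U U' V W (f : {linear U -> V}) (g : {linear V -> W})
    (h : {linear U' -> U}) :
  (forall u, exists u', h u' = u) ->
  is_exact f g -> is_exact (f \o h : {linear _ -> _}) g.
Proof.
move=> hs /exactP[gf ex]; apply/exactP; split=> [u|v /= /ex[u fu]] /=.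
  by rewrite gf.
by have [u' hu'] := hs u; exists u'; rewrite hu' fu.
Qed.

Lemma exact_compr U V W W' (f : {linear U -> V}) (g : {linear V -> W})
    (h : {linear W -> W'}) :
  (forall w, h w = 0 -> w = 0) ->
  is_exact f g -> is_exact f (h \o g : {linear _ -> _}).
Proof.
move=> hi /exactP[gf ex]; apply/exactP; split=> [u|v /= /hi/ex[u fu]] /=.
  by rewrite gf linear0.
by exists u.
Qed.

End LinearMaps.

Section SubmodClosure.
Variables (R : nzRingType) (V : lmodType R) (S : submod V).
Notation inS := (S : set V).

Lemma submodD u v : inS u -> inS v -> inS (u + v).
Proof. by move=> Su Sv; rewrite -[u]scale1r; exact: submodP. Qed.

Lemma submodZ a u : inS u -> inS (a *: u).
Proof. by move=> Su; rewrite -[_ *: _]addr0; exact: submodP (submod0 S). Qed.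

Lemma submodB u v : inS u -> inS v -> inS (u - v).
Proof. by move=> Su Sv; rewrite addrC -scaleN1r; exact: submodP. Qed.

End SubmodClosure.

Section SubquotientClasses.
Variables (R : nzRingType) (V : lmodType R) (Z B : submod V).
Notation inZ := (Z : set V).
Notation inB := (B : set V).

(* The class of [z], with junk value [0] outside [Z]. *)
Definition sq_class (z : V) : subquot Z B :=
  if pselect (z \in submod_pred Z) is left zZ
  then quot_pi (restrict_submod Z B) (SubmodElt zZ) else 0.

Lemma sq_classE z (zZ : z \in submod_pred Z) :
  sq_class z = quot_pi (restrict_submod Z B) (SubmodElt zZ).
Proof.
by rewrite /sq_class; case: pselect => [zZ'|//]; congr quot_pi; apply: val_inj.
Qed.

Lemma sq_classP a u v : inZ u -> inZ v ->
  sq_class (a *: u + v) = a *: sq_class u + sq_class v.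
Proof.
move=> Zu Zv; rewrite (sq_classE (mem_set Zu)) (sq_classE (mem_set Zv)).
rewrite (sq_classE (mem_set (submodP a Zu Zv))) -linearP; congr quot_pi.
exact: val_inj.
Qed.

Lemma sq_class_surj x : exists2 z, inZ z & sq_class z = x.
Proof.
rewrite -[x]quot_reprK; case: (quot_repr x) => z zZ.
by exists z; [exact: set_mem zZ|exact: sq_classE].
Qed.

Lemma sq_class0 z : inZ z -> sq_class z = 0 <-> inB z.
Proof.
move=> Zz; rewrite (sq_classE (mem_set Zz)) -(linear0 (quot_pi _)).
by rewrite quot_piP subr0.
Qed.

Lemma sq_class_eq u v : inZ u -> inZ v -> inB (u - v) -> sq_class u = sq_class v.
Proof.
move=> Zu Zv Buv; apply/eqP; rewrite -subr_eq0 addrC -scaleN1r -sq_classP//.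
by rewrite scaleN1r addrC; apply/eqP/sq_class0 => //; exact: submodB.
Qed.

(** The relation descends to classes, where values at boundaries vanish; [r] may relate one cycle to
    many vectors as long as boundaries only have the value [0]. *)
Lemma sq_map_of_rel (U : lmodType R) (r : V -> U -> Prop) :
  (forall a v w v' w', r v w -> r v' w' -> r (a *: v + v') (a *: w + w')) ->
  (forall v, inZ v -> exists w, r v w) ->
  (forall v w, inZ v -> inB v -> r v w -> w = 0) ->
  exists f : {linear subquot Z B -> U},
    forall v w, inZ v -> r v w -> f (sq_class v) = w.
Proof.
move=> rl rt r0.
pose r' x w := exists v, [/\ inZ v, sq_class v = x & r v w].
have [a x w x' w' [v [Zv <- rv]] [v' [Zv' <- rv']]|x|w [v [Zv v0 rvw]]|f fP] :=
  @linear_of_rel _ _ _ r'.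
- exists (a *: v + v'); split; last exact: rl.
    exact: submodP.
  exact: sq_classP.
- have [v Zv <-] := sq_class_surj x.
  by have [w rvw] := rt _ Zv; exists w, v.
- by apply: r0 rvw => //; apply/sq_class0.
(* The value of [f] is known only at some representative [v'] of the class. As [v' - v] is in [B],
   the two values agree. *)
exists f => v w Zv rvw; have [v' [Zv' vv' rv']] := fP (sq_class v).
apply/eqP; rewrite -subr_eq0 addrC -scaleN1r; apply/eqP.
apply: (r0 _ _ _ _ (rl (-1) _ _ _ _ rvw rv')); first exact: submodP.
apply/sq_class0; first exact: submodP.
by rewrite sq_classP// vv' scaleN1r addNr.
Qed.

End SubquotientClasses.
Arguments sq_class {R V} Z B z.

(** * Long exact sequences *)

Section SubquotientMaps.
Variables (R : nzRingType).
Implicit Types V W : lmodType R.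

Lemma sq_map_ex V W (Z B : submod V) (Z' B' : submod W) (f : {linear V -> W}) :
  (forall z, (Z : set V) z -> (Z' : set W) (f z)) ->
  (forall z, (Z : set V) z -> (B : set V) z -> (B' : set W) (f z)) ->
  exists F : {linear subquot Z B -> subquot Z' B'},
    forall z, (Z : set V) z -> F (sq_class Z B z) = sq_class Z' B' (f z).
Proof.
move=> fZ fB.
have [|v Zv|v w Zv Bv [_ ->]|F FP] := @sq_map_of_rel R V Z B (subquot Z' B')
    (fun z w => (Z : set V) z /\ w = sq_class Z' B' (f z)).
- move=> a v _ v' _ [Zv ->] [Zv' ->]; split; first exact: submodP.
  by rewrite linearP sq_classP//; exact: fZ.
- by exists (sq_class Z' B' (f v)).
- by apply/sq_class0; [exact: fZ|exact: fB].
by exists F => z Zz; exact: FP.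
Qed.

(** Bijectivity is asked of [f] only up to boundaries, so the criterion covers homotopy equivalences
    as well as isomorphisms of complexes. *)
Lemma sq_map_iso V W (Z B : submod V) (Z' B' : submod W) (f : {linear V -> W}) :
  (forall z, (Z : set V) z -> (Z' : set W) (f z)) ->
  (forall z, (Z : set V) z -> (B : set V) z <-> (B' : set W) (f z)) ->
  (forall w, (Z' : set W) w ->
     exists2 z, (Z : set V) z & (B' : set W) (w - f z)) ->
  lmod_iso (subquot Z B) (subquot Z' B').
Proof.
move=> fZ fB fs; have [F FP] := sq_map_ex fZ (fun z Zz => (fB z Zz).1).
apply: (@bij_lmod_iso _ _ _ F) => [u|w].
  have [z Zz <-] := sq_class_surj u; rewrite FP// => /(sq_class0 _ (fZ _ Zz)) B'fz.
  by apply/sq_class0 => //; exact/fB.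
have [z' Zz' <-] := sq_class_surj w; have [z Zz Bz] := fs _ Zz'.
by exists (sq_class Z B z); rewrite FP//; apply/esym/sq_class_eq => //; exact: fZ.
Qed.

(* In a short exact sequence of complexes, this is what holds at each place of
   the (co)cycles [Z] and (co)boundaries [B], also at the end of the complex. *)
Record sq_ses (A B C : lmodType R) (i : {linear A -> B}) (p : {linear B -> C})
    (ZA BA : submod A) (ZB BB : submod B) (ZC BC : submod C) : Prop := SqSes {
  ses_inj : forall x, i x = 0 -> x = 0;
  ses_comp : forall x, p (i x) = 0;
  ses_ker : forall y, p y = 0 -> exists x, i x = y;
  ses_surj : forall z, exists y, p y = z;
  ses_iZ : forall x, (ZA : set A) x <-> (ZB : set B) (i x);
  ses_iB : forall x, (BA : set A) x -> (BB : set B) (i x);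
  ses_pZ : forall y, (ZB : set B) y -> (ZC : set C) (p y);
  ses_pB : forall z, (BC : set C) z <-> exists2 y, (BB : set B) y & p y = z;
  ses_BZ : forall y, (BB : set B) y -> (ZB : set B) y }.

Section Ses.
Variables (A B C : lmodType R) (i : {linear A -> B}) (p : {linear B -> C}).
Variables (ZA BA : submod A) (ZB BB : submod B) (ZC BC : submod C).
Hypothesis s : sq_ses i p ZA BA ZB BB ZC BC.

Definition ses_incl : {linear subquot ZA BA -> subquot ZB BB} :=
  projT1 (cid (sq_map_ex (fun x => (ses_iZ s x).1) (fun x _ => ses_iB s (x := x)))).

Lemma ses_inclE x : (ZA : set A) x ->
  ses_incl (sq_class ZA BA x) = sq_class ZB BB (i x).
Proof. by rewrite /ses_incl; case: cid => F /=; exact. Qed.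

Let pB y : (ZB : set B) y -> (BB : set B) y -> (BC : set C) (p y).
Proof. by move=> _ By; apply/(ses_pB s); exists y. Qed.

Definition ses_proj : {linear subquot ZB BB -> subquot ZC BC} :=
  projT1 (cid (sq_map_ex (ses_pZ s) pB)).

Lemma ses_projE x : (ZB : set B) x ->
  ses_proj (sq_class ZB BB x) = sq_class ZC BC (p x).
Proof. by rewrite /ses_proj; case: cid => F /=; exact. Qed.

Lemma ses_exact : is_exact ses_incl ses_proj.
Proof.
apply/exactP; split=> [u|v].
  have [x Zx <-] := sq_class_surj u; rewrite ses_inclE//.
  have Zix := (ses_iZ s x).1 Zx; rewrite ses_projE// (ses_comp s).
  by apply/sq_class0; exact: submod0.
have [z Zz <-] := sq_class_surj v; rewrite ses_projE//.
move=> /(sq_class0 _ (ses_pZ s Zz)) /(ses_pB s)[y By pyz].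
have [|x xP] := ses_ker s (y := z - y); first by rewrite linearB pyz subrr.
have Zx : (ZA : set A) x.
  by apply/(ses_iZ s); rewrite xP; apply: submodB => //; apply: (ses_BZ s).
exists (sq_class ZA BA x); rewrite ses_inclE// xP; apply: sq_class_eq => //.
  by apply: submodB => //; apply: (ses_BZ s).
by rewrite addrAC subrr add0r -scaleN1r; apply: submodZ.
Qed.

End Ses.

Section Connecting.
Variables (A1 B1 C1 : lmodType R) (i1 : {linear A1 -> B1}) (p1 : {linear B1 -> C1}).
Variables (ZA1 BA1 : submod A1) (ZB1 BB1 : submod B1) (ZC1 BC1 : submod C1).
Hypothesis s1 : sq_ses i1 p1 ZA1 BA1 ZB1 BB1 ZC1 BC1.
Variables (A2 B2 C2 : lmodType R) (i2 : {linear A2 -> B2}) (p2 : {linear B2 -> C2}).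
Variables (ZA2 BA2 : submod A2) (ZB2 BB2 : submod B2) (ZC2 BC2 : submod C2).
Hypothesis s2 : sq_ses i2 p2 ZA2 BA2 ZB2 BB2 ZC2 BC2.
Variables (dA : {linear A1 -> A2}) (dB : {linear B1 -> B2}) (dC : {linear C1 -> C2}).
Hypothesis di : forall x, dB (i1 x) = i2 (dA x).
Hypothesis dp : forall y, dC (p1 y) = p2 (dB y).
Hypothesis ZB1P : forall y, (ZB1 : set B1) y <-> dB y = 0.
Hypothesis ZC1P : forall z, (ZC1 : set C1) z <-> dC z = 0.
Hypothesis BA2P : forall x, (BA2 : set A2) x <-> exists x', dA x' = x.
Hypothesis BB2P : forall y, (BB2 : set B2) y <-> exists y', dB y' = y.

(** The snake relation: lift [z] through [p1], differentiate, and pull back along [i2]. Both the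
    lift and the pullback are left free. *)
Let r z w := exists b a, [/\ p1 b = z, i2 a = dB b & w = sq_class ZA2 BA2 a].

Let rZ b a : i2 a = dB b -> (ZA2 : set A2) a.
Proof.
by move=> e; apply/(ses_iZ s2); rewrite e; apply: (ses_BZ s2); apply/BB2P; exists b.
Qed.

Lemma connecting_ex : exists delta : {linear subquot ZC1 BC1 -> subquot ZA2 BA2},
  forall b a, dC (p1 b) = 0 -> i2 a = dB b ->
    delta (sq_class ZC1 BC1 (p1 b)) = sq_class ZA2 BA2 a.
Proof.
have [k v w v' w'|z Zz|z w Zz|delta dP] := @sq_map_of_rel _ _ ZC1 BC1 _ r.
- case=> [b [a [<- e ->]]] [b' [a' [<- e' ->]]].
  exists (k *: b + b'), (k *: a + a'); rewrite !linearP e e'; split=> //.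
  by apply/esym/sq_classP; [exact: rZ e|exact: rZ e'].
- have [b bz] := ses_surj s1 z; have [|a ab] := ses_ker s2 (y := dB b).
    by rewrite -dp bz; exact/ZC1P.
  by exists (sq_class ZA2 BA2 a), b, a.
(* A boundary [z] also has a lift [b'] which is a boundary, hence a cycle. The difference of the
   lifts comes from some [a'], and [dA a' = a]. *)
- move=> /(ses_pB s1)[b' Bb' b'z] [b [a [bz ab ->]]].
  have [|a' a'P] := ses_ker s1 (y := b - b'); first by rewrite linearB b'z bz subrr.
  apply/sq_class0; first exact: rZ ab.
  apply/BA2P; exists a'; apply/eqP; rewrite -subr_eq0; apply/eqP/(ses_inj s2).
  rewrite linearB -di a'P ab linearB.
  by rewrite (ZB1P b').1 ?subr0 ?subrr//; exact: (ses_BZ s1).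
exists delta => b a bZ ab; apply: dP; first exact/ZC1P.
by exists b, a.
Qed.

Definition connecting := projT1 (cid connecting_ex).

Lemma connectingE b a : dC (p1 b) = 0 -> i2 a = dB b ->
  connecting (sq_class ZC1 BC1 (p1 b)) = sq_class ZA2 BA2 a.
Proof. by rewrite /connecting; case: cid => F /=; exact. Qed.

Lemma exact_proj_connecting : is_exact (ses_proj s1) connecting.
Proof.
apply/exactP; split=> [u|v].
  have [b Zb <-] := sq_class_surj u; rewrite ses_projE//.
  have b0 : dB b = 0 by exact/ZB1P.
  rewrite (@connectingE b 0); last 2 first.
  - by rewrite dp b0 linear0.
  - by rewrite b0 linear0.
  by apply/sq_class0; exact: submod0.
have [z Zz <-] := sq_class_surj v; have [b bz] := ses_surj s1 z.
have dz : dC (p1 b) = 0 by rewrite bz; exact/ZC1P.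
have [|a ab] := ses_ker s2 (y := dB b); first by rewrite -dp.
rewrite -bz (connectingE dz ab) => /(sq_class0 _ (rZ ab)) /BA2P[a' a'a].
(* The lift [b] becomes a cycle after subtracting [i1 a'], which does not change its image under
   [p1]. *)
have Zy : (ZB1 : set B1) (b - i1 a').
  by apply/ZB1P; rewrite linearB di a'a ab subrr.
exists (sq_class ZB1 BB1 (b - i1 a')); rewrite ses_projE//.
by rewrite linearB (ses_comp s1) subr0.
Qed.

Lemma exact_connecting_incl : is_exact connecting (ses_incl s2).
Proof.
apply/exactP; split=> [u|v].
  have [z Zz <-] := sq_class_surj u; have [b bz] := ses_surj s1 z.
  have dz : dC (p1 b) = 0 by rewrite bz; exact/ZC1P.
  have [|a ab] := ses_ker s2 (y := dB b); first by rewrite -dp.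
  rewrite -bz (connectingE dz ab) ses_inclE; last exact: rZ ab.
  apply/sq_class0; first by apply/(ses_iZ s2); exact: rZ ab.
  by rewrite ab; apply/BB2P; exists b.
have [a Za <-] := sq_class_surj v; rewrite ses_inclE//.
move=> /(sq_class0 _ ((ses_iZ s2 _).1 Za)) /BB2P[b ba].
exists (sq_class ZC1 BC1 (p1 b)); apply: connectingE => //.
by rewrite dp ba (ses_comp s2).
Qed.

End Connecting.
End SubquotientMaps.

Section LongExactSequences.
Variables (R : nzRingType) (A B C : nat -> lmodType R).

Section Cohomology.
Variables (dA : forall n, {linear A n -> A n.+1}) (dB : forall n, {linear B n -> B n.+1})
  (dC : forall n, {linear C n -> C n.+1}).
Variables (i : forall n, {linear A n -> B n}) (p : forall n, {linear B n -> C n}).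
Hypothesis dBK : forall n x, dB n.+1 (dB n x) = 0.
Hypothesis di : forall n x, dB n (i n x) = i n.+1 (dA n x).
Hypothesis dp : forall n x, dC n (p n x) = p n.+1 (dB n x).
Hypothesis i_inj : forall n x, i n x = 0 -> x = 0.
Hypothesis pi0 : forall n x, p n (i n x) = 0.
Hypothesis p_ker : forall n y, p n y = 0 -> exists x, i n x = y.
Hypothesis p_surj : forall n z, exists y, p n y = z.

Lemma cohomology_ses n : sq_ses (i n) (p n)
  (ker_submod (dA n)) (coboundaries dA n)
  (ker_submod (dB n)) (coboundaries dB n)
  (ker_submod (dC n)) (coboundaries dC n).
Proof.
split; [exact: i_inj|exact: pi0|exact: p_ker|exact: p_surj|..].
- move=> x; split=> /=; rewrite di; [move=> ->; exact: linear0|exact: i_inj].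
- case: n => [x ->|n x [x' _ <-]]; first exact: linear0.
  by exists (i n x'); rewrite ?di.
- by move=> y /= y0; rewrite dp y0 linear0.
- case: n => [|n] z /=; split.
  + by move=> ->; exists 0 => //; rewrite linear0.
  + by move=> [y -> <-]; rewrite linear0.
  + case=> z' _ <-; have [y <-] := p_surj z'.
    by exists (dB n y); [exists y|rewrite dp].
  + by case=> _ [y' _ <-] <-; exists (p n y'); rewrite ?dp.
- by case: n => [y ->|n y [y' _ <-]]; [exact: linear0|exact: dBK].
Qed.

Theorem cohomology_les :
  exists (alpha : forall n, {linear cohomology dA n -> cohomology dB n})
    (beta : forall n, {linear cohomology dB n -> cohomology dC n})
    (delta : forall n, {linear cohomology dC n -> cohomology dA n.+1}),
  [/\ injective (alpha 0%N),
      forall n, is_exact (alpha n) (beta n),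
      forall n, is_exact (beta n) (delta n) &
      forall n, is_exact (delta n) (alpha n.+1)].
Proof.
exists (fun n => ses_incl (cohomology_ses n)), (fun n => ses_proj (cohomology_ses n)).
(* The connecting map ends in degree [n.+1], where coboundaries are an image; the special convention
   in degree 0 never occurs at its target. *)
have imP (D : nat -> lmodType R) (d : forall n, {linear D n -> D n.+1}) n x :
    (coboundaries d n.+1 : set _) x <-> exists x', d n x' = x.
  by split=> [[x' _ <-]|[x' <-]]; exists x'.
exists (fun n => connecting (cohomology_ses n) (cohomology_ses n.+1) (@di n) (@dp n)
  (fun _ => iff_refl _) (fun _ => iff_refl _) (imP _ dA n) (imP _ dB n)).
split=> [|n|n|n]; [|exact: ses_exact|exact: exact_proj_connecting
  |exact: exact_connecting_incl].
apply: raddf_inj => u; have [x Zx <-] := sq_class_surj u.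
rewrite /= ses_inclE// => /(sq_class0 _ ((ses_iZ (cohomology_ses 0) x).1 Zx)) /i_inj ->.
by apply/sq_class0 => //; exact: submod0.
Qed.

End Cohomology.

Section Homology.
Variables (dA : forall n, {linear A n.+1 -> A n}) (dB : forall n, {linear B n.+1 -> B n})
  (dC : forall n, {linear C n.+1 -> C n}).
Variables (i : forall n, {linear A n -> B n}) (p : forall n, {linear B n -> C n}).
Hypothesis dBK : forall n x, dB n (dB n.+1 x) = 0.
Hypothesis di : forall n x, dB n (i n.+1 x) = i n (dA n x).
Hypothesis dp : forall n x, dC n (p n.+1 x) = p n (dB n x).
Hypothesis i_inj : forall n x, i n x = 0 -> x = 0.
Hypothesis pi0 : forall n x, p n (i n x) = 0.
Hypothesis p_ker : forall n y, p n y = 0 -> exists x, i n x = y.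
Hypothesis p_surj : forall n z, exists y, p n y = z.

Lemma homology_ses n : sq_ses (i n) (p n)
  (cycles dA n) (im_submod (dA n))
  (cycles dB n) (im_submod (dB n))
  (cycles dC n) (im_submod (dC n)).
Proof.
split; [exact: i_inj|exact: pi0|exact: p_ker|exact: p_surj|..].
- case: n => [|n] x //; split=> /=; rewrite di; [move=> ->; exact: linear0|exact: i_inj].
- by move=> x [x' _ <-]; exists (i n.+1 x'); rewrite ?di.
- by case: n => [|n] y //= y0; rewrite dp y0 linear0.
- move=> z; split.
  + case=> z' _ <-; have [y <-] := p_surj z'.
    by exists (dB n y); [exists y|rewrite dp].
  + by case=> _ [y' _ <-] <-; exists (p n.+1 y'); rewrite ?dp.
- by case: n => [|n] y //= [y' _ <-]; exact: dBK.
Qed.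

Theorem homology_les :
  exists (alpha : forall n, {linear homology dA n -> homology dB n})
    (beta : forall n, {linear homology dB n -> homology dC n})
    (delta : forall n, {linear homology dC n.+1 -> homology dA n}),
  [/\ forall x, exists y, beta 0%N y = x,
      forall n, is_exact (alpha n) (beta n),
      forall n, is_exact (beta n.+1) (delta n) &
      forall n, is_exact (delta n) (alpha n)].
Proof.
exists (fun n => ses_incl (homology_ses n)), (fun n => ses_proj (homology_ses n)).
have imP (D D' : lmodType R) (d : {linear D -> D'}) x :
    (im_submod d : set _) x <-> exists x', d x' = x.
  by split=> [[x' _ <-]|[x' <-]]; exists x'.
exists (fun n => connecting (homology_ses n.+1) (homology_ses n) (@di n) (@dp n)
  (fun _ => iff_refl _) (fun _ => iff_refl _) (imP _ _ (dA n)) (imP _ _ (dB n))).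
split=> [x|n|n|n]; [|exact: ses_exact|exact: exact_proj_connecting
  |exact: exact_connecting_incl].
have [z Zz <-] := sq_class_surj x; have [y yz] := p_surj z.
by exists (sq_class _ _ y); rewrite ses_projE// yz.
Qed.

End Homology.
End LongExactSequences.

(** * Direct products and direct sums *)

Lemma dep_choice (T : Type) (U : T -> Type) (P : forall t, U t -> Prop) :
  (forall t, exists u, P t u) -> exists f : forall t, U t, forall t, P t (f t).
Proof.
by move=> ex; exists (fun t => projT1 (cid (ex t))) => t; exact: (projT2 (cid (ex t))).
Qed.

Section DirectSums.
Variables (R : nzRingType) (I : Type).
Implicit Types F : I -> lmodType R.

Lemma dirprod_ext F (f g : dirprod F) : (forall i, f i = g i) -> f = g.
Proof. exact: functional_extensionality_dep. Qed.

Definition dcoef F (u : dirsum F) : dirprod F := val u.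

Lemma dcoef_linear F i : linear (fun u : dirsum F => dcoef u i).
Proof. by []. Qed.

Lemma dcoefP F a (u v : dirsum F) i :
  dcoef (a *: u + v) i = a *: dcoef u i + dcoef v i.
Proof. exact: (@dcoef_linear F i). Qed.

Lemma dcoef0 F i : dcoef (0 : dirsum F) i = 0. Proof. by []. Qed.

Lemma dcoefB F (u v : dirsum F) i : dcoef (u - v) i = dcoef u i - dcoef v i.
Proof. by []. Qed.

Lemma dcoef_inj F (u v : dirsum F) : (forall i, dcoef u i = dcoef v i) -> u = v.
Proof. by move=> uv; apply/val_inj/dirprod_ext. Qed.

Lemma dcoef_finite F (u : dirsum F) : finite_set [set i | dcoef u i <> 0].
Proof. exact: set_mem (valP u). Qed.

Definition dirsum_of F (f : dirprod F) (ff : finite_set [set i | f i <> 0]) :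
  dirsum F := SubmodElt (mem_set (ff : (dirsum_submod F : set _) f)).

(** Summands depend on an index type without decidable equality, so the entry is transported along a
    classically obtained proof of [i = j]. *)
Definition din_fun F i (x : F i) : dirprod F := fun j =>
  if pselect (i = j) is left e then eq_rect i (fun k => F k) x j e else 0.

Lemma din_fun_id F i (x : F i) : din_fun x i = x.
Proof.
rewrite /din_fun; case: pselect => // e.
by rewrite (Prop_irrelevance e erefl).
Qed.

Lemma din_fun_neq F i (x : F i) j : i <> j -> din_fun x j = 0.
Proof. by rewrite /din_fun; case: pselect. Qed.

Lemma din_finite F i (x : F i) : finite_set [set j | din_fun x j <> 0].
Proof.
apply: sub_finite_set (finite_set1 i) => j /= xj.
by have [->//|/(@din_fun_neq _ _ x)] := pselect (i = j).
Qed.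

Definition din F i (x : F i) : dirsum F := dirsum_of (@din_finite F i x).

Lemma din_id F i (x : F i) : dcoef (din x) i = x. Proof. exact: din_fun_id. Qed.

Lemma din_neq F i (x : F i) j : i <> j -> dcoef (din x) j = 0.
Proof. exact: din_fun_neq. Qed.

Lemma din_linear F i : linear (@din F i).
Proof.
move=> a x y; apply: dcoef_inj => j; rewrite dcoefP.
have [<-|ij] := pselect (i = j); first by rewrite !din_id.
by rewrite !din_neq// scaler0 addr0.
Qed.

HB.instance Definition _ F i :=
  GRing.isLinear.Build R (F i) (dirsum F) *:%R (@din F i) (@din_linear F i).

(** Induction on a finite list containing the support, removing one entry at a time. *)
Lemma dirsum_ind F (S : submod (dirsum F)) :
  (forall i (x : F i), (S : set _) (din x)) -> forall u, (S : set _) u.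
Proof.
move=> Sd u; have /(@finite_seqP {classic I})[s us] := dcoef_finite u.
have {us} : forall i : {classic I}, dcoef u i <> 0 -> i \in s.
  by move=> i ui; have : [set i | dcoef u i <> 0] i by []; rewrite us.
elim: s u => [|i s IH] u us.
  suff -> : u = 0 by exact: submod0.
  apply: dcoef_inj => i; rewrite dcoef0; apply: contrapT => ui.
  by have := us _ ui.
rewrite -[u](subrK (din (dcoef u i))); apply: submodD; last exact: Sd.
apply: IH => j; rewrite dcoefB; have [<-|ij] := pselect (i = j).
  by rewrite din_id subrr.
rewrite din_neq// subr0 => /us; rewrite in_cons => /orP[/eqP ji|//].
by case: ij.
Qed.

Lemma dirsum_ext F (W : lmodType R) (f g : {linear dirsum F -> W}) :
  (forall i (x : F i), f (din x) = g (din x)) -> f =1 g.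
Proof.
move=> fg u; apply/eqP; rewrite -subr_eq0; apply/eqP.
have fgl : linear (fun u => f u - g u).
  by move=> a x y; rewrite (linearP f) (linearP g); rewrite scalerBr opprD addrACA.
apply: (@dirsum_ind F (ker_submod (linear_fun fgl))) => i x /=.
by rewrite /linear_fun fg subrr.
Qed.

Section Lift.
Variables (F : I -> lmodType R) (W : lmodType R) (h : forall i, {linear F i -> W}).

Definition dlift (u : dirsum F) : W :=
  \sum_(i \in [set: {classic I}]) h i (dcoef u i).

Lemma dlift_fset (A : {fset {classic I}}) (u : dirsum F) :
  [set i | dcoef u i <> 0] `<=` [set` A] ->
  dlift u = \sum_(i <- A) h i (dcoef u i).
Proof.
move=> uA; apply: fsbigTE => i iA; have [->|u0] := pselect (dcoef u i = 0).
  exact: linear0.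
by move: iA; rewrite [i \in A]uA.
Qed.

Lemma dlift_linear : linear dlift.
Proof.
move=> a u v.
have [A uA] := (@finite_fsetP {classic I} _).1 (dcoef_finite u).
have [B vB] := (@finite_fsetP {classic I} _).1 (dcoef_finite v).
have sA w : [set i | dcoef w i <> 0] `<=`
    [set i | dcoef u i <> 0] `|` [set i | dcoef v i <> 0] ->
    dlift w = \sum_(i <- (A `|` B : {fset {classic I}})%fset) h i (dcoef w i).
  by move=> wuv; apply: dlift_fset; rewrite set_fsetU -uA -vB.
have su := sA u (@subsetUl _ _ _); have sv := sA v (@subsetUr _ _ _).
rewrite su sv sA; last first.
  move=> i /= w0; have [u0|] := pselect (dcoef u i = 0); last by left.
  by right=> v0; apply: w0; rewrite dcoefP u0 v0 scaler0 addr0.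
rewrite scaler_sumr -big_split /=; apply: eq_bigr => i _.
by rewrite dcoefP linearP.
Qed.

HB.instance Definition _ := GRing.isLinear.Build R (dirsum F) W *:%R
  dlift dlift_linear.

Lemma dlift_din i (x : F i) : dlift (din x) = h i x.
Proof.
rewrite (@dlift_fset [fset (i : {classic I})]%fset).
  by rewrite big_seq_fset1 din_id.
move=> j /= xj; apply/fset1P.
by have [->//|/(@din_neq _ _ x)] := pselect (i = j).
Qed.

End Lift.

Definition dirprod_map_fun F F' (f : forall i, {linear F i -> F' i})
  (u : dirprod F) : dirprod F' := fun i => f i (u i).

Lemma dirprod_map_linear F F' (f : forall i, {linear F i -> F' i}) :
  linear (dirprod_map_fun f).
Proof. by move=> a u v; apply: dirprod_ext => i; exact: (linearP (f i)). Qed.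

Definition dirprod_map F F' (f : forall i, {linear F i -> F' i}) :
  {linear dirprod F -> dirprod F'} := linear_fun (dirprod_map_linear f).

Lemma dirsum_map_finite F F' (f : forall i, {linear F i -> F' i}) (u : dirsum F) :
  finite_set [set i | dirprod_map_fun f (dcoef u) i <> 0].
Proof.
apply: sub_finite_set (dcoef_finite u) => i /= fu0 u0; apply: fu0.
by rewrite /dirprod_map_fun u0 linear0.
Qed.

Definition dirsum_map_fun F F' (f : forall i, {linear F i -> F' i})
  (u : dirsum F) : dirsum F' := dirsum_of (@dirsum_map_finite F F' f u).

Lemma dirsum_map_linear F F' (f : forall i, {linear F i -> F' i}) :
  linear (dirsum_map_fun f).
Proof. by move=> a u v; apply: dcoef_inj => i; exact: (linearP (f i)). Qed.

Definition dirsum_map F F' (f : forall i, {linear F i -> F' i}) :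
  {linear dirsum F -> dirsum F'} := linear_fun (dirsum_map_linear f).

Lemma dirsum_mapE F F' (f : forall i, {linear F i -> F' i}) u i :
  dcoef (dirsum_map f u) i = f i (dcoef u i).
Proof. by []. Qed.

Lemma dirsum_map_din F F' (f : forall i, {linear F i -> F' i}) i (x : F i) :
  dirsum_map f (din x) = din (f i x).
Proof.
apply: dcoef_inj => j; rewrite dirsum_mapE.
have [<-|ij] := pselect (i = j); first by rewrite !din_id.
by rewrite !din_neq// linear0.
Qed.

Lemma dirprod_iso F F' : (forall i, lmod_iso (F i) (F' i)) ->
  lmod_iso (dirprod F) (dirprod F').
Proof.
move=> iso; pose f i := projT1 (cid (iso i)).
pose g i := projT1 (cid (projT2 (cid (iso i)))).
exists (dirprod_map f), (dirprod_map g); split=> u; apply: dirprod_ext => i.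
  by have [fg _] := projT2 (cid (projT2 (cid (iso i)))); exact: fg.
by have [_ gf] := projT2 (cid (projT2 (cid (iso i)))); exact: gf.
Qed.

Lemma dirsum_iso F F' : (forall i, lmod_iso (F i) (F' i)) ->
  lmod_iso (dirsum F) (dirsum F').
Proof.
move=> iso; pose f i := projT1 (cid (iso i)).
pose g i := projT1 (cid (projT2 (cid (iso i)))).
exists (dirsum_map f), (dirsum_map g); split=> u; apply: dcoef_inj => i.
  by have [fg _] := projT2 (cid (projT2 (cid (iso i)))); exact: fg.
by have [_ gf] := projT2 (cid (projT2 (cid (iso i)))); exact: gf.
Qed.

Lemma subquot_dirprod_iso F (Z B : submod (dirprod F)) (Zi Bi : forall i, submod (F i)) :
  (forall u, (Z : set _) u <-> forall i, (Zi i : set _) (u i)) ->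
  (forall u, (B : set _) u <-> forall i, (Bi i : set _) (u i)) ->
  lmod_iso (subquot Z B) (dirprod (fun i => subquot (Zi i) (Bi i))).
Proof.
move=> ZP BP.
pose r (u : dirprod F) (w : dirprod (fun i => subquot (Zi i) (Bi i))) :=
  (Z : set _) u /\ w = fun i => sq_class (Zi i) (Bi i) (u i).
have [|u Zu|u w Zu Bu [_ ->]|f fP] := @sq_map_of_rel _ _ Z B _ r.
- move=> a u _ v _ [Zu ->] [Zv ->]; split; first exact: submodP.
  by apply: dirprod_ext => i; apply/esym/sq_classP; exact: (ZP _).1.
- by exists (fun i => sq_class (Zi i) (Bi i) (u i)).
- apply: dirprod_ext => i; apply/sq_class0; first exact: (ZP _).1.
  exact: (BP _).1.
have {}fP u : (Z : set _) u ->
    f (sq_class Z B u) = fun i => sq_class (Zi i) (Bi i) (u i).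
  by move=> Zu; exact: fP.
apply: (@bij_lmod_iso _ _ _ f) => [x|w].
  have [u Zu <-] := sq_class_surj x; rewrite fP// => u0.
  apply/sq_class0 => //; apply/BP => i.
  apply: (sq_class0 _ ((ZP u).1 Zu i)).1.
  exact: (congr1 (fun w : dirprod _ => w i) u0).
have /dep_choice[u uP] : forall i, exists u, (Zi i : set _) u /\ sq_class (Zi i) (Bi i) u = w i.
  by move=> i; have [u Zu uw] := sq_class_surj (w i); exists u.
exists (sq_class Z B u); rewrite fP; last by apply/ZP => i; exact: (uP i).1.
by apply: dirprod_ext => i; exact: (uP i).2.
Qed.

Lemma subquot_dirsum_iso F (Z B : submod (dirsum F)) (Zi Bi : forall i, submod (F i)) :
  (forall u, (Z : set _) u <-> forall i, (Zi i : set _) (dcoef u i)) ->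
  (forall u, (B : set _) u <-> forall i, (Bi i : set _) (dcoef u i)) ->
  lmod_iso (subquot Z B) (dirsum (fun i => subquot (Zi i) (Bi i))).
Proof.
move=> ZP BP.
pose r (u : dirsum F) (w : dirsum (fun i => subquot (Zi i) (Bi i))) :=
  (Z : set _) u /\ forall i, dcoef w i = sq_class (Zi i) (Bi i) (dcoef u i).
have class0 i : sq_class (Zi i) (Bi i) 0 = 0 by apply/sq_class0; exact: submod0.
have [|u Zu|u w Zu Bu [_ uw]|f fP] := @sq_map_of_rel _ _ Z B _ r.
- move=> a u u' v v' [Zu uu'] [Zv vv']; split; first exact: submodP.
  by move=> i; rewrite !dcoefP uu' vv'; apply/esym/sq_classP; exact: (ZP _).1.
- have fin : finite_set [set i | sq_class (Zi i) (Bi i) (dcoef u i) <> 0].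
    apply: sub_finite_set (dcoef_finite u) => i /= cu u0; apply: cu.
    by rewrite u0 class0.
  by exists (dirsum_of fin).
- apply: dcoef_inj => i; rewrite uw dcoef0; apply/sq_class0; first exact: (ZP _).1.
  exact: (BP _).1.
apply: (@bij_lmod_iso _ _ _ f) => [x|w].
  have [u Zu <-] := sq_class_surj x => u0.
  apply/sq_class0 => //; apply/BP => i.
  apply: (sq_class0 _ ((ZP u).1 Zu i)).1.
  have fin : finite_set [set i | sq_class (Zi i) (Bi i) (dcoef u i) <> 0].
    apply: sub_finite_set (dcoef_finite u) => j /= cu uj; apply: cu.
    by rewrite uj class0.
  have := fP u (dirsum_of fin) Zu (conj Zu (fun _ => erefl)).
  by rewrite u0 => /(congr1 (fun w => dcoef w i)) /esym.
(* The representative [0] is imposed wherever the class vanishes; otherwise the chosen family might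
   have infinite support. *)
have /dep_choice[u uP] : forall i, exists u, [/\ (Zi i : set _) u,
    sq_class (Zi i) (Bi i) u = dcoef w i & dcoef w i = 0 -> u = 0].
  move=> i; have [w0|w0] := pselect (dcoef w i = 0).
    by exists 0; rewrite w0 class0; split=> //; exact: submod0.
  by have [u Zu uw] := sq_class_surj (dcoef w i); exists u.
have fin : finite_set [set i | u i <> 0].
  by apply: sub_finite_set (dcoef_finite w) => i /= u0 /(let: And3 _ _ h := uP i in h).
have Zu : (Z : set _) (dirsum_of fin) by apply/ZP => i; have [] := uP i.
exists (sq_class Z B (dirsum_of fin)); apply: fP => //.
by split=> // i; have [_ ->] := uP i.
Qed.

Lemma cohomology_dirprod_iso (C : I -> nat -> lmodType R)
    (d : forall i n, {linear C i n -> C i n.+1}) n :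
  lmod_iso (@cohomology R (fun n => dirprod (fun i => C i n))
              (fun n => dirprod_map (fun i => d i n)) n)
           (dirprod (fun i => cohomology (d i) n)).
Proof.
apply: subquot_dirprod_iso => [u|].
  split=> [/= u0 i|u0]; first exact: (congr1 (fun w : dirprod _ => w i) u0).
  exact: dirprod_ext.
case: n => [|n] u; split=> /=.
- by move=> ->.
- by move=> u0; exact: dirprod_ext.
- by move=> [v _ <-] i; exists (v i).
- move=> uB; have /dep_choice[v vP] : forall i, exists v, d i n v = u i.
    by move=> i; have [v _ vu] := uB i; exists v.
  by exists v => //; exact: dirprod_ext.
Qed.

Lemma homology_dirsum_iso (C : I -> nat -> lmodType R)
    (d : forall i n, {linear C i n.+1 -> C i n}) n :
  lmod_iso (@homology R (fun n => dirsum (fun i => C i n))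
              (fun n => dirsum_map (fun i => d i n)) n)
           (dirsum (fun i => homology (d i) n)).
Proof.
apply: subquot_dirsum_iso => u; last first.
  split=> [[v _ <-] i|uB]; first by exists (dcoef v i).
  (* As for classes, the preimage of [0] is chosen to be [0] so that [v] has finite support. *)
  have /dep_choice[v vP] : forall i, exists v, d i n v = dcoef u i /\ (dcoef u i = 0 -> v = 0).
    move=> i; have [u0|u0] := pselect (dcoef u i = 0).
      by exists 0; rewrite u0 linear0.
    by have [v _ vu] := uB i; exists v.
  have fin : finite_set [set i | v i <> 0].
    by apply: sub_finite_set (dcoef_finite u) => i /= v0 /(vP i).2.
  by exists (dirsum_of fin) => //; apply: dcoef_inj => i; exact: (vP i).1.
case: n u => [|n] u //; split=> [/= u0 i|u0].
  exact: (congr1 (fun w => dcoef w i) u0).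
by apply: dcoef_inj => i; exact: u0.
Qed.

End DirectSums.

Arguments din {R I F} i x.

(** * Discrete modules and injective resolutions *)

Lemma subgroupM (G : groupType) (H : subgroup G) x y :
  subgroup_set H x -> subgroup_set H y -> subgroup_set H (x * y)%g.
Proof.
move=> Hx Hy; rewrite -[y]invgK; apply: subgroup_div => //.
by rewrite -[y^-1%g]mul1g; apply: subgroup_div => //; exact: subgroup1.
Qed.

Lemma subgroupV (G : groupType) (H : subgroup G) x :
  subgroup_set H x -> subgroup_set H x^-1%g.
Proof.
by move=> Hx; rewrite -[x^-1%g]mul1g; apply: subgroup_div => //; exact: subgroup1.
Qed.

Section TopologicalGroups.
Variable G : topGroupType.

Lemma mulg_continuousl (x : G) : continuous (fun y : G => (x * y)%g).
Proof.
move=> y; apply: (@continuous_comp _ _ _ (fun y => (x, y)) (fun xy : G * G => (xy.1 * xy.2)%g)).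
  by apply: cvg_pair; [exact: cvg_cst|exact: cvg_id].
exact: mulg_continuous.
Qed.

Lemma mulg_continuousr (x : G) : continuous (fun y : G => (y * x)%g).
Proof.
move=> y; apply: (@continuous_comp _ _ _ (fun y => (y, x)) (fun xy : G * G => (xy.1 * xy.2)%g)).
  by apply: cvg_pair; [exact: cvg_id|exact: cvg_cst].
exact: mulg_continuous.
Qed.

Lemma subgroup_open (H : subgroup G) :
  nbhs (1%g : G) (subgroup_set H) -> open (subgroup_set H).
Proof.
move=> H1; rewrite openE => h Hh; rewrite /interior.
have : nbhs h ((fun y => (h^-1 * y)%g) @^-1` subgroup_set H).
  by apply: mulg_continuousl; rewrite mulVg.
apply: filterS => y /= Hy; rewrite -[y](mulVKg h).
exact: subgroupM.
Qed.

Lemma open_nbhs1 (H : subgroup G) :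
  open (subgroup_set H) -> nbhs (1%g : G) (subgroup_set H).
Proof. by move=> oH; apply: open_nbhs_nbhs; split=> //; exact: subgroup1. Qed.

Lemma nbhs1_conj (g : G) (U : set G) :
  nbhs (1%g : G) U -> nbhs (1%g : G) [set x | U (g^-1 * x * g)%g].
Proof.
move=> U1; apply: (@continuous_comp _ _ _ (fun x : G => (g^-1 * x)%g) (fun x : G => (x * g)%g)).
- exact: mulg_continuousl.
- exact: mulg_continuousr.
by rewrite /= mulg1 mulVg.
Qed.

End TopologicalGroups.

Lemma gactK (G : groupType) X (a : gaction G X) g : cancel (a g) (a g^-1%g).
Proof. by move=> x; rewrite -gactM mulVg gact1. Qed.

Lemma gactVK (G : groupType) X (a : gaction G X) g : cancel (a g^-1%g) (a g).
Proof. by move=> x; rewrite -gactM mulgV gact1. Qed.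

Section Homs.
Variable G : topGroupType.
Implicit Types A B C : dmod G.

Definition mk_hom A B (f : A -> B) (fl : linear f)
    (fG : forall g x, f (dact A g x) = dact B g (f x)) : hom A B :=
  SubmodElt (mem_set (conj fl fG : (hom_submod A B : set _) f)).

Lemma hom_ext A B (f g : hom A B) : (forall x, hom_fun f x = hom_fun g x) -> f = g.
Proof. by move=> fg; apply/val_inj/funext. Qed.

Lemma homPE A B a (f g : hom A B) x :
  hom_fun (a *: f + g) x = a *: hom_fun f x + hom_fun g x.
Proof. by []. Qed.

Lemma homBE A B (f g : hom A B) x : hom_fun (f - g) x = hom_fun f x - hom_fun g x.
Proof. by []. Qed.

Definition hom_id A : hom A A := @mk_hom A A id (fun _ _ _ => erefl) (fun _ _ => erefl).

Definition hom_comp A B C (f : hom B C) (g : hom A B) : hom A C := hom_post A f g.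

Lemma hom_compE A B C (f : hom B C) (g : hom A B) x :
  hom_fun (hom_comp f g) x = hom_fun f (hom_fun g x).
Proof. by []. Qed.

Section SubDmod.
Variables (B : dmod G) (S : submod B).
Hypothesis SG : forall g x, (S : set B) x -> (S : set B) (dact B g x).

Definition sub_act (g : G) (x : submod_type S) : submod_type S :=
  SubmodElt (mem_set (SG g (set_mem (valP x)))).

Lemma sub_act1 x : sub_act 1%g x = x.
Proof. by apply: val_inj; exact: gact1. Qed.

Lemma sub_actM g h x : sub_act (g * h)%g x = sub_act g (sub_act h x).
Proof. by apply: val_inj; exact: gactM. Qed.

Lemma sub_act_linear g : linear (sub_act g).
Proof. by move=> a x y; apply: val_inj; exact: (linearP (dact B g)). Qed.

Definition sub_action : gaction G (submod_type S) := Gaction sub_act1 sub_actM.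

Lemma sub_act_open x : open (subgroup_set (stab sub_action x)).
Proof.
have -> : subgroup_set (stab sub_action x) =
    subgroup_set (stab (dact B) (val x)).
  apply/seteqP; split=> g /= gx; first by rewrite -[in RHS]gx.
  exact: val_inj.
exact: dact_open.
Qed.

Definition sub_dmod : dmod G :=
  @Dmod G (submod_type S : lmodType rat) sub_action sub_act_linear sub_act_open.

Definition sub_dmod_val : hom sub_dmod B :=
  @mk_hom sub_dmod B val (fun _ _ _ => erefl) (fun _ _ => erefl).

End SubDmod.

Section Image.
Variables (A B : dmod G) (f : hom A B).

Lemma image_stable g x : (im_submod (hom_fun f) : set B) x ->
  (im_submod (hom_fun f) : set B) (dact B g x).
Proof. by move=> [y _ <-]; exists (dact A g y) => //; exact: hom_equivariant. Qed.

Definition image_dmod := sub_dmod image_stable.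

Definition image_of (x : A) : image_dmod :=
  SubmodElt (mem_set (imageT (hom_fun f) x : (im_submod (hom_fun f) : set B) _)).

Lemma image_of_subproof :
  linear image_of /\ forall g x, image_of (dact A g x) = dact image_dmod g (image_of x).
Proof.
split=> [a x y|g x]; apply: val_inj; first exact: (linearP (hom_fun f)).
exact: hom_equivariant.
Qed.

Definition image_hom : hom A image_dmod :=
  mk_hom (proj1 image_of_subproof) (proj2 image_of_subproof).

Lemma image_hom_surj y : exists x, hom_fun image_hom x = y.
Proof.
have [x _ xy] : (im_submod (hom_fun f) : set B) (val y) := set_mem (valP y).
by exists x; apply: val_inj.
Qed.

End Image.

(** The condition on kernels makes [u] factor through the image of [f]; injectivity of [J] is
    applied to the inclusion of that image in [B]. *)
Lemma injective_extension (A B J : dmod G) (f : hom A B) (u : hom A J) :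
  injective_object J -> (forall x, hom_fun f x = 0 -> hom_fun u x = 0) ->
  exists s : hom B J, forall x, hom_fun s (hom_fun f x) = hom_fun u x.
Proof.
move=> Jinj u0.
have uE x y : hom_fun f x = hom_fun f y -> hom_fun u x = hom_fun u y.
  move=> fxy; apply/eqP; rewrite -subr_eq0 -(linearB (hom_fun u)).
  by apply/eqP/u0; rewrite linearB /= fxy subrr.
have /choice[k kP] := @image_hom_surj _ _ f.
have fk y : hom_fun f (k y) = val y.
  by rewrite -[in RHS](kP y).
have vl : linear (fun y : image_dmod f => hom_fun u (k y)).
  by move=> a x y; rewrite -(linearP (hom_fun u)); apply: uE; rewrite linearP /= !fk.
have vG g (y : image_dmod f) :
    hom_fun u (k (dact _ g y)) = dact J g (hom_fun u (k y)).
  by rewrite -hom_equivariant; apply: uE; rewrite hom_equivariant !fk.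
have [|s sP] := Jinj _ _ (sub_dmod_val (@image_stable _ _ f)) (mk_hom vl vG).
  by move=> x y /val_inj.
exists s => x; have := congr1 (fun h => h (image_of f x)) sP.
by move=> /= ->; apply: uE; rewrite fk.
Qed.

(** [u] takes its values in the image of [f], onto which [A] surjects; the lift is made over this
    image. *)
Lemma projective_lift (P A B : dmod G) (f : hom A B) (u : hom P B) :
  projective_object P -> (forall p, exists x, hom_fun f x = hom_fun u p) ->
  exists s : hom P A, forall p, hom_fun f (hom_fun s p) = hom_fun u p.
Proof.
move=> Pproj fu.
have imu p : (im_submod (hom_fun f) : set B) (hom_fun u p).
  by have [x xp] := fu p; exists x.
pose v p : image_dmod f := SubmodElt (mem_set (imu p)).
have vl : linear v by move=> a x y; apply: val_inj; exact: (linearP (hom_fun u)).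
have vG g p : v (dact P g p) = dact (image_dmod f) g (v p).
  by apply: val_inj; exact: hom_equivariant.
have [s sP] := Pproj _ _ (image_hom f) (mk_hom vl vG) (@image_hom_surj _ _ f).
by exists s => p; exact: (congr1 (fun h => val (h p)) sP).
Qed.

End Homs.

(** Dependent choice for recursions in which the next term exists only if the current one is good:
    [Inv] is what makes the step possible and [P] is what is wanted of consecutive terms. *)
Lemma dep_nat_choice (T : nat -> Type) (Inv : forall n, T n -> Prop)
    (Q : T 0%N -> Prop) (P : forall n, T n -> T n.+1 -> Prop) :
  (exists x, Q x /\ Inv 0%N x) ->
  (forall n x, Inv n x -> exists y, P n x y /\ Inv n.+1 y) ->
  exists f : forall n, T n, Q (f 0%N) /\ forall n, P n (f n) (f n.+1).
Proof.
move=> ex0 exS; have [x0 [Qx0 Ix0]] := cid ex0.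
pose T' n := {x : T n | Inv n x}.
pose next n (x : T' n) : {y : T n.+1 | P n (projT1 x) y /\ Inv n.+1 y} :=
  cid (exS n _ (projT2 x)).
pose f := nat_rect T' (exist _ x0 Ix0)
  (fun n x => exist _ (projT1 (next n x)) (projT2 (next n x)).2).
by exists (fun n => projT1 (f n)); split=> // n; exact: (projT2 (next n (f n))).1.
Qed.

(** * Independence of the injective resolution *)

Section CompareInjective.
Variables (G : topGroupType) (M : dmod G).
Implicit Types I J : injective_resolution M.

Lemma ires_dd I n x : hom_fun (ires_d I n.+1) (hom_fun (ires_d I n) x) = 0.
Proof. by have /exactP[dd _] := ires_exact I n; exact: dd. Qed.

(** Each step extends [d_J f] along [d_I], for which it must vanish on the kernel of [d_I]: this is
    the invariant. It propagates because by exactness the next kernel is the image of [d_I]. *)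
Lemma ires_chain_map I J : exists f : forall n, hom (I n) (J n),
  (forall m, hom_fun (f 0%N) (hom_fun (ires_aug I) m) = hom_fun (ires_aug J) m) /\
  forall n x, hom_fun (f n.+1) (hom_fun (ires_d I n) x) =
              hom_fun (ires_d J n) (hom_fun (f n) x).
Proof.
pose Inv n (f : hom (I n) (J n)) := forall x, hom_fun (ires_d I n) x = 0 ->
  hom_fun (ires_d J n) (hom_fun f x) = 0.
apply: (@dep_nat_choice _ Inv
  (fun f : hom (I 0%N) (J 0%N) =>
     forall m, hom_fun f (hom_fun (ires_aug I) m) = hom_fun (ires_aug J) m)
  (fun n (f : hom (I n) (J n)) (f' : hom (I n.+1) (J n.+1)) =>
     forall x, hom_fun f' (hom_fun (ires_d I n) x) =
              hom_fun (ires_d J n) (hom_fun f x))) => [|n f fI].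
  have [|f fP] := injective_extension (f := ires_aug I) (u := ires_aug J)
      (@ires_injective _ _ J 0%N).
    by move=> x; rewrite -(linear0 (hom_fun (ires_aug I))) => /ires_aug_inj ->; rewrite linear0.
  exists f; split=> // x; have /exactP[_ ex] := ires_exact0 I => /ex[m <-].
  by rewrite fP; have /exactP[dd _] := ires_exact0 J; exact: dd.
have [|f' fP] := injective_extension (f := ires_d I n)
    (u := hom_comp (ires_d J n) f) (@ires_injective _ _ J n.+1); first exact: fI.
exists f'; split=> // x; have /exactP[_ ex] := ires_exact I n => /ex[y <-].
by rewrite fP; exact: ires_dd.
Qed.

(** A chain map that vanishes on [M] is null-homotopic: the next homotopy extends [f - d s] along
    [d_I], and the invariant says that this difference vanishes on the kernel of [d_I]. *)
Lemma ires_homotopy I J (f : forall n, hom (I n) (J n)) :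
  (forall m, hom_fun (f 0%N) (hom_fun (ires_aug I) m) = 0) ->
  (forall n x, hom_fun (f n.+1) (hom_fun (ires_d I n) x) =
               hom_fun (ires_d J n) (hom_fun (f n) x)) ->
  exists s : forall n, hom (I n.+1) (J n),
    (forall x, hom_fun (s 0%N) (hom_fun (ires_d I 0%N) x) = hom_fun (f 0%N) x) /\
    forall n x, hom_fun (s n.+1) (hom_fun (ires_d I n.+1) x) =
      hom_fun (f n.+1) x - hom_fun (ires_d J n) (hom_fun (s n) x).
Proof.
move=> f0 fd.
pose Inv n (s : hom (I n.+1) (J n)) := forall x, hom_fun (ires_d I n.+1) x = 0 ->
  hom_fun (f n.+1) x - hom_fun (ires_d J n) (hom_fun s x) = 0.
apply: (@dep_nat_choice _ Inv
  (fun s : hom (I 1%N) (J 0%N) =>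
     forall x, hom_fun s (hom_fun (ires_d I 0%N) x) = hom_fun (f 0%N) x)
  (fun n (s : hom (I n.+1) (J n)) (s' : hom (I n.+2) (J n.+1)) =>
     forall x, hom_fun s' (hom_fun (ires_d I n.+1) x) =
      hom_fun (f n.+1) x - hom_fun (ires_d J n) (hom_fun s x))) => [|n s sI].
  have [|s sP] := injective_extension (f := ires_d I 0%N) (u := f 0%N)
      (@ires_injective _ _ J 0%N).
    by move=> x; have /exactP[_ ex] := ires_exact0 I => /ex[m <-]; exact: f0.
  exists s; split=> // x; have /exactP[_ ex] := ires_exact I 0%N => /ex[y <-].
  by rewrite fd sP subrr.
have [|s' sP] := injective_extension (f := ires_d I n.+1)
    (u := f n.+1 - hom_comp (ires_d J n) s) (@ires_injective _ _ J n.+1); first exact: sI.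
exists s'; split=> // x; have /exactP[_ ex] := ires_exact I n.+1 => /ex[y <-].
by rewrite fd sP homBE linearB /= hom_compE ires_dd subr0 subrr.
Qed.

(** Comparison maps exist in both directions, and each composite differs from the identity by a
    null-homotopic map, hence by coboundaries on cocycles. *)
Theorem dcohomology_iso I J n : lmod_iso (dcohomology I n) (dcohomology J n).
Proof.
have [f [f0 fd]] := ires_chain_map I J; have [g [g0 gd]] := ires_chain_map J I.
have homotopic (K L : injective_resolution M) (u : forall n, hom (K n) (L n))
    (v : forall n, hom (L n) (K n)) :
    (forall m, hom_fun (u 0%N) (hom_fun (ires_aug K) m) = hom_fun (ires_aug L) m) ->
    (forall m, hom_fun (v 0%N) (hom_fun (ires_aug L) m) = hom_fun (ires_aug K) m) ->
    (forall n x, hom_fun (u n.+1) (hom_fun (ires_d K n) x) =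
              hom_fun (ires_d L n) (hom_fun (u n) x)) ->
    (forall n x, hom_fun (v n.+1) (hom_fun (ires_d L n) x) =
              hom_fun (ires_d K n) (hom_fun (v n) x)) ->
    forall n (z : hom (triv G) (K n)), hom_post _ (ires_d K n) z = 0 ->
    (coboundaries (fun k => hom_post (triv G) (ires_d K k) : {linear _ -> _}) n : set _)
      (z - hom_post _ (v n) (hom_post _ (u n) z)).
  move=> u0 v0 ud vd.
  have [|m|s [s0 sS]] := @ires_homotopy K K (fun n => hom_id (K n) - hom_comp (v n) (u n)).
  - by move=> m; rewrite homBE hom_compE u0 v0 subrr.
  - by move=> x; rewrite !homBE !hom_compE ud vd linearB.
  (* On a cocycle the homotopy term [s (d z)] vanishes. In degree 0 nothing remains, in degree
     [k.+1] the difference is the coboundary of [s z]. *)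
  case=> [|k] z dz.
    apply: hom_ext => q; rewrite homBE.
    have := s0 (hom_fun z q); rewrite homBE hom_compE => <-.
    have -> : hom_fun (ires_d K 0) (hom_fun z q) = 0.
      exact: (congr1 (fun w : hom _ _ => hom_fun w q) dz).
    by rewrite linear0.
  exists (hom_post _ (s k) z) => //; apply: hom_ext => q.
  have := sS k (hom_fun z q); rewrite homBE hom_compE => /esym/eqP.
  have -> : hom_fun (ires_d K k.+1) (hom_fun z q) = 0.
    exact: (congr1 (fun w : hom _ _ => hom_fun w q) dz).
  by rewrite linear0 subr_eq0 => /eqP /esym.
have post_d (K L : injective_resolution M) (u : forall n, hom (K n) (L n)) :
    (forall n x, hom_fun (u n.+1) (hom_fun (ires_d K n) x) =
              hom_fun (ires_d L n) (hom_fun (u n) x)) ->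
    forall k (z : hom (triv G) (K k)), hom_post _ (ires_d L k) (hom_post _ (u k) z) =
     hom_post _ (u k.+1) (hom_post _ (ires_d K k) z).
  by move=> ud k z; apply: hom_ext => q; rewrite !hom_compE -ud.
have post_B (K L : injective_resolution M) (u : forall n, hom (K n) (L n)) :
    (forall n x, hom_fun (u n.+1) (hom_fun (ires_d K n) x) =
              hom_fun (ires_d L n) (hom_fun (u n) x)) ->
    forall k (z : hom (triv G) (K k)),
    (coboundaries (fun k => hom_post (triv G) (ires_d K k) : {linear _ -> _}) k : set _) z ->
    (coboundaries (fun k => hom_post (triv G) (ires_d L k) : {linear _ -> _}) k : set _)
      (hom_post _ (u k) z).
  move=> ud [z ->|k z [y _ <-]]; first exact: (linear0 (hom_post (triv G) (u 0%N))).
  by exists (hom_post _ (u k) y) => //; exact: post_d.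
apply: (sq_map_iso (f := hom_post _ (f n) : {linear _ -> _})) => [z /= dz|z dz|w dw].
- by rewrite post_d// dz linear0.
- split=> [|/(post_B _ _ _ gd) Bz]; first exact: post_B.
  rewrite -[z](subrK (hom_post _ (g n) (hom_post _ (f n) z))).
  by apply: submodD => //; exact: homotopic.
- exists (hom_post _ (g n) w); first by rewrite /= post_d// dw linear0.
  exact: homotopic.
Qed.

End CompareInjective.

(** * Tensor products and projective resolutions *)

Lemma free_ind (R : nzRingType) X (S : submod (free_mod R X)) :
  (forall x, (S : set _) (free_delta R x)) -> forall u, (S : set _) u.
Proof.
move=> Sd; pose F := fun _ : X => (R^o : lmodType R).
apply: (@dirsum_ind R X F S) => x c.
have -> : din x c = c *: (free_delta R x : dirsum F).
  apply: (@dcoef_inj R X F) => y.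
  have -> : dcoef (c *: (free_delta R x : dirsum F)) y =
      c * (if `[< y = x >] then 1 else 0) by [].
  case: asboolP => [->|yx]; first by rewrite din_id mulr1.
  by rewrite din_neq ?mulr0// => /esym.
exact: submodZ.
Qed.

Section TensorTheory.
Variables (G : topGroupType) (M : dmod G).
Implicit Types P Q : dmod G.

Lemma tensor_ext P (W : lmodType rat) (f g : {linear tensor M P -> W}) :
  (forall p m, f (tens p m) = g (tens p m)) -> f =1 g.
Proof.
move=> fg x; rewrite -[x]quot_reprK; move: (quot_repr x) => u {x}.
apply/eqP; rewrite -subr_eq0; apply/eqP.
have fgl : linear (fun u => f (quot_pi (span_submod (@tensor_rel G M P)) u) -
                           g (quot_pi (span_submod (@tensor_rel G M P)) u)).
  move=> a v w; rewrite (linearP (quot_pi _)) (linearP f) (linearP g).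
  by rewrite scalerBr opprD addrACA.
apply: (@free_ind _ _ (ker_submod (linear_fun fgl))) => -[p m] /=.
by apply/eqP; rewrite subr_eq0; apply/eqP; exact: fg.
Qed.

Section Lift.
Variables (P : dmod G) (W : lmodType rat) (b : P -> M -> W).
Hypothesis bl : forall m, linear (fun p => b p m).
Hypothesis br : forall p, linear (b p).
Hypothesis bG : forall g p m, b (dact P g^-1%g p) m = b p (dact M g m).

Let pre : {linear free_mod rat (P * M) -> W} := free_lift (fun pm : P * M => b pm.1 pm.2).

Lemma tensor_lift_subproof v : (span_submod (@tensor_rel G M P) : set _) v -> pre v = 0.
Proof.
have blP m a p q : b (a *: p + q) m = a *: b p m + b q m := bl m a p q.
have brP p a m n : b p (a *: m + n) = a *: b p m + b p n := br p a m n.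
have bl0 m : b 0 m = 0 by have := blP m (-1) 0 0; rewrite scaler0 addr0 scaleN1r addNr.
have br0 p : b p 0 = 0 by have := brP p (-1) 0 0; rewrite scaler0 addr0 scaleN1r addNr.
apply: (_ : (span_submod (@tensor_rel G M P) : set _) v ->
            (ker_submod pre : set _) v); apply => {v} _ [] * /=.
all: rewrite linearB ?linearD ?linearZ /= !free_lift_delta /=.
- by rewrite -[X in b (X + _) _]scale1r blP scale1r -opprD subrr.
- by rewrite -[X in b _ (X + _)]scale1r brP scale1r -opprD subrr.
- by rewrite -[X in b X _]addr0 blP bl0 addr0 scalerN subrr.
- by rewrite -[X in b _ X]addr0 brP br0 addr0 scalerN subrr.
- by rewrite bG subrr.
Qed.

Definition tensor_lift : {linear tensor M P -> W} := quot_lift tensor_lift_subproof.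

Lemma tensor_liftE p m : tensor_lift (tens p m) = b p m.
Proof. exact: etrans (quot_liftE _ _) (free_lift_delta _ _). Qed.

End Lift.

Lemma tens_linearl P m : linear (fun p : P => tens p m : tensor M P).
Proof. by move=> a p q; rewrite tensDl tensZl. Qed.

Lemma tens_linearr P (p : P) : linear (fun m => tens p m : tensor M P).
Proof. by move=> a m n; rewrite tensDr tensZr. Qed.

Lemma tensor_mapE P Q (f : hom P Q) p m :
  tensor_map M f (tens p m) = tens (hom_fun f p) m.
Proof. exact: etrans (quot_liftE _ _) (free_lift_delta _ _). Qed.

Lemma tensor_map_comp P Q S (f : hom Q S) (g : hom P Q) x :
  tensor_map M (hom_comp f g) x = tensor_map M f (tensor_map M g x).
Proof.
apply: (tensor_ext (f := tensor_map M (hom_comp f g))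
  (g := tensor_map M f \o tensor_map M g : {linear _ -> _})) => p m.
by rewrite [RHS](congr1 _ (tensor_mapE _ _ _)) !tensor_mapE.
Qed.

Lemma tensor_map_id P x : tensor_map M (hom_id P) x = x.
Proof.
apply: (tensor_ext (f := tensor_map M (hom_id P)) (g := idfun : {linear _ -> _})) => p m.
by rewrite tensor_mapE.
Qed.

Lemma tensor_mapP P Q a (f g : hom P Q) x :
  tensor_map M (a *: f + g) x = a *: tensor_map M f x + tensor_map M g x.
Proof.
have l : linear (fun x => a *: tensor_map M f x + tensor_map M g x).
  move=> c u v; rewrite (linearP (tensor_map M f)) (linearP (tensor_map M g)).
  by rewrite !scalerDr !scalerA [a * c]mulrC addrACA.
apply: (tensor_ext (f := tensor_map M (a *: f + g)) (g := linear_fun l)) => p m.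
rewrite [RHS](congr2 _ (congr1 _ (tensor_mapE _ _ _)) (tensor_mapE _ _ _)).
by rewrite tensor_mapE homPE tensDl tensZl.
Qed.

Lemma tensor_mapB P Q (f g : hom P Q) x :
  tensor_map M (f - g) x = tensor_map M f x - tensor_map M g x.
Proof. by rewrite addrC -scaleN1r tensor_mapP scaleN1r addrC. Qed.

Lemma tensor_map_eq0 P Q (f : hom P Q) x :
  (forall p, hom_fun f p = 0) -> tensor_map M f x = 0.
Proof.
move=> f0; have -> : f = 0 by apply: hom_ext => p; rewrite f0.
have -> : (0 : hom P Q) = 0 - 0 by rewrite subrr.
by rewrite tensor_mapB subrr.
Qed.

End TensorTheory.

(** * Independence of the projective resolution *)

Section CompareProjective.
Variables (G : topGroupType) (N : dmod G).
Implicit Types P Q : projective_resolution N.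

Lemma pres_dd P n x : hom_fun (pres_d P n) (hom_fun (pres_d P n.+1) x) = 0.
Proof. by have /exactP[dd _] := pres_exact P n; exact: dd. Qed.

(** Dual to the injective case: the invariant says that [f (d y)] lies in the image of [d_Q], so
    that projectivity can lift it. *)
Lemma pres_chain_map P Q : exists f : forall n, hom (P n) (Q n),
  (forall x, hom_fun (pres_aug Q) (hom_fun (f 0%N) x) = hom_fun (pres_aug P) x) /\
  forall n x, hom_fun (pres_d Q n) (hom_fun (f n.+1) x) =
              hom_fun (f n) (hom_fun (pres_d P n) x).
Proof.
pose Inv n (f : hom (P n) (Q n)) := forall y, exists x,
  hom_fun (pres_d Q n) x = hom_fun f (hom_fun (pres_d P n) y).
apply: (@dep_nat_choice _ Inv
  (fun f : hom (P 0%N) (Q 0%N) =>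
     forall x, hom_fun (pres_aug Q) (hom_fun f x) = hom_fun (pres_aug P) x)
  (fun n (f : hom (P n) (Q n)) (f' : hom (P n.+1) (Q n.+1)) =>
     forall x, hom_fun (pres_d Q n) (hom_fun f' x) =
               hom_fun f (hom_fun (pres_d P n) x))) => [|n f fI].
  have [|f fP] := projective_lift (f := pres_aug Q) (u := pres_aug P)
      (@pres_projective _ _ P 0%N).
    by move=> x; exact: pres_aug_surj.
  exists f; split=> // x; have /exactP[_ ex] := pres_exact0 Q.
  apply: ex; rewrite /= fP; have /exactP[dd _] := pres_exact0 P; exact: dd.
have [|f' fP] := projective_lift (f := pres_d Q n)
    (u := hom_comp f (pres_d P n)) (@pres_projective _ _ P n.+1); first exact: fI.
exists f'; split=> // x; have /exactP[_ ex] := pres_exact Q n.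
by apply: ex; rewrite /= fP hom_compE pres_dd linear0.
Qed.

Lemma pres_homotopy P Q (f : forall n, hom (P n) (Q n)) :
  (forall x, hom_fun (pres_aug Q) (hom_fun (f 0%N) x) = 0) ->
  (forall n x, hom_fun (pres_d Q n) (hom_fun (f n.+1) x) =
               hom_fun (f n) (hom_fun (pres_d P n) x)) ->
  exists s : forall n, hom (P n) (Q n.+1),
    (forall x, hom_fun (pres_d Q 0%N) (hom_fun (s 0%N) x) = hom_fun (f 0%N) x) /\
    forall n x, hom_fun (pres_d Q n.+1) (hom_fun (s n.+1) x) =
      hom_fun (f n.+1) x - hom_fun (s n) (hom_fun (pres_d P n) x).
Proof.
move=> f0 fd.
pose Inv n (s : hom (P n) (Q n.+1)) := forall y, exists x,
  hom_fun (pres_d Q n.+1) x = hom_fun (f n.+1) y - hom_fun s (hom_fun (pres_d P n) y).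
apply: (@dep_nat_choice _ Inv
  (fun s : hom (P 0%N) (Q 1%N) =>
     forall x, hom_fun (pres_d Q 0%N) (hom_fun s x) = hom_fun (f 0%N) x)
  (fun n (s : hom (P n) (Q n.+1)) (s' : hom (P n.+1) (Q n.+2)) =>
     forall x, hom_fun (pres_d Q n.+1) (hom_fun s' x) =
       hom_fun (f n.+1) x - hom_fun s (hom_fun (pres_d P n) x))) => [|n s sI].
  have [|s sP] := projective_lift (f := pres_d Q 0%N) (u := f 0%N)
      (@pres_projective _ _ P 0%N).
    by move=> x; have /exactP[_ ex] := pres_exact0 Q; apply: ex; exact: f0.
  exists s; split=> // x; have /exactP[_ ex] := pres_exact Q 0%N.
  by apply: ex; rewrite linearB /= fd sP subrr.
have [|s' sP] := projective_lift (f := pres_d Q n.+1)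
    (u := f n.+1 - hom_comp s (pres_d P n)) (@pres_projective _ _ P n.+1); first exact: sI.
exists s'; split=> // x; have /exactP[_ ex] := pres_exact Q n.+1.
apply: ex; rewrite linearB /= fd sP homBE hom_compE pres_dd linear0 subr0.
exact: subrr.
Qed.

(** Tensoring with [M] is an additive functor, so it turns the homotopies between comparison maps
    into homotopies of the tensored complexes. *)
Theorem homology_tensor_iso (M : dmod G) P Q n :
  lmod_iso (homology (fun k => tensor_map M (pres_d P k)) n)
           (homology (fun k => tensor_map M (pres_d Q k)) n).
Proof.
have [f [f0 fd]] := pres_chain_map P Q; have [g [g0 gd]] := pres_chain_map Q P.
have homotopic (K L : projective_resolution N) (u : forall n, hom (K n) (L n))
    (v : forall n, hom (L n) (K n)) :
    (forall x, hom_fun (pres_aug L) (hom_fun (u 0%N) x) = hom_fun (pres_aug K) x) ->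
    (forall x, hom_fun (pres_aug K) (hom_fun (v 0%N) x) = hom_fun (pres_aug L) x) ->
    (forall n x, hom_fun (pres_d L n) (hom_fun (u n.+1) x) =
                 hom_fun (u n) (hom_fun (pres_d K n) x)) ->
    (forall n x, hom_fun (pres_d K n) (hom_fun (v n.+1) x) =
                 hom_fun (v n) (hom_fun (pres_d L n) x)) ->
    forall n (z : tensor M (K n)), (cycles (fun k => tensor_map M (pres_d K k)) n : set _) z ->
    (im_submod (tensor_map M (pres_d K n)) : set _)
      (z - tensor_map M (v n) (tensor_map M (u n) z)).
  move=> u0 v0 ud vd.
  have [x|k x|s [s0 sS]] := @pres_homotopy K K (fun n => hom_id (K n) - hom_comp (v n) (u n)).
  - by rewrite homBE linearB /= hom_compE v0 u0 subrr.
  - by rewrite !homBE linearB /= !hom_compE vd ud.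
  have phiE k (z : tensor M (K k)) : z - tensor_map M (v k) (tensor_map M (u k) z) =
      tensor_map M (hom_id (K k) - hom_comp (v k) (u k)) z.
    by rewrite tensor_mapB tensor_map_id tensor_map_comp.
  case=> [|k] z dz; rewrite phiE.
    exists (tensor_map M (s 0%N) z) => //; rewrite -tensor_map_comp.
    by congr (tensor_map M _ z); apply: hom_ext => x; rewrite hom_compE s0.
  have dz0 : tensor_map M (pres_d K k) z = 0 := dz.
  exists (tensor_map M (s k.+1) z) => //; rewrite -tensor_map_comp.
  have -> : hom_comp (pres_d K k.+1) (s k.+1) =
      (hom_id (K k.+1) - hom_comp (v k.+1) (u k.+1)) - hom_comp (s k) (pres_d K k).
    by apply: hom_ext => x; rewrite homBE !hom_compE sS.
  by rewrite [LHS]tensor_mapB [tensor_map M (hom_comp (s k) _) _]tensor_map_comp dz linear0 subr0.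
have tens_d (K L : projective_resolution N) (u : forall n, hom (K n) (L n)) :
    (forall n x, hom_fun (pres_d L n) (hom_fun (u n.+1) x) =
                 hom_fun (u n) (hom_fun (pres_d K n) x)) ->
    forall k z, tensor_map M (pres_d L k) (tensor_map M (u k.+1) z) =
     tensor_map M (u k) (tensor_map M (pres_d K k) z).
  move=> ud k z; rewrite -!tensor_map_comp; congr (tensor_map M _ z).
  by apply: hom_ext => x; exact: ud.
have tens_Z (K L : projective_resolution N) (u : forall n, hom (K n) (L n)) :
    (forall n x, hom_fun (pres_d L n) (hom_fun (u n.+1) x) =
                 hom_fun (u n) (hom_fun (pres_d K n) x)) ->
    forall k z, (cycles (fun k => tensor_map M (pres_d K k)) k : set _) z ->
      (cycles (fun k => tensor_map M (pres_d L k)) k : set _) (tensor_map M (u k) z).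
  move=> ud [//|k] z dz; have dz0 : tensor_map M (pres_d K k) z = 0 := dz.
  by apply: (etrans (tens_d _ _ _ ud _ _)); rewrite dz0 linear0.
have tens_B (K L : projective_resolution N) (u : forall n, hom (K n) (L n)) :
    (forall n x, hom_fun (pres_d L n) (hom_fun (u n.+1) x) =
                 hom_fun (u n) (hom_fun (pres_d K n) x)) ->
    forall k z, (im_submod (tensor_map M (pres_d K k)) : set _) z ->
      (im_submod (tensor_map M (pres_d L k)) : set _) (tensor_map M (u k) z).
  by move=> ud k _ [y _ <-]; exists (tensor_map M (u k.+1) y) => //; exact: tens_d.
apply: (sq_map_iso (f := tensor_map M (f n))) => [|z dz|w dw].
- exact: tens_Z.
- split=> [|/(tens_B _ _ _ gd) Bz]; first exact: tens_B.
  rewrite -[z](subrK (tensor_map M (g n) (tensor_map M (f n) z))).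
  by apply: submodD => //; exact: homotopic.
- by exists (tensor_map M (g n) w); [exact: tens_Z|exact: homotopic].
Qed.

End CompareProjective.

(** * Permutation modules *)

Section Bundles.
Variables (G : topGroupType) (X : Type) (b : gaction G X).

(* Sections with finite support of an equivariant bundle over the G-set [X] with
   constant fibre [P]; [th g x] maps the fibre over [x] to the fibre over [g x]. *)
Variables (P : lmodType rat) (th : G -> X -> {linear P -> P}).
Hypothesis th1 : forall x p, th 1%g x p = p.
Hypothesis thM : forall g h x p, th (g * h)%g x p = th g (b h x) (th h x p).
Hypothesis tho : forall x p, nbhs (1%g : G) [set g | b g x = x /\ th g x p = p].

Notation F := (fun _ : X => P).
Notation PX := (dirsum F).

Lemma bundle_act_finite (g : G) (u : PX) :
  finite_set [set x | th g (b g^-1%g x) (dcoef u (b g^-1%g x)) <> 0].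
Proof.
apply: sub_finite_set (finite_image (b g) (dcoef_finite u)) => x /= ux.
exists (b g^-1%g x); last exact: gactVK.
by move=> u0; apply: ux; rewrite u0 linear0.
Qed.

Definition bundle_act (g : G) (u : PX) : PX := dirsum_of (bundle_act_finite g u).

Lemma bundle_actE g u x :
  dcoef (bundle_act g u) x = th g (b g^-1%g x) (dcoef u (b g^-1%g x)).
Proof. by []. Qed.

Lemma bundle_act1 u : bundle_act 1%g u = u.
Proof. by apply: dcoef_inj => x; rewrite bundle_actE invg1 !gact1 th1. Qed.

Lemma bundle_actM g h u : bundle_act (g * h)%g u = bundle_act g (bundle_act h u).
Proof.
by apply: dcoef_inj => x; rewrite !bundle_actE invgM !gactM thM gactVK.
Qed.

Definition bundle_action : gaction G PX := Gaction bundle_act1 bundle_actM.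

Lemma bundle_act_linear g : linear (bundle_act g).
Proof.
move=> a u v; apply: dcoef_inj => x.
by rewrite dcoefP !bundle_actE dcoefP linearP.
Qed.

Lemma bundle_act_din g x (p : P) :
  bundle_act g (@din _ _ F x p) = @din _ _ F (b g x) (th g x p).
Proof.
apply: dcoef_inj => y; rewrite bundle_actE.
have [<-|xy] := pselect (b g x = y); first by rewrite gactK !din_id.
rewrite !din_neq ?linear0// => xy'; apply: xy.
by rewrite xy' gactVK.
Qed.

(** The vectors whose stabiliser is a neighbourhood of [1] form a submodule, which contains every
    section supported at one point by [tho]. *)
Lemma bundle_act_nbhs (u : PX) : nbhs (1%g : G) [set g | bundle_act g u = u].
Proof.
pose A : set PX := [set u | nbhs (1%g : G) [set g | bundle_act g u = u]].
have A0 : A 0.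
  rewrite /A /=; suff -> : [set g | bundle_act g 0 = 0] = setT by exact: filterT.
  by apply/seteqP; split=> // g _; exact: (linear0 (linear_fun (bundle_act_linear g))).
have AP (a : rat) v w : A v -> A w -> A (a *: v + w).
  move=> nv nw; apply: (filterS _ (filterI nv nw)) => g /= [gv gw].
  by rewrite bundle_act_linear gv gw.
apply: (@dirsum_ind _ _ _ (Submod A0 AP) _ u) => x p /=.
apply: (filterS _ (tho x p)).
by move=> g /= [gx gp]; rewrite bundle_act_din gx gp.
Qed.

Lemma bundle_act_open u : open (subgroup_set (stab bundle_action u)).
Proof. by apply: subgroup_open; exact: bundle_act_nbhs. Qed.

Definition bundle_mod : dmod G :=
  @Dmod G (PX : lmodType rat) bundle_action bundle_act_linear bundle_act_open.

Definition bin (x : X) (p : P) : bundle_mod := @din _ _ F x p.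

Lemma bin_linear x : linear (bin x). Proof. exact: din_linear. Qed.

Lemma dact_bin g x p : dact bundle_mod g (bin x p) = bin (b g x) (th g x p).
Proof. exact: bundle_act_din. Qed.

Lemma bundle_ext (W : lmodType rat) (f g : bundle_mod -> W) : linear f -> linear g ->
  (forall x p, f (bin x p) = g (bin x p)) -> f =1 g.
Proof.
by move=> fl gl fg; apply: (dirsum_ext (f := linear_fun fl) (g := linear_fun gl)).
Qed.

Lemma bundle_lift (B : dmod G) (h : X -> {linear P -> B}) :
  (forall g x p, h (b g x) (th g x p) = dact B g (h x p)) ->
  exists f : hom bundle_mod B, forall x p, hom_fun f (bin x p) = h x p.
Proof.
move=> hG; have fl : linear (dlift h : bundle_mod -> B) := dlift_linear h.
have fG g u : dlift h (dact bundle_mod g u) = dact B g (dlift h u).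
  move: u; apply: bundle_ext.
  - by move=> a u v; rewrite (linearP (dact bundle_mod g)) fl.
  - by move=> a u v; rewrite fl (linearP (dact B g)).
  - by move=> x p; rewrite dact_bin /bin !dlift_din hG.
by exists (mk_hom fl fG) => x p; exact: dlift_din.
Qed.

End Bundles.

Section PermutationModules.
Variables (G : topGroupType) (X : Type) (b : gaction G X).
Hypothesis bo : forall x, open (subgroup_set (stab b x)).

Section Action.
Variable P : dmod G.

Lemma perm_nbhs x (p : P) : nbhs (1%g : G) [set g | b g x = x /\ dact P g p = p].
Proof. exact: (filterI (open_nbhs1 (bo x)) (open_nbhs1 (@dact_open G P p))). Qed.

(** The rational tensor product of the permutation module on [X] with [P], under the diagonal
    action. *)
Definition perm_mod : dmod G :=
  @bundle_mod G X b P (fun g _ => dact P g) (fun _ => gact1 (dact P))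
    (fun g h _ => gactM (dact P) g h) perm_nbhs.

Definition pin (x : X) (p : P) : perm_mod :=
  @bin G X b P (fun g _ => dact P g) _ _ perm_nbhs x p.

Lemma pin_linear x : linear (pin x). Proof. exact: bin_linear. Qed.

Lemma dact_pin g x p : dact perm_mod g (pin x p) = pin (b g x) (dact P g p).
Proof. exact: dact_bin. Qed.

Lemma perm_ext (W : lmodType rat) (f g : perm_mod -> W) : linear f -> linear g ->
  (forall x p, f (pin x p) = g (pin x p)) -> f =1 g.
Proof. exact: bundle_ext. Qed.

Lemma perm_lift (B : dmod G) (h : X -> {linear P -> B}) :
  (forall g x p, h (b g x) (dact P g p) = dact B g (h x p)) ->
  exists f : hom perm_mod B, forall x p, hom_fun f (pin x p) = h x p.
Proof. exact: bundle_lift. Qed.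

End Action.

Lemma perm_map_equivariant (P Q : dmod G) (f : hom P Q) g (u : perm_mod P) :
  dirsum_map (fun _ => hom_fun f) (dact (perm_mod P) g u) =
  dact (perm_mod Q) g (dirsum_map (fun _ => hom_fun f) u).
Proof. by apply: dcoef_inj => x; exact: hom_equivariant. Qed.

Definition perm_map (P Q : dmod G) (f : hom P Q) : hom (perm_mod P) (perm_mod Q) :=
  @mk_hom G (perm_mod P) (perm_mod Q) (dirsum_map (fun _ => hom_fun f))
    (dirsum_map_linear _) (perm_map_equivariant f).

Lemma perm_map_pin (P Q : dmod G) (f : hom P Q) x p :
  hom_fun (perm_map f) (pin x p) = pin x (hom_fun f p).
Proof. exact: dirsum_map_din. Qed.

(** * Frobenius reciprocity over the orbits *)

Section OrbitDecomposition.
Variables (J : Type) (s : J -> X) (K : J -> subgroup G).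
Hypothesis KP : forall j g, subgroup_set (K j) g <-> b g (s j) = s j.
Hypothesis sP : forall x, exists! j, exists g, b g (s j) = x.

Lemma val_stab j (k : K j) : b (val k) (s j) = s j.
Proof. by apply/KP; exact: (set_mem (valP k)). Qed.

(** A representative and a transporter are chosen at each point. Any other transporter differs from
    [t x] by an element of the stabiliser, so formulas written with [t x] can be evaluated at
    whichever [g] is convenient. *)
Lemma orbit_rep : exists (r : X -> J) (t : X -> G),
  (forall x, b (t x) (s (r x)) = x) /\
  forall x j g, b g (s j) = x -> r x = j /\ exists k : K (r x), g = (t x * val k)%g.
Proof.
have /choice[rt rtP] : forall x, exists jg : J * G, b jg.2 (s jg.1) = x.
  by move=> x; have [j [[g gj] _]] := sP x; exists (j, g).
exists (fst \o rt), (snd \o rt); split=> [x|x j g gj] /=; first exact: rtP.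
have rj : (rt x).1 = j.
  have [j0 [_ j0u]] := sP x.
  by rewrite -(j0u j); [rewrite -(j0u (rt x).1)//; exists (rt x).2; exact: rtP|exists g].
split=> //.
have Kk : ((rt x).2^-1 * g)%g \in subgroup_pred (K (rt x).1).
  apply/mem_set/KP; rewrite gactM {1}rj gj.
  by apply: (canLR (gactK b _)); rewrite rtP.
by exists (SubgroupElt Kk); rewrite /= mulVKg.
Qed.

Section HomDecomposition.
Variable I : dmod G.

Lemma hom_ev_subproof (u : hom (perm_mod (triv G)) I) j :
  (hom_submod (triv (K j)) (res I (K j)) : set _)
    (fun q : triv (K j) => hom_fun u (pin (P := triv G) (s j) q)).
Proof.
split=> [a p q|k q]; first by rewrite pin_linear linearP.
rewrite [RHS](_ : _ = dact I (val k) (hom_fun u (pin (P := triv G) (s j) q)))//.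
by rewrite -hom_equivariant dact_pin val_stab.
Qed.

(** Frobenius reciprocity for all orbits at once, as evaluation at the representatives. *)
Definition hom_ev (u : hom (perm_mod (triv G)) I) :
    dirprod (fun j => hom (triv (K j)) (res I (K j))) :=
  fun j => SubmodElt (mem_set (hom_ev_subproof u j)).

Lemma hom_evE u j q : hom_fun (hom_ev u j) q = hom_fun u (pin (P := triv G) (s j) q).
Proof. by []. Qed.

Lemma hom_ev_linear : linear hom_ev.
Proof. by move=> a u v; apply: dirprod_ext => j; apply: hom_ext => q. Qed.

Lemma hom_ev_inj u : hom_ev u = 0 -> u = 0.
Proof.
move=> u0; have uj j q : hom_fun u (pin (P := triv G) (s j) q) = 0.
  by rewrite -hom_evE u0.
apply: hom_ext; apply: perm_ext; [exact: hom_linear|exact: hom_linear|].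
move=> x q; have [j [[g <-] _]] := sP x.
have -> : pin (b g (s j)) q = dact (perm_mod (triv G)) g (pin (P := triv G) (s j) q).
  by rewrite dact_pin.
by rewrite hom_equivariant uj linear0.
Qed.

Lemma hom_ev_surj c : exists u, hom_ev u = c.
Proof.
have [r [t [tP rP]]] := orbit_rep.
pose h x (q : triv G) : I := dact I (t x) (hom_fun (c (r x)) q).
(* Independence of the transporter: an element of [K j] is absorbed by the equivariance of [c j]. *)
have hE x j g q : b g (s j) = x -> h x q = dact I g (hom_fun (c j) q).
  move=> gx; have [rj [k gk]] := rP _ _ _ gx; subst j.
  rewrite /h gk gactM; congr (dact I _ _).
  exact: (hom_equivariant (c (r x)) k q).
have hl x : linear (h x).
  move=> a p q; rewrite /h (linearP (hom_fun (c (r x)))).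
  exact: (linearP (dact I (t x))).
have [g x q|u uP] := @perm_lift (triv G) I (fun x => linear_fun (hl x)).
  rewrite /= /linear_fun (hE (b g x) (r x) (g * t x)%g); first by rewrite gactM.
  by rewrite gactM tP.
exists u; apply: dirprod_ext => j; apply: hom_ext => q.
rewrite hom_evE uP /= /linear_fun (hE _ j 1%g); first exact: gact1.
exact: gact1.
Qed.

End HomDecomposition.

Section TensorDecomposition.
Variable M : dmod G.
Notation "M |_ j" := (res M (K j)) (at level 20).

(** A tensor at [x] is carried back to the representative of its orbit. The transporter is ambiguous
    up to [K j], which the balancing relation over [K j] absorbs. *)
Lemma tensor_split_ex (P : dmod G) :
  exists f : {linear tensor M (perm_mod P) -> dirsum (fun j => tensor (M |_ j) (P |_ j))},
  forall x p m j g, b g (s j) = x ->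
    f (tens (pin x p) m) = din j (tens (dact P g^-1%g p : P |_ j) (dact M g^-1%g m : M |_ j)).
Proof.
have [r [t [tP rP]]] := orbit_rep.
pose W := dirsum (fun j => tensor (M |_ j) (P |_ j)).
pose h x (m : M) (p : P) : W :=
  din (r x) (tens (dact P (t x)^-1%g p : P |_ (r x)) (dact M (t x)^-1%g m : M |_ (r x))).
have hE x p m j g : b g (s j) = x -> h x m p =
    din j (tens (dact P g^-1%g p : P |_ j) (dact M g^-1%g m : M |_ j)).
  move=> gx; have [rj [k gk]] := rP _ _ _ gx; subst j.
  rewrite /h; congr din; rewrite gk invgM !gactM.
  set p' := dact P _ p; set m' := dact M _ m.
  rewrite -[in LHS](gactVK (dact M) (val k) m').
  exact: (esym (@tens_balanced _ (M |_ (r x)) (P |_ (r x)) k p' (dact M (val k)^-1%g m'))).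
have hlp x m : linear (h x m).
  by move=> a p q; rewrite /h (linearP (dact P _)) tens_linearl din_linear.
have hlm x p : linear (fun m => h x m p).
  by move=> a m n; rewrite /h (linearP (dact M _)) tens_linearr din_linear.
pose B (u : perm_mod P) (m : M) : W := dlift (fun x => linear_fun (hlp x m)) u.
have B_pin x p m : B (pin x p) m = h x m p by exact: dlift_din.
have Bl m : linear (fun u => B u m) by exact: dlift_linear.
have Br u : linear (B u).
  move=> a m n; move: u; apply: perm_ext => [|c u v|x p]; first exact: Bl.
    by rewrite !Bl !scalerDr !scalerA [a * c]mulrC addrACA.
  by rewrite !B_pin hlm.
(* Passing from [x] to [g^-1 x] replaces the transporter [t x] by [g^-1 * t x]: the two occurrences
   of [g] cancel on [p], and [g] appears on [m]. *)
have BG g u m : B (dact (perm_mod P) g^-1%g u) m = B u (dact M g m).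
  move: u; apply: perm_ext => [c u v||x p]; last 1 first.
  - rewrite dact_pin !B_pin (hE x _ _ (r x) (t x))// (hE _ _ _ (r x) (g^-1 * t x)%g).
      by rewrite invgM invgK !gactM gactVK.
    by rewrite gactM tP.
  - by rewrite (linearP (dact (perm_mod P) _)) Bl.
  - exact: Bl.
exists (tensor_lift Bl Br BG) => x p m j g gx.
by rewrite tensor_liftE B_pin; exact: hE.
Qed.

Definition tensor_split P := projT1 (cid (tensor_split_ex P)).

Lemma tensor_splitE P x p m j g : b g (s j) = x ->
  tensor_split P (tens (pin x p) m) =
    din j (tens (dact P g^-1%g p : P |_ j) (dact M g^-1%g m : M |_ j)).
Proof. exact: (projT2 (cid (tensor_split_ex P))). Qed.

Lemma tensor_perm_ext P (W : lmodType rat) (f g : {linear tensor M (perm_mod P) -> W}) :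
  (forall x p m, f (tens (pin x p) m) = g (tens (pin x p) m)) -> f =1 g.
Proof.
move=> fg; apply: tensor_ext => u m; move: u; apply: perm_ext => [a u v|a u v|x p].
- by rewrite tens_linearl linearP.
- by rewrite tens_linearl linearP.
- exact: fg.
Qed.

(** The inverse places the tensors of the component [j] at the point [s j]. Balancing over [G] shows
    that tensors at other points of the orbit are also reached. *)
Lemma tensor_split_bij P : exists g, cancel (tensor_split P) g /\ cancel g (tensor_split P).
Proof.
pose T j := tensor (M |_ j) (P |_ j).
have gj j : exists g : {linear T j -> tensor M (perm_mod P)},
    forall p m, g (tens p m) = tens (pin (s j) p) m.
  have bl (m : M |_ j) : linear (fun p : P |_ j => tens (pin (P := P) (s j) p) (m : M)).
    by move=> a p q; rewrite pin_linear tens_linearl.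
  have br (p : P |_ j) : linear (fun m : M |_ j => tens (pin (P := P) (s j) p) (m : M)).
    exact: (@tens_linearr _ M (perm_mod P) (pin (P := P) (s j) p)).
  have bG (k : K j) (p : P |_ j) (m : M |_ j) :
      tens (pin (P := P) (s j) (dact (P |_ j) k^-1%g p)) (m : M) =
      tens (pin (P := P) (s j) p) (dact (M |_ j) k m : M).
    have kj : b (val k)^-1%g (s j) = s j by rewrite -[in LHS](val_stab k) gactK.
    have -> : pin (P := P) (s j) (dact (P |_ j) k^-1%g p) =
        dact (perm_mod P) (val k)^-1%g (pin (P := P) (s j) p) by rewrite dact_pin kj.
    exact: (@tens_balanced _ M (perm_mod P) (val k) (pin (P := P) (s j) p) m).
  by exists (tensor_lift bl br bG) => p m; rewrite tensor_liftE.
pose g j := projT1 (cid (gj j)).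
have gE j p m : g j (tens p m) = tens (pin (s j) p) m := projT2 (cid (gj j)) p m.
exists (dlift g); split.
  apply: (tensor_perm_ext (f := dlift g \o tensor_split P : {linear _ -> _})
    (g := idfun : {linear _ -> _})) => x p m /=.
  have [j [[k kx] _]] := sP x.
  rewrite (tensor_splitE _ _ kx) dlift_din gE.
  have -> : pin (s j) (dact P k^-1%g p) = dact (perm_mod P) k^-1%g (pin x p).
    by rewrite dact_pin -kx gactK.
  by rewrite tens_balanced gactVK.
apply: (dirsum_ext (f := tensor_split P \o dlift g : {linear _ -> _})
    (g := idfun : {linear _ -> _})) => j.
apply: (tensor_ext (f := tensor_split P \o (dlift g \o din j) : {linear _ -> _})
    (g := din j : {linear _ -> _})) => p m /=.
rewrite dlift_din gE (tensor_splitE _ _ (gact1 b (s j))).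
by rewrite invg1 !gact1.
Qed.

Lemma tensor_split_map P Q (f : hom P Q) (fj : forall j, hom (P |_ j) (Q |_ j)) :
  (forall j p, hom_fun (fj j) p = hom_fun f p) -> forall x,
  tensor_split Q (tensor_map M (perm_map f) x) =
  dirsum_map (fun j => tensor_map (M |_ j) (fj j)) (tensor_split P x).
Proof.
move=> fjE.
apply: (tensor_perm_ext (f := tensor_split Q \o tensor_map M (perm_map f) : {linear _ -> _})
  (g := dirsum_map (fun j => tensor_map (M |_ j) (fj j)) \o tensor_split P : {linear _ -> _})).
move=> x p m; have [j [[k kx] _]] := sP x.
rewrite [LHS](congr1 _ (tensor_mapE _ _ _)) [RHS](congr1 _ (tensor_splitE _ _ kx)).
rewrite perm_map_pin (tensor_splitE _ _ kx) dirsum_map_din tensor_mapE fjE.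
by rewrite hom_equivariant.
Qed.

End TensorDecomposition.
End OrbitDecomposition.
End PermutationModules.

(** * The chain complex of a tree *)

Lemma dactB (G : topGroupType) (M : dmod G) g (x y : M) :
  dact M g (x - y) = dact M g x - dact M g y.
Proof. exact: (linearB (dact M g)). Qed.

Section Tree.
Variables (G : topGroupType) (T : graph) (a : gaction G (vertex T)).
Hypothesis ha : graph_action a.

Notation edge := (set_type (@edges T)).

Lemma edgesP (e : edge) : edges (val e). Proof. exact: set_mem (valP e). Qed.

Lemma edge_act_subproof g (e : edge) : set_gaction a g (val e) \in @edges T.
Proof.
have [x [y [xy ->]]] := edgesP e; apply/mem_set; exists (a g x), (a g y).
by rewrite ha xy; split=> //=; rewrite image_setU !image_set1.
Qed.

Definition edge_act g (e : edge) : edge := SigSub (edge_act_subproof g e).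

Lemma edge_act1 e : edge_act 1%g e = e.
Proof. by apply: val_inj; exact: gact1. Qed.

Lemma edge_actM g h e : edge_act (g * h)%g e = edge_act g (edge_act h e).
Proof. by apply: val_inj; exact: gactM. Qed.

Definition edge_action : gaction G edge := Gaction edge_act1 edge_actM.

Lemma edge_stab (e : edge) :
  subgroup_set (stab edge_action e) = subgroup_set (stab (set_gaction a) (val e)).
Proof.
apply/seteqP; split=> g /= ge; first by rewrite -[in RHS]ge.
exact: val_inj.
Qed.

Lemma set2_eq (X : Type) (x y u v : X) : u <> v -> [set u; v] = [set x; y] ->
  (u = x /\ v = y) \/ (u = y /\ v = x).
Proof.
move=> uv e; have : [set u; v] u by left.
have : [set u; v] v by right.
by rewrite e /= => -[vx|vy] [ux|uy]; [case: uv; rewrite ux|right|left|case: uv; rewrite uy].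
Qed.

Lemma adj_neq (x y : vertex T) : adj x y -> x <> y.
Proof. by move=> + xy; rewrite xy adj_irrefl. Qed.

Section EdgeRepresentatives.
Variable E : set (set (vertex T)).
Hypothesis hE : orbit_representatives (set_gaction a) (@edges T) E.

Definition edge_rep (j : E) : edge := SigSub (mem_set (hE.1 _ (set_mem (valP j)))).

Lemma edge_rep_stab j g :
  subgroup_set (stab (set_gaction a) (val j)) g <-> edge_action g (edge_rep j) = edge_rep j.
Proof.
by rewrite -[edge_action g _ = _]/(subgroup_set (stab edge_action (edge_rep j)) g) edge_stab.
Qed.

Lemma edge_rep_unique x : exists! j, exists g, edge_action g (edge_rep j) = x.
Proof.
have [e [[Ee [g ge]] eu]] := hE.2 _ (edgesP x).
exists (SigSub (mem_set Ee)); split; first by exists g; apply: val_inj.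
move=> j [h hj]; apply: val_inj; apply: eu; split; first exact: set_mem (valP j).
by exists h; rewrite -hj.
Qed.

(** One edge of each orbit is oriented arbitrarily and the orientation is transported. This is
    consistent because the stabiliser of an edge, being unable to swap its ends, fixes both of
    them. *)
Lemma edge_orientation : without_inversion a ->
  exists (src tgt : edge -> vertex T),
    (forall e, adj (src e) (tgt e) /\ val e = [set src e; tgt e]) /\
    forall g e, src (edge_action g e) = a g (src e) /\ tgt (edge_action g e) = a g (tgt e).
Proof.
move=> hinv; pose K (j : E) := stab (set_gaction a) (val j).
have [r [t [tP rP]]] := orbit_rep edge_rep_stab edge_rep_unique.
have /choice[o oP] : forall j : E, exists uv : vertex T * vertex T,
    adj uv.1 uv.2 /\ val j = [set uv.1; uv.2].
  by move=> j; have [x [y [xy je]]] := edgesP (edge_rep j); exists (x, y).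
have fix_o j (k : K j) : a (val k) (o j).1 = (o j).1 /\ a (val k) (o j).2 = (o j).2.
  have kj : a (val k) @` (val j) = val j := set_mem (valP k).
  have [adjo jE] := oP j; move: kj.
  have adjk : adj (a (val k) (o j).1) (a (val k) (o j).2) by rewrite ha.
  (* An element preserving the pair of ends either fixes both or exchanges them, and [hinv] excludes
     the exchange. *)
  rewrite jE image_setU !image_set1 => /(set2_eq (adj_neq adjk))[//|inv].
  by case: (hinv _ _ _ adjo inv).
exists (fun x => a (t x) (o (r x)).1), (fun x => a (t x) (o (r x)).2); split=> [e|g e].
  rewrite ha; have [adjo jE] := oP (r e); split=> //.
  by rewrite -[in LHS](tP e) /= jE image_setU !image_set1.
have [|re [k gk]] := rP (edge_action g e) (r e) (g * t e)%g; first by rewrite gactM tP.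
have [ko kq] := fix_o _ k.
by rewrite -!gactM -re gk !gactM ko kq.
Qed.

End EdgeRepresentatives.

(** * Removal of an edge of a tree *)

Section Bridge.
Variables (x y : vertex T).

Definition adj_off (u v : vertex T) : bool :=
  adj u v && ~~ `[< [set u; v] = [set x; y] >].

Definition reach (v : vertex T) := exists s, path adj_off x s /\ last x s = v.

Lemma reach_adj u v : adj_off u v -> reach u -> reach v.
Proof.
by move=> uv [s [ps su]]; exists (rcons s v); rewrite rcons_path ps last_rcons su.
Qed.

Lemma adj_off_sym u v : adj_off u v = adj_off v u.
Proof. by rewrite /adj_off adj_sym setUC. Qed.

(** A path from [x] to [y] avoiding the edge, shortened to a simple one, would close up with that
    edge to a cycle. *)
Lemma tree_bridge : is_tree T -> adj x y -> ~ reach y.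
Proof.
case=> _ _ acyclic xy [s [ps sy]]; move: sy; case/shortenP: ps => s' ps' us' _ sy.
have ps'' : path (@adj T) x s'.
  by apply: sub_path ps' => u v /andP[].
apply: (acyclic (x :: s')).
  (* Only cycles with at least three vertices are excluded: an empty path would give [x = y], and a
     path of one step would use the removed edge. *)
  case: s' ps' {us' ps''} sy => [_ /= xy'|u [|//]].
    by move: xy; rewrite xy' adj_irrefl.
  by move=> /= /andP[/andP[_ +] _] uy; rewrite uy => /negP[]; exact/asboolP.
by rewrite /ucycle /ucycleb us' andbT /= rcons_path ps'' sy adj_sym xy.
Qed.

End Bridge.

Section Sequence.
Hypothesis hT : is_tree T.
Variables (src tgt : edge -> vertex T).
Hypothesis oE : forall e, adj (src e) (tgt e) /\ val e = [set src e; tgt e].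
Hypothesis oG : forall g e,
  src (edge_action g e) = a g (src e) /\ tgt (edge_action g e) = a g (tgt e).
Hypothesis vo : forall v, open (subgroup_set (stab a v)).
Hypothesis eo : forall e, open (subgroup_set (stab edge_action e)).
Variable P : dmod G.
Notation PV := (perm_mod vo P).
Notation PE := (perm_mod eo P).

Lemma boundary_ex : exists d : hom PE PV, forall e p,
  hom_fun d (pin eo e p) = pin vo (tgt e) p - pin vo (src e) p.
Proof.
have hl e : linear (fun p : P => pin vo (tgt e) p - pin vo (src e) p).
  by move=> c p q; rewrite !pin_linear scalerBr opprD addrACA.
have hG g e (p : P) :
    pin vo (tgt (edge_action g e)) (dact P g p) - pin vo (src (edge_action g e)) (dact P g p) =
    dact PV g (pin vo (tgt e) p - pin vo (src e) p).
  by rewrite dactB !dact_pin; have [-> ->] := oG g e.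
exact: (@perm_lift _ _ _ eo P PV (fun e => linear_fun (hl e)) hG).
Qed.

Lemma augment_ex : exists s : hom PV P, forall v p, hom_fun s (pin vo v p) = p.
Proof. exact: (@perm_lift _ _ _ vo P P (fun _ => idfun)). Qed.

Definition boundary := projT1 (cid boundary_ex).
Definition augment := projT1 (cid augment_ex).

Lemma boundaryE e p : hom_fun boundary (pin eo e p) = pin vo (tgt e) p - pin vo (src e) p.
Proof. exact: (projT2 (cid boundary_ex)). Qed.

Lemma augmentE v p : hom_fun augment (pin vo v p) = p.
Proof. exact: (projT2 (cid augment_ex)). Qed.

(* Summing a chain over the component of [src e] in the tree minus [e] kills
   the boundary of every edge but [e]. *)
Lemma boundary_inj u : hom_fun boundary u = 0 -> u = 0.
Proof.
move=> u0; apply: dcoef_inj => e; rewrite dcoef0.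
pose C v := `[< reach (src e) (tgt e) v >].
have hl v : linear (fun p : P => if C v then p else 0).
  by move=> c p q; case: (C v) => //; rewrite scaler0 addr0.
pose F : PV -> P := dlift (fun v => linear_fun (hl v)).
have Fl : linear F := dlift_linear _.
have F_sub u v : F (u - v) = F u - F v := linearB (linear_fun Fl) u v.
have F_pin v p : F (pin vo v p) = if C v then p else 0 by exact: dlift_din.
have FB : forall u, F (hom_fun boundary u) = - dcoef u e.
  apply: perm_ext => [c v w|c v w|e' p].
  - by rewrite linearP Fl.
  - by rewrite dcoefP opprD scalerN.
  rewrite boundaryE F_sub !F_pin.
  have [ee'|ee'] := pselect (e' = e).
    rewrite ee' /pin din_id /C asboolF; last exact/tree_bridge/(oE e).1.
    by rewrite asboolT ?sub0r//; exists [::].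
  rewrite /pin din_neq// oppr0.
  have off : adj_off (src e) (tgt e) (src e') (tgt e').
    rewrite /adj_off (oE e').1 /=; apply/negP => /asboolP.
    by rewrite -(oE e).2 -(oE e').2 => /val_inj.
  suff -> : C (tgt e') = C (src e') by rewrite subrr.
  apply: asbool_equiv_eq; split; apply: reach_adj => //.
  by rewrite adj_off_sym.
have F0 : F 0 = 0 := linear0 (linear_fun Fl).
by have /eqP := FB u; rewrite u0 F0 eq_sym oppr_eq0 => /eqP.
Qed.

Lemma augment_boundary u : hom_fun augment (hom_fun boundary u) = 0.
Proof.
move: u; apply: perm_ext => [c u v|c u v|e p].
- by rewrite !linearP.
- by rewrite scaler0 addr0.
- by rewrite boundaryE linearB /= !augmentE subrr.
Qed.

Lemma edge_boundary u v p : adj u v -> exists w,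
  hom_fun boundary w = pin vo v p - pin vo u p.
Proof.
move=> uv; have Ee : @edges T [set u; v] by exists u, v.
pose e : edge := SigSub (mem_set Ee).
have [adje eE] := oE e; have [[us vt]|[ut vs]] := set2_eq (adj_neq uv) eE.
  by exists (pin eo e p); rewrite boundaryE us vt.
by exists (- pin eo e p); rewrite linearN /= boundaryE ut vs opprB.
Qed.

Lemma path_boundary u s p : path (@adj T) u s -> exists w,
  hom_fun boundary w = pin vo (last u s) p - pin vo u p.
Proof.
elim: s u => [|v s IH] u /=; first by exists 0; rewrite linear0 subrr.
move=> /andP[/(edge_boundary p)[w1 w1P] /IH[w2 w2P]].
by exists (w2 + w1); rewrite linearD /= w1P w2P addrA subrK.
Qed.

(** Each chain is moved to the base vertex [v0] along paths, which changes it by a boundary; what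
    remains at [v0] is its augmentation. *)
Lemma augment_ker u : hom_fun augment u = 0 -> exists w, hom_fun boundary w = u.
Proof.
have [[v0] conn _] := hT.
have pin0 : pin vo v0 (0 : P) = 0 := linear0 (linear_fun (@pin_linear _ _ _ vo P v0)).
suff /(_ u)[w wP] : forall u, exists w, hom_fun boundary w = u - pin vo v0 (hom_fun augment u).
  by move=> u0; exists w; rewrite wP u0 pin0 subr0.
move=> {}u.
pose A : set PV := [set u | exists w, hom_fun boundary w = u - pin vo v0 (hom_fun augment u)].
have A0 : A 0.
  by exists 0; rewrite !linear0 pin0 subr0.
have AP (c : rat) v w : A v -> A w -> A (c *: v + w).
  move=> [v' vP] [w' wP]; exists (c *: v' + w').
  rewrite linearP [hom_fun augment _]linearP /= vP wP pin_linear.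
  by rewrite scalerBr opprD addrACA.
apply: (@dirsum_ind _ _ _ (Submod A0 AP) _ u) => v p.
have [s [ps sv]] := conn v0 v; have [w wP] := path_boundary p ps.
by exists w; rewrite wP sv -[din v p]/(pin vo v p) augmentE.
Qed.

Lemma augment_surj p : exists u, hom_fun augment u = p.
Proof. by have [[v0] _ _] := hT; exists (pin vo v0 p); exact: augmentE. Qed.

End Sequence.
End Tree.

(** * Restriction of injective modules *)

Section Cosets.
Variables (G : topGroupType) (H : subgroup G).
Notation inH := (subgroup_set H).

(** A choice made from the coset as a set, hence the same for all its elements. *)
Definition coset_rep (x : G) : G := xget 1%g [set y | inH (x^-1 * y)%g].

Lemma coset_repP x : inH (x^-1 * coset_rep x)%g.
Proof.
apply: (xgetPex 1%g (P := [set y | inH (x^-1 * y)%g])); exists x.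
by rewrite /= mulVg; exact: subgroup1.
Qed.

Lemma coset_rep_eq x y : inH (x^-1 * y)%g -> coset_rep x = coset_rep y.
Proof.
move=> xy; rewrite /coset_rep; congr xget; apply/seteqP; split=> z /= Hz.
  rewrite -[z](mulVKg x) mulgA; apply: subgroupM => //.
  by rewrite -[(y^-1 * x)%g]invgK invgM invgK; exact: subgroupV.
by rewrite -[z](mulVKg y) mulgA; exact: subgroupM.
Qed.

Definition lcoset := {x : G | coset_rep x = x}.

Lemma coset_rep_id x : coset_rep (coset_rep x) = coset_rep x.
Proof. exact/esym/coset_rep_eq/coset_repP. Qed.

Definition to_lcoset (x : G) : lcoset := exist _ _ (coset_rep_id x).

Lemma lcoset_ext (x y : lcoset) : sval x = sval y -> x = y.
Proof.
case: x y => [x xP] [y yP] /= e; subst y.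
by rewrite (Prop_irrelevance xP yP).
Qed.

Definition lcoset_act (g : G) (x : lcoset) : lcoset := to_lcoset (g * sval x)%g.

Lemma lcoset_act1 x : lcoset_act 1%g x = x.
Proof. by apply: lcoset_ext; rewrite /= mul1g; case: x. Qed.

Lemma lcoset_actM g h x : lcoset_act (g * h)%g x = lcoset_act g (lcoset_act h x).
Proof.
apply: lcoset_ext => /=; apply: coset_rep_eq.
by rewrite -[(g * h * _)%g]mulgA invgM -mulgA mulKg; exact: coset_repP.
Qed.

Definition lcoset_action : gaction G lcoset := Gaction lcoset_act1 lcoset_actM.

Lemma lcoset_stab x g :
  lcoset_action g x = x <-> inH ((sval x)^-1 * g * sval x)%g.
Proof.
split=> [/(congr1 sval) /= gx|Hg].
  rewrite -mulgA -[(_ * _)%g]invgK; apply: subgroupV.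
  by rewrite invgM invgK -{2}gx; exact: coset_repP.
apply: lcoset_ext; apply: (etrans _ (svalP x)).
by apply/esym/coset_rep_eq; rewrite mulgA.
Qed.

Lemma lcoset_stab_open : open inH ->
  forall x, open (subgroup_set (stab lcoset_action x)).
Proof.
move=> oH x; apply: subgroup_open.
apply: (filterS _ (nbhs1_conj (sval x) (open_nbhs1 oH))) => g Hg.
exact/lcoset_stab.
Qed.

(* [g (sval x) = sval (g x) (lcoset_cocycle g x)] *)
Lemma lcoset_cocycle_subproof (g : G) (x : lcoset) :
  ((coset_rep (g * sval x))^-1 * (g * sval x))%g \in subgroup_pred H.
Proof.
apply/mem_set; rewrite -[(_ * _)%g]invgK; apply: subgroupV.
by rewrite invgM invgK; exact: coset_repP.
Qed.

Definition lcoset_cocycle (g : G) (x : lcoset) : H :=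
  SubgroupElt (lcoset_cocycle_subproof g x).

Lemma lcoset_cocycle1 x : lcoset_cocycle 1%g x = 1%g.
Proof. by apply: val_inj; rewrite /= mul1g (svalP x) mulVg. Qed.

Lemma lcoset_cocycleM g h x :
  lcoset_cocycle (g * h)%g x =
  (lcoset_cocycle g (lcoset_action h x) * lcoset_cocycle h x)%g.
Proof.
apply: val_inj; have /(congr1 sval) /= e := lcoset_actM g h x.
by rewrite /= e -!mulgA !mulVKg.
Qed.

Section Induction.
Hypothesis oH : open inH.
Variable A : dmod H.

Definition ind_fibre (g : G) (x : lcoset) : {linear A -> A} := dact A (lcoset_cocycle g x).

Lemma ind_fibre1 x m : ind_fibre 1%g x m = m.
Proof. by rewrite /ind_fibre lcoset_cocycle1; exact: gact1. Qed.

Lemma ind_fibreM g h x m :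
  ind_fibre (g * h)%g x m = ind_fibre g (lcoset_action h x) (ind_fibre h x m).
Proof. by rewrite /ind_fibre lcoset_cocycleM; exact: gactM. Qed.

Lemma subgroup_nbhs (U : set H) : nbhs (1%g : H) U -> nbhs (1%g : G) [set val h | h in U].
Proof.
rewrite nbhsE => -[V [[O oO OV] V1] VU].
have O1 : nbhs (1%g : G) O.
  by apply: open_nbhs_nbhs; split=> //; move: V1; rewrite -OV.
apply: (filterS _ (filterI O1 (open_nbhs1 oH))) => g [Og Hg].
exists (SubgroupElt (mem_set Hg)) => //; apply: VU; rewrite -OV.
exact: Og.
Qed.

(** If [L] is the stabiliser of [m] in [H], the conjugate of [L] by [sval x] fixes both the coset
    and the vector; it is a neighbourhood of [1] because [H] is open. *)
Lemma ind_fibre_nbhs x m :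
  nbhs (1%g : G) [set g | lcoset_action g x = x /\ ind_fibre g x m = m].
Proof.
have /subgroup_nbhs/(nbhs1_conj (sval x)) := open_nbhs1 (@dact_open H A m).
move=> n; apply: (filterS _ n) => g [h hm /= hg].
have gx : lcoset_action g x = x.
  by apply/lcoset_stab; rewrite -hg; exact: (set_mem (valP h)).
split=> //; rewrite /ind_fibre (_ : lcoset_cocycle g x = h)//.
by apply: val_inj; rewrite /= -[coset_rep _]/(sval (lcoset_action g x)) gx mulgA.
Qed.

(** The module induced from [H] to [G], with finitely supported sections: the vector [m] over the
    coset [x] stands for the tensor of [sval x] and [m], and the cocycle is what [g] leaves behind
    in [H]. *)
Definition ind : dmod G :=
  @bundle_mod G lcoset lcoset_action A ind_fibre ind_fibre1 ind_fibreM ind_fibre_nbhs.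

Definition ind_in (x : lcoset) (m : A) : ind :=
  @bin G lcoset lcoset_action A ind_fibre ind_fibre1 ind_fibreM ind_fibre_nbhs x m.

Lemma dact_ind_in g x m :
  dact ind g (ind_in x m) = ind_in (lcoset_action g x) (ind_fibre g x m).
Proof. exact: dact_bin. Qed.

Lemma ind_lift (B : dmod G) (f : hom A (res B H)) :
  exists F : hom ind B, forall x m, hom_fun F (ind_in x m) = dact B (sval x) (hom_fun f m).
Proof.
have hl (x : lcoset) : linear (fun m : A => dact B (sval x) (hom_fun f m)).
  by move=> a m n; rewrite (linearP (hom_fun f)) (linearP (dact B (sval x))).
apply: (bundle_lift _ _ _ (h := fun x => linear_fun (hl x))) => g x m.
rewrite -[LHS]/(dact B (coset_rep (g * sval x)%g) (hom_fun f (ind_fibre g x m))).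
rewrite hom_equivariant -[dact (res _ _) _ _]/(dact B (val (lcoset_cocycle g x)) (hom_fun f m)).
by rewrite -!gactM /= mulVKg.
Qed.

End Induction.

Lemma ind_map_ex (oH : open inH) (A B : dmod H) (i : hom A B) : injective (hom_fun i) ->
  exists2 F : hom (ind oH A) (ind oH B), injective (hom_fun F) &
    forall x m, hom_fun F (ind_in oH x m) = ind_in oH x (hom_fun i m).
Proof.
move=> i_inj; pose F := dirsum_map (fun _ : lcoset => hom_fun i : {linear _ -> _}).
have FG g u : F (dact (ind oH A) g u) = dact (ind oH B) g (F u).
  by apply: dcoef_inj => x; exact: hom_equivariant.
exists (@mk_hom G (ind oH A) (ind oH B) F (dirsum_map_linear _) FG) => [u v uv|x m].
  by apply: dcoef_inj => x; apply: i_inj; exact: (congr1 (fun w => dcoef w x) uv).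
exact: dirsum_map_din.
Qed.

(** Restriction is right adjoint to induction, which preserves injections. The adjunction is made
    explicit: extend over the module induced from [B], then evaluate at the coset [H]. *)
Theorem injective_res (oH : open inH) (I : dmod G) :
  injective_object I -> injective_object (res I H).
Proof.
move=> Iinj A B i f i_inj.
have [F FP] := ind_lift oH f; have [J J_inj JP] := ind_map_ex oH i_inj.
have [h hP] := Iinj _ _ J F J_inj.
(* The chosen representative of the coset [H] lies in [H] but may differ from [1], hence the
   correction by its inverse in [h0]. *)
pose x0 := to_lcoset 1%g.
have Hx0 : inH (sval x0) by have := coset_repP 1%g; rewrite invg1 mul1g.
pose h0 (m : B) : res I H := dact I (sval x0)^-1%g (hom_fun h (ind_in oH x0 m)).
have h0l : linear h0.
  move=> a m n; rewrite /h0 -(linearP (dact I _)) -linearP; congr (dact I _ (hom_fun h _)).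
  exact: bin_linear.
have h0G (k : H) m : h0 (dact B k m) = dact (res I H) k (h0 m).
  rewrite -[RHS]/(dact I (val k) (dact I (sval x0)^-1%g (hom_fun h (ind_in oH x0 m)))).
  (* This conjugate fixes the coset [x0] and has cocycle [k] there, so it acts on the fibre over
     [x0] as [k] does on [B]. *)
  pose g := (sval x0 * val k * (sval x0)^-1)%g.
  have gx0 : (g * sval x0)%g = (sval x0 * val k)%g by rewrite /g mulgVK.
  have ex0 : lcoset_action g x0 = x0.
    by apply/lcoset_stab; rewrite /g -!mulgA mulVg mulg1 mulKg; exact: (set_mem (valP k)).
  have ek : lcoset_cocycle g x0 = k.
    apply: val_inj; rewrite /= -[coset_rep (g * _)%g]/(sval (lcoset_action g x0)) ex0 gx0.
    by rewrite mulKg.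
  have -> : h0 (dact B k m) =
      dact I (sval x0)^-1%g (hom_fun h (dact (ind oH B) g (ind_in oH x0 m))).
    by rewrite dact_ind_in ex0 /ind_fibre ek.
  by rewrite hom_equivariant -!gactM /g !mulgA mulVg mul1g.
exists (mk_hom h0l h0G); apply/funext => m.
rewrite -[LHS]/(dact I (sval x0)^-1%g (hom_fun h (ind_in oH x0 (hom_fun i m)))).
rewrite -JP -[hom_fun h (hom_fun J _)]/((hom_fun h \o hom_fun J) _) hP FP.
exact: gactK.
Qed.

End Cosets.

(** * Compact open subgroups *)

Section VanDantzig.
Variable G : topGroupType.

Lemma continuous_mulg (T : topologicalType) (f g : T -> G) :
  continuous f -> continuous g -> continuous (fun z => (f z * g z)%g).
Proof.
move=> fc gc z; apply: (@continuous_comp _ _ _ (fun z => (f z, g z))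
  (fun xy : G * G => (xy.1 * xy.2)%g)); last exact: mulg_continuous.
by apply: cvg_pair; [exact: fc|exact: gc].
Qed.

Lemma continuous_invg (T : topologicalType) (f : T -> G) :
  continuous f -> continuous (fun z => (f z)^-1%g).
Proof.
move=> fc z; apply: (@continuous_comp _ _ _ f (fun x : G => x^-1%g)); first exact: fc.
exact: invg_continuous.
Qed.

(* Inside a compact subgroup the open subgroups have finite index; this is the
   consequence of compactness which passes to subsets. *)
Definition coset_bounded (S : set G) := forall L : subgroup G, open (subgroup_set L) ->
  exists s : seq G, forall g, S g -> exists2 t, t \in s & subgroup_set L (t^-1 * g)%g.

Lemma coset_bounded_sub (S S' : set G) : S `<=` S' -> coset_bounded S' -> coset_bounded S.
Proof. by move=> SS bS' L /bS'[s sP]; exists s => g /SS /sP. Qed.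

Lemma coset_bounded_conj (S : set G) x :
  coset_bounded S -> coset_bounded [set g | S (x^-1 * g * x)%g].
Proof.
move=> bS L oL.
have Ldiv g h : subgroup_set L (x * g * x^-1)%g -> subgroup_set L (x * h * x^-1)%g ->
    subgroup_set L (x * (g / h) * x^-1)%g.
  move=> Lg Lh; have -> : (x * (g / h) * x^-1)%g = ((x * g * x^-1) / (x * h * x^-1))%g.
    by rewrite !invgM invgK !mulgA mulgVK.
  exact: subgroup_div.
have L1 : subgroup_set L (x * 1 * x^-1)%g by rewrite mulg1 mulgV; exact: subgroup1.
pose Lx := @Subgroup G [set g | subgroup_set L (x * g * x^-1)%g] L1 Ldiv.
have oLx : open (subgroup_set Lx).
  apply: subgroup_open; have := nbhs1_conj x^-1%g (open_nbhs1 oL).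
  by rewrite invgK.
have [s sP] := bS Lx oLx; exists [seq (x * t * x^-1)%g | t <- s] => g /sP[t ts /= Lt].
exists (x * t * x^-1)%g; first by apply/mapP; exists t.
by move: Lt; rewrite !invgM !invgK !mulgA mulgK.
Qed.

(** The open cosets [x L] cover [C]. Compactness is used in its near-covering form, for the filter
    of sequences containing any prescribed elements. *)
Lemma compact_coset_bounded (C : set G) : compact C -> coset_bounded C.
Proof.
move=> /compact_near_coveringP cC L oL.
pose F := filter_from [set: seq G] (fun s => [set s' : seq G | {subset s <= s'}]).
have FF : Filter F.
  apply: filter_from_filter; first by exists [::].
  move=> s s' _ _; exists (s ++ s') => // s'' /= ss''.
  by split=> t ts; apply: ss''; rewrite mem_cat ts ?orbT.
have [x Cx|s _ sP] := cC _ F (fun s g => exists2 t, t \in s & subgroup_set L (t^-1 * g)%g) FF.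
  exists ((fun g => (x^-1 * g)%g) @^-1` subgroup_set L, [set s : seq G | {subset [:: x] <= s}]).
    split=> /=; last by exists [:: x].
    by apply: mulg_continuousl; rewrite mulVg; exact: open_nbhs1.
  by move=> [g s] /= [Lg xs]; exists x => //; apply: xs; rewrite inE.
by exists s; exact: (sP s).
Qed.

Section ClopenNeighbourhoods.
Variable K : set G.
Hypotheses (cK : compact K) (clK : closed K) (K1 : K 1%g).

(** Neighbourhoods of [1] that are clopen in [K], expressed by closedness in [G] since [K] is
    closed. *)
Definition clopen_in (D : set G) := [/\ D `<=` K, closed D, closed (K `\` D) & D 1%g].

Lemma clopen_inT : clopen_in K.
Proof. by split=> //; rewrite setDv; exact: closed0. Qed.

Lemma clopen_inI D D' : clopen_in D -> clopen_in D' -> clopen_in (D `&` D').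
Proof.
move=> [DK cD oD D1] [D'K cD' oD' D'1]; split=> //.
- by move=> x [/DK].
- exact: closedI.
- by rewrite setDIr; exact: closedU.
Qed.

Definition quasi_component := [set x | forall D, clopen_in D -> D x].

(** Otherwise the sets [D] minus [O] generate a proper filter on the compact [K]; a cluster point
    would belong to every [D] and lie outside [O]. *)
Lemma clopen_in_sub (O : set G) : open O -> quasi_component `<=` O ->
  exists2 D, clopen_in D & D `<=` O.
Proof.
move=> oO QO; apply: contrapT => noD.
pose F := filter_from clopen_in (fun D => D `\` O).
have FF : ProperFilter F.
  apply: filter_from_proper; last first.
    move=> D cD; apply: contrapT => D0; apply: noD; exists D => // x Dx.
    by apply: contrapT => Ox; apply: D0; exists x.
  apply: filter_from_filter; first by exists K; exact: clopen_inT.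
  move=> D D' cD cD'; exists (D `&` D'); first exact: clopen_inI.
  by move=> x [[Dx D'x] Ox]; split.
have FK : F K by exists K; [exact: clopen_inT|move=> x []].
have [x [Kx clx]] := cK FF FK.
have DOx D : clopen_in D -> closure (D `\` O) x.
  by move=> cD U nU; apply: clx => //; exists D.
have Qx : quasi_component x.
  move=> D cD; have [_ clD _ _] := cD; apply: clD.
  by apply: closureS (DOx D cD) => y [].
have : closure (~` O) x by apply: closureS (DOx K clopen_inT) => y [].
by rewrite -(closure_id _).1; [apply; exact: QO|exact: open_closedC].
Qed.

Lemma quasi_component_closed : closed quasi_component.
Proof.
rewrite (_ : quasi_component = \bigcap_(D in clopen_in) D)//.
by apply: closed_bigI => D [].
Qed.

(** By compactness there are neighbourhoods [W1], [W2] of [1] such that no [x w1 w2^-1] with [x] in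
    [A] lies in [B]; then [A W1] and [B W2] are disjoint. *)
Lemma separate_compact (A B : set G) : compact A -> closed B -> A `&` B = set0 ->
  exists U V, [/\ open U, open V, A `<=` U, B `<=` V & U `&` V = set0].
Proof.
move=> /compact_near_coveringP cA clB AB0.
pose P (w : G * G) (x : G) := ~ B (x * w.1 * w.2^-1)%g.
have [|[W1 W2] [/= n1 n2] WP] := cA _ (nbhs ((1, 1)%g : G * G)) P _.
  move=> x Ax; have nB : nbhs x (~` B).
    apply: open_nbhs_nbhs; split; first exact: closed_openC.
    by move=> Bx; have : (A `&` B) x by []; rewrite AB0.
  pose f (z : G * (G * G)) := (z.1 * z.2.1 * z.2.2^-1)%g.
  have fc : continuous f.
    apply: continuous_mulg; last first.
      apply: continuous_invg => z; apply: (@continuous_comp _ _ _ snd snd); exact: cvg_snd.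
    apply: continuous_mulg => z; first exact: cvg_fst.
    by apply: (@continuous_comp _ _ _ snd fst); [exact: cvg_snd|exact: cvg_fst].
  have := fc (x, (1, 1)%g) (~` B); rewrite /f /= mulg1 invg1 mulg1 => /(_ nB).
  by [].
have trans (S W : set G) : open [set g | exists2 x, S x & W^° (x^-1 * g)%g].
  rewrite (_ : [set g | _] = \bigcup_(x in S) ((fun g => (x^-1 * g)%g) @^-1` W^°)).
    apply: bigcup_open => x _; apply: open_comp (open_interior W) => g _.
    exact: mulg_continuousl.
  by apply/seteqP; split=> g [x Sx Wx]; exists x.
exists [set g | exists2 x, A x & W1^° (x^-1 * g)%g].
exists [set g | exists2 x, B x & W2^° (x^-1 * g)%g].
split; [exact: trans|exact: trans|..].
- by move=> x Ax; exists x => //; rewrite mulVg.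
- by move=> x Bx; exists x => //; rewrite mulVg.
apply/seteqP; split=> // g [[x Ax /interior_subset Wx] [y By /interior_subset Wy]].
have /= := WP (x^-1 * g, y^-1 * g)%g (conj Wx Wy) x Ax; apply.
by rewrite /= mulVKg invgM invgK mulVKg.
Qed.

(** If the quasi-component splits into closed pieces [A] and [B], separate them by open [U] and [V]
    and take a relatively clopen [D] inside their union. Then [D] cut by [U] is again clopen in [K]
    and contains [1], so it contains the quasi-component and [B] is empty. *)
Lemma quasi_component_connected : connected quasi_component.
Proof.
have key A B : closed A -> closed B -> A `|` B = quasi_component ->
    A `&` B = set0 -> A 1%g -> B = set0.
  move=> clA clB ABQ AB0 A1.
  have QK : quasi_component `<=` K by move=> x Qx; exact: Qx clopen_inT.
  have cA : compact A.
    by apply: subclosed_compact clA cK _ => x Ax; apply: QK; rewrite -ABQ; left.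
  have [U [V [oU oV AU BV UV0]]] := separate_compact cA clB AB0.
  have [||D [DK clD clKD D1] DUV] := @clopen_in_sub (U `|` V).
  - exact: openU.
  - by rewrite -ABQ => x [/AU|/BV]; [left|right].
  have DU : D `&` U = D `&` ~` V.
    apply/seteqP; split=> x [Dx Ux]; split=> //.
      by move=> Vx; have : (U `&` V) x by []; rewrite UV0.
    by have [] := DUV _ Dx.
  have cDU : clopen_in (D `&` U).
    split; [by move=> x [/DK]| | |by split=> //; exact: AU].
    - by rewrite DU; apply: closedI => //; exact: open_closedC.
    - rewrite setDIr; apply: closedU => //; rewrite setDE.
      by apply: closedI => //; exact: open_closedC.
  apply/seteqP; split=> // x Bx; have Qx : quasi_component x by rewrite -ABQ; right.
  have [_ Ux] := Qx _ cDU; have : (U `&` V) x by split=> //; exact: BV.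
  by rewrite UV0.
have Q1 : quasi_component 1%g by move=> D [].
move=> B [b Bb] [O oO BO] [C clC BC].
have clB : closed B by rewrite BC; apply: closedI => //; exact: quasi_component_closed.
have clB' : closed (quasi_component `&` ~` O).
  by apply: closedI; [exact: quasi_component_closed|exact: open_closedC].
(* [key] shows that the piece without [1] is empty; that piece is the complement of [B] in one case
   and [B] itself in the other. *)
have [OQ|nO1] := pselect (O 1%g).
  have B0 := key B (quasi_component `&` ~` O) clB clB'.
  apply/seteqP; split=> [x|x Qx]; first by rewrite BO => -[].
  apply: contrapT => nBx.
  have : (quasi_component `&` ~` O) x by split=> // Ox; apply: nBx; rewrite BO.
  rewrite B0//; last by rewrite BO.
  - by rewrite BO -setIUr setUv setIT.
  - by rewrite BO setIACA setICr setI0.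
have := key (quasi_component `&` ~` O) B clB' clB.
rewrite BO -setIUr setUC setUv setIT setIACA setICl setI0 => /(_ erefl erefl (conj Q1 nO1)) B0.
by move: Bb; rewrite BO B0.
Qed.

End ClopenNeighbourhoods.

(** Total disconnectedness reduces the quasi-component of [1] in a compact neighbourhood [K] to [1],
    so some compact [C] containing [1], clopen in [K], lies in the interior of [K]. The elements
    with [C x = C] form a subgroup, open because [C] is compact and open, and contained in [C]
    because [1] is in [C]. *)
Theorem van_dantzig : tdlc G ->
  exists U : subgroup G, open (subgroup_set U) /\ coset_bounded (subgroup_set U).
Proof.
move=> [lcG tdG].
have [K nK [cK clK]] := lcG 1%g I.
have {}nK : nbhs (1%g : G) K 
  by move: nK; rewrite /within /=; apply: filterS => x; apply.
have K1 := nbhs_singleton nK.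
have Q1 : quasi_component K `<=` [set 1%g].
  rewrite -(tdG 1%g I); apply: connected_component_max => //.
    by move=> D [].
  exact: quasi_component_connected.
have [|C [CK clC clKC C1] CO] := clopen_in_sub cK clK K1 (open_interior K).
  by move=> x /Q1 ->.
have cC : compact C := subclosed_compact clC cK CK.
have oC : open C.
  rewrite (_ : C = K^° `&` ~` (K `\` C)).
    by apply: openI; [exact: open_interior|exact: closed_openC].
  apply/seteqP; split=> [x Cx|x [/interior_subset Kx nKC]].
    by split; [exact: CO|move=> []].
  by apply: contrapT => nCx; apply: nKC.
have Udiv x y : (forall c, C c -> C (c * x)%g /\ C (c * x^-1)%g) ->
    (forall c, C c -> C (c * y)%g /\ C (c * y^-1)%g) ->
    forall c, C c -> C (c * (x / y))%g /\ C (c * (x / y)^-1)%g.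
  move=> Ux Uy c Cc; rewrite invgM invgK !mulgA; split.
    by apply: (Uy _ _).2; exact: (Ux _ _).1.
  by apply: (Ux _ _).2; exact: (Uy _ _).1.
have U1 c : C c -> C (c * 1)%g /\ C (c * 1^-1)%g by rewrite invg1 mulg1.
(* Stability of [C] under right multiplication by [x] and by its inverse amounts to [C x = C]. *)
pose U := @Subgroup G [set x | forall c, C c -> C (c * x)%g /\ C (c * x^-1)%g] U1 Udiv.
exists U; split; last first.
  apply: coset_bounded_sub (compact_coset_bounded cC) => x Ux.
  by have [] := Ux _ C1; rewrite mul1g.
apply: subgroup_open; move/compact_near_coveringP: (cC) => nC.
apply: (nC _ (nbhs (1%g : G)) (fun x c => C (c * x)%g /\ C (c * x^-1)%g)) => c Cc.
have nbC : nbhs c C by exact: open_nbhs_nbhs.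
have f1 : continuous (fun z : G * G => (z.1 * z.2)%g).
  by apply: continuous_mulg => z; [exact: cvg_fst|exact: cvg_snd].
have f2 : continuous (fun z : G * G => (z.1 * z.2^-1)%g).
  apply: continuous_mulg; first by move=> z; exact: cvg_fst.
  by apply: continuous_invg => z; exact: cvg_snd.
have n1 : nbhs (c, 1%g : G) [set z : G * G | C (z.1 * z.2)%g].
  by apply: (f1 (c, 1%g)); rewrite /= mulg1.
have n2 : nbhs (c, 1%g : G) [set z : G * G | C (z.1 * z.2^-1)%g].
  by apply: (f2 (c, 1%g)); rewrite /= invg1 mulg1.
exact: filterI n1 n2.
Qed.
End VanDantzig.

(** * Restriction of projective modules *)

Section Averaging.
Variables (G : topGroupType) (A B : dmod G) (f : hom A B) (S : subgroup G).
Hypothesis bS : coset_bounded (subgroup_set S).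

(** Average a lift over its [S]-orbit. The orbit is finite because the stabiliser of the lift is
    open and [S] meets finitely many of its cosets; its size is invertible in the rationals. *)
Lemma invariant_lift b : (forall g, subgroup_set S g -> dact B g b = b) ->
  (exists x, hom_fun f x = b) ->
  exists2 x, hom_fun f x = b & forall g, subgroup_set S g -> dact A g x = x.
Proof.
move=> Sb [x xb]; pose O := [set dact A g x | g in subgroup_set S].
have finO : finite_set O.
  have [s sP] := bS (@dact_open G A x).
  apply: (@sub_finite_set _ _ [set` [seq dact A t x | t <- s]]); last exact: finite_seq.
  move=> _ [g /sP[t ts Lt] <-]; apply/mapP; exists t => //.
  by rewrite -{1}(mulVKg t g) gactM Lt.
have Ox : O x by exists 1%g; [exact: subgroup1|exact: gact1].
pose F : {fset A} := fset_set O.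
have FP y : (y \in F) = (y \in O) by rewrite in_fset_set.
have F0 : (#|` F|)%:R != 0 :> rat.
  rewrite Num.Theory.pnatr_eq0 -lt0n cardfs_gt0; apply/fset0Pn; exists x.
  by rewrite FP; exact: mem_set.
exists ((#|` F|)%:R^-1 *: \sum_(y <- F) y).
  rewrite linearZ linear_sum /= (eq_big_seq (fun _ => b)).
    by rewrite big_const_seq count_predT iter_addr_0 -scaler_nat scalerA mulVf ?scale1r.
  move=> y; rewrite FP => /set_mem[g Sg <-].
  by rewrite hom_equivariant xb Sb.
move=> g Sg; rewrite linearZ linear_sum /=; congr (_ *: _).
rewrite -(big_map (dact A g) xpredT id); apply: perm_big.
apply: uniq_perm; [|exact: fset_uniq|].
  by rewrite map_inj_uniq ?fset_uniq//; exact: can_inj (gactK (dact A) g).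
move=> y; apply/mapP/idP => [[z + ->]|].
  rewrite !FP => /set_mem[h Sh <-]; apply/mem_set; exists (g * h)%g.
    exact: subgroupM.
  exact: gactM.
rewrite FP => /set_mem[h Sh <-]; exists (dact A (g^-1 * h)%g x).
  rewrite FP; apply/mem_set; exists (g^-1 * h)%g => //.
  by apply: subgroupM => //; exact: subgroupV.
by rewrite -gactM mulVKg.
Qed.

End Averaging.

(** A choice made from the orbit as a predicate depends on the orbit alone, which makes [r]
    invariant without a prescribed set of representatives. *)
Lemma orbit_choice (G : groupType) X (b : gaction G X) :
  exists (r : X -> X) (t : X -> G), (forall x, b (t x) (r x) = x) /\
    forall g x, r (b g x) = r x.
Proof.
pose P x : pred {classic X} := fun y => `[< exists g, b g x = y >].
have exP x : exists y, P x y by exists x; apply/asboolP; exists 1%g; exact: gact1.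
pose r x : X := xchoose (exP x).
have rE g x : r (b g x) = r x.
  apply: (@eq_xchoose _ (P _) (P _)) => y; apply: asbool_equiv_eq; split=> -[h hy].
    by exists (h * g)%g; rewrite gactM.
  by exists (h * g^-1)%g; rewrite gactM gactK.
have /choice[t tP] : forall x, exists g, b g (r x) = x.
  move=> x; have /asboolP[g gx] := xchooseP (exP x).
  by exists g^-1%g; rewrite -[r x]/(xchoose (exP x)) -gx gactK.
by exists r, t.
Qed.

(* For G totally disconnected and locally compact these are the projective
   modules, in a form which is inherited by open subgroups. *)
Definition perm_retract (G : topGroupType) (P : dmod G) :=
  exists X (b : gaction G X) (bo : forall x, open (subgroup_set (stab b x))),
    (forall x, coset_bounded (subgroup_set (stab b x))) /\
    exists (c : hom P (perm_mod bo (triv G))) (e : hom (perm_mod bo (triv G)) P),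
      forall p, hom_fun e (hom_fun c p) = p.

(** A map out of a permutation module is an equivariant family of images of the points, so it
    suffices to lift the image of one point per orbit to a vector fixed by the stabiliser of that
    point; averaging provides it. *)
Lemma perm_projective (G : topGroupType) X (b : gaction G X)
    (bo : forall x, open (subgroup_set (stab b x))) :
  (forall x, coset_bounded (subgroup_set (stab b x))) ->
  projective_object (perm_mod bo (triv G)).
Proof.
move=> bb A B f u f_surj; have [r [t [tP rP]]] := orbit_choice b.
pose one : triv G := 1 : rat.
have /choice[l lP] : forall x, exists y, hom_fun f y = hom_fun u (pin bo x one) /\
    forall g, b g x = x -> dact A g y = y.
  move=> x; have [|y fy Sy] := invariant_lift (f := f) (bb x)
    (b := hom_fun u (pin bo x one)) _ (f_surj _).
    by move=> g gx; rewrite -hom_equivariant dact_pin [b g x]gx.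
  by exists y.
(* The lifts are used only at the orbit representatives and transported; invariance under the
   stabiliser makes [m] equivariant. *)
pose m x := dact A (t x) (l (r x)).
have mG g x : m (b g x) = dact A g (m x).
  rewrite /m rP -gactM -[in RHS](mulVKg (t (b g x)) (g * t x)%g) gactM.
  congr (dact A _ _); apply/esym/(lP _).2.
  by rewrite !gactM tP; apply: (canLR (gactK b _)); rewrite -(rP g x) tP.
have hl x : linear (fun q : triv G => (q : rat) *: m x).
  by move=> k p q; rewrite scalerDl scalerA.
have hG g x (q : triv G) : (q : rat) *: m (b g x) = dact A g ((q : rat) *: m x).
  by rewrite mG (linearZ_LR (linear_fun (dact_linear g))).
have [h hP] := @perm_lift _ _ _ bo (triv G) A (fun x => linear_fun (hl x)) hG.
exists h; apply/funext; apply: perm_ext => [k p q|k p q|x q] /=.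
- by rewrite !linearP.
- by rewrite linearP.
have -> : pin bo x q = (q : rat) *: pin bo x one.
  rewrite -[RHS]addr0 -(linear0 (linear_fun (@pin_linear _ _ _ bo (triv G) x))).
  by rewrite -[RHS](pin_linear bo) addr0 -[X in pin _ _ X]mulr1.
rewrite !linearZ /=; congr (_ *: _).
have -> : hom_fun h (pin bo x one) = m x by rewrite hP; exact: scale1r.
by rewrite /m hom_equivariant (lP _).1 -hom_equivariant dact_pin tP.
Qed.

Lemma perm_retract_projective (G : topGroupType) (P : dmod G) :
  perm_retract P -> projective_object P.
Proof.
move=> [X [b [bo [bb [c [e ec]]]]]] A B f u f_surj.
have [h hP] := perm_projective bb (hom_comp u e) f_surj.
exists (hom_comp h c); apply/funext => p.
have := congr1 (fun k => k (hom_fun c p)) hP.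
by move=> /= ->; rewrite hom_compE ec.
Qed.

(** [P] is a quotient of a permutation module on points [(p, x)], by sending such a point to [p];
    projectivity splits the quotient map. *)
Lemma projective_perm_retract (G : topGroupType) (P : dmod G) :
  tdlc G -> projective_object P -> perm_retract P.
Proof.
move=> /van_dantzig[U [oU bU]] Pproj.
(* The factor of cosets of [U] confines point stabilisers to conjugates of [U], which makes them
   [coset_bounded]. *)
pose b_fun (g : G) (x : P * lcoset U) := (dact P g x.1, lcoset_action U g x.2).
have b1 x : b_fun 1%g x = x by case: x => p x; rewrite /b_fun !gact1.
have bM g h x : b_fun (g * h)%g x = b_fun g (b_fun h x) by rewrite /b_fun !gactM.
pose b := @Gaction G (P * lcoset U) b_fun b1 bM.
have bo x : open (subgroup_set (stab b x)).
  case: x => p x; apply: subgroup_open.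
  apply: (filterS _ (filterI (open_nbhs1 (@dact_open G P p))
                             (open_nbhs1 (lcoset_stab_open oU x)))).
  by move=> g [gp gx]; congr pair.
have bb x : coset_bounded (subgroup_set (stab b x)).
  case: x => p x; apply: coset_bounded_sub (coset_bounded_conj (sval x) bU).
  by move=> g /(congr1 snd) /lcoset_stab.
exists _, b, bo; split=> //.
have hl (x : P * lcoset U) : linear (fun q : triv G => (q : rat) *: x.1).
  by move=> k p q; rewrite scalerDl scalerA.
have hG g (x : P * lcoset U) (q : triv G) : (q : rat) *: (b g x).1 = dact P g ((q : rat) *: x.1).
  by rewrite (linearZ_LR (linear_fun (dact_linear g))).
have [e eP] := @perm_lift _ _ _ bo (triv G) P (fun x => linear_fun (hl x)) hG.
have [|c cP] := projective_lift (f := e) (u := hom_id P) Pproj.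
  move=> p; exists (pin (P := triv G) bo (p, to_lcoset U 1%g) (1 : rat)).
  by rewrite eP; exact: scale1r.
by exists c, e.
Qed.

Section Restriction.
Variables (G : topGroupType) (H : subgroup G).
Hypothesis oH : open (subgroup_set H).

Lemma coset_bounded_val (S : set G) :
  coset_bounded S -> coset_bounded [set h : H | S (val h)].
Proof.
move=> bS L oL.
have L1 : [set val h | h in subgroup_set L] 1%g by exists 1%g => //; exact: subgroup1.
have Ldiv x y : [set val h | h in subgroup_set L] x -> [set val h | h in subgroup_set L] y ->
    [set val h | h in subgroup_set L] (x / y)%g.
  by move=> [h Lh <-] [k Lk <-]; exists (h / k)%g => //; exact: subgroup_div.
pose L' := @Subgroup G [set val h | h in subgroup_set L] L1 Ldiv.
have oL' : open (subgroup_set L').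
  by apply: subgroup_open; apply: subgroup_nbhs => //; exact: open_nbhs1.
have [s sP] := bS L' oL'; exists (pmap insub s) => h Sh.
have [t ts [k Lk kE]] := sP _ Sh.
(* The list for [G] may leave [H], but an entry [t] in the same coset as [h] modulo a subgroup of
   [H] lies in [H]. *)
have Ht : t \in subgroup_pred H.
  apply/mem_set; rewrite -[t]invgK; have -> : (t^-1 = val k * (val h)^-1)%g by rewrite kE mulgK.
  apply: subgroupV; apply: subgroup_div; exact: set_mem (valP _).
exists (SubgroupElt Ht).
  by rewrite mem_pmap_sub.
by rewrite (_ : (_ * h)%g = k)//; apply: val_inj.
Qed.

(** The same set [X] and the same two linear maps serve over [H]; only the point stabilisers shrink
    to their intersections with [H]. *)
Lemma perm_retract_res (P : dmod G) : perm_retract P -> perm_retract (res P H).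
Proof.
move=> [X [b [bo [bb [c [e ec]]]]]].
pose bH := @Gaction H X (fun h => b (val h)) (gact1 b) (fun g h => gactM b (val g) (val h)).
have boH x : open (subgroup_set (stab bH x)).
  exact: open_comp (fun h _ => @subgroup_val_continuous G H h) (bo x).
exists X, bH, boH; split; first by move=> x; exact: coset_bounded_val (bb x).
have actE (h : H) (u : perm_mod bo (triv G)) :
    dact (perm_mod bo (triv G)) (val h) u = dact (perm_mod boH (triv H)) h u.
  exact: dcoef_inj.
have cG (h : H) (p : res P H) :
    hom_fun c (dact (res P H) h p) = dact (perm_mod boH (triv H)) h (hom_fun c p).
  by rewrite -actE -hom_equivariant.
have eG (h : H) (u : perm_mod boH (triv H)) :
    hom_fun e (dact (perm_mod boH (triv H)) h u) = dact (res P H) h (hom_fun e u).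
  by rewrite -actE hom_equivariant.
exists (@mk_hom H (res P H) (perm_mod boH (triv H)) (hom_fun c) (hom_linear c) cG).
by exists (@mk_hom H (perm_mod boH (triv H)) (res P H) (hom_fun e) (hom_linear e) eG).
Qed.

Theorem projective_res (P : dmod G) :
  tdlc G -> projective_object P -> projective_object (res P H).
Proof.
move=> hG Pproj; apply/perm_retract_projective/perm_retract_res.
exact: projective_perm_retract.
Qed.

End Restriction.

(** * Decomposition over the orbits *)

Section RestrictedResolutions.
Variables (G : topGroupType) (H : subgroup G).

Definition res_hom (A B : dmod G) (f : hom A B) : hom (res A H) (res B H) :=
  @mk_hom H (res A H) (res B H) (hom_fun f) (hom_linear f)
    (fun h x => hom_equivariant f (val h) x).

Hypothesis oH : open (subgroup_set H).

(** Restriction leaves the underlying linear maps unchanged, so the proofs of exactness are reused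
    as they are. *)
Definition ires_res (M : dmod G) (I : injective_resolution M) :
    injective_resolution (res M H) :=
  @InjectiveResolution H (res M H) (fun n => res (I n) H) (res_hom (ires_aug I))
    (fun n => res_hom (ires_d I n))
    (fun n => injective_res oH (@ires_injective _ _ I n))
    (@ires_aug_inj _ _ I) (ires_exact0 I) (ires_exact I).

Definition pres_res (hG : tdlc G) (P : projective_resolution (triv G)) :
    projective_resolution (triv H) :=
  @ProjectiveResolution H (triv H) (fun n => res (P n) H)
    (@mk_hom H (res (P 0%N) H) (triv H) (hom_fun (pres_aug P)) (hom_linear (pres_aug P))
      (fun h x => hom_equivariant (pres_aug P) (val h) x))
    (fun n => res_hom (pres_d P n))
    (fun n => projective_res oH hG (@pres_projective _ _ P n))
    (@pres_aug_surj _ _ P) (pres_exact0 P) (pres_exact P).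

End RestrictedResolutions.

Section ComplexIsomorphisms.
Variables (R : nzRingType) (C D : nat -> lmodType R).

Lemma cohomology_iso (dC : forall n, {linear C n -> C n.+1})
    (dD : forall n, {linear D n -> D n.+1}) (f : forall n, {linear C n -> D n}) :
  (forall n x, f n.+1 (dC n x) = dD n (f n x)) ->
  (forall n x, f n x = 0 -> x = 0) -> (forall n y, exists x, f n x = y) ->
  forall n, lmod_iso (cohomology dC n) (cohomology dD n).
Proof.
move=> fd fi fs n; apply: (sq_map_iso (f := f n)) => [z dz|z dz|w dw].
- by rewrite /= -fd dz linear0.
- case: n z dz => [|n] z dz.
    by split=> [->|/fi//]; exact: linear0.
  split=> [[y _ <-]|[y _ yz]]; first by exists (f n y).
  have [x xy] := fs n y; exists x => //.
  apply/eqP; rewrite -subr_eq0; apply/eqP/(fi n.+1).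
  by rewrite linearB /= fd xy yz subrr.
- have [z zw] := fs n w; exists z; last by rewrite zw subrr; exact: submod0.
  by apply: (fi n.+1); rewrite fd zw.
Qed.

Lemma homology_iso (dC : forall n, {linear C n.+1 -> C n})
    (dD : forall n, {linear D n.+1 -> D n}) (f : forall n, {linear C n -> D n}) :
  (forall n x, f n (dC n x) = dD n (f n.+1 x)) ->
  (forall n x, f n x = 0 -> x = 0) -> (forall n y, exists x, f n x = y) ->
  forall n, lmod_iso (homology dC n) (homology dD n).
Proof.
move=> fd fi fs n; apply: (sq_map_iso (f := f n)) => [z|z _|w].
- by case: n z => [|n] z // dz; rewrite /= -fd [dC n z]dz linear0.
- split=> [[y _ <-]|[y _ yz]]; first by exists (f n.+1 y).
  have [x xy] := fs n.+1 y; exists x => //.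
  apply/eqP; rewrite -subr_eq0; apply/eqP/(fi n).
  by rewrite linearB /= fd xy yz subrr.
- have [z zw] := fs n w; exists z; last by rewrite zw subrr; exact: submod0.
  case: n w H z zw => [|n] w dw z zw //.
  by apply: (fi n); rewrite fd zw.
Qed.

End ComplexIsomorphisms.

Section TransportSequences.
Variables (R : nzRingType) (A B C A' B' C' : nat -> lmodType R).

Lemma cohomology_les_transport
    (alpha : forall n, {linear A n -> B n}) (beta : forall n, {linear B n -> C n})
    (delta : forall n, {linear C n -> A n.+1}) :
  (forall n, lmod_iso (B n) (B' n)) -> (forall n, lmod_iso (C n) (C' n)) ->
  [/\ injective (alpha 0%N), forall n, is_exact (alpha n) (beta n),
      forall n, is_exact (beta n) (delta n) & forall n, is_exact (delta n) (alpha n.+1)] ->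
  exists (alpha : forall n, {linear A n -> B' n}) (beta : forall n, {linear B' n -> C' n})
    (delta : forall n, {linear C' n -> A n.+1}),
  [/\ injective (alpha 0%N), forall n, is_exact (alpha n) (beta n),
      forall n, is_exact (beta n) (delta n) & forall n, is_exact (delta n) (alpha n.+1)].
Proof.
move=> /dep_choice[fB /dep_choice[gB BP]] /dep_choice[fC /dep_choice[gC CP]].
have fBi n w : fB n w = 0 -> w = 0.
  by move=> w0; rewrite -[w](BP n).1 w0 linear0.
have fCi n w : fC n w = 0 -> w = 0.
  by move=> w0; rewrite -[w](CP n).1 w0 linear0.
have gBs n w : exists w', gB n w' = w by exists (fB n w); exact: (BP n).1.
have gCs n w : exists w', gC n w' = w by exists (fC n w); exact: (CP n).1.
case=> inj0 ex1 ex2 ex3.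
exists (fun n => fB n \o alpha n : {linear _ -> _}).
exists (fun n => fC n \o (beta n \o gB n) : {linear _ -> _}).
exists (fun n => delta n \o gC n : {linear _ -> _}); split=> [|n|n|n].
- by move=> x y /(can_inj (BP 0%N).1)/inj0.
- by apply: exact_compr; [exact: fCi|exact: (exact_comp (BP n).1 (BP n).2)].
- by apply: (exact_comp (CP n).1 (CP n).2); exact: exact_compl.
- by apply: exact_compr; [exact: fBi|exact: exact_compl].
Qed.

Lemma homology_les_transport
    (alpha : forall n, {linear A n -> B n}) (beta : forall n, {linear B n -> C n})
    (delta : forall n, {linear C n.+1 -> A n}) :
  (forall n, lmod_iso (A n) (A' n)) -> (forall n, lmod_iso (B n) (B' n)) ->
  [/\ forall x, exists y, beta 0%N y = x, forall n, is_exact (alpha n) (beta n),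
      forall n, is_exact (beta n.+1) (delta n) & forall n, is_exact (delta n) (alpha n)] ->
  exists (alpha : forall n, {linear A' n -> B' n}) (beta : forall n, {linear B' n -> C n})
    (delta : forall n, {linear C n.+1 -> A' n}),
  [/\ forall x, exists y, beta 0%N y = x, forall n, is_exact (alpha n) (beta n),
      forall n, is_exact (beta n.+1) (delta n) & forall n, is_exact (delta n) (alpha n)].
Proof.
move=> /dep_choice[fA /dep_choice[gA AP]] /dep_choice[fB /dep_choice[gB BP]].
have fAi n w : fA n w = 0 -> w = 0.
  by move=> w0; rewrite -[w](AP n).1 w0 linear0.
have fBi n w : fB n w = 0 -> w = 0.
  by move=> w0; rewrite -[w](BP n).1 w0 linear0.
have gAs n w : exists w', gA n w' = w by exists (fA n w); exact: (AP n).1.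
have gBs n w : exists w', gB n w' = w by exists (fB n w); exact: (BP n).1.
case=> surj0 ex1 ex2 ex3.
exists (fun n => fB n \o (alpha n \o gA n) : {linear _ -> _}).
exists (fun n => beta n \o gB n : {linear _ -> _}).
exists (fun n => fA n \o delta n : {linear _ -> _}); split=> [x|n|n|n].
- have [y yx] := surj0 x; exists (fB 0%N y) => /=.
  by rewrite (BP 0%N).1.
- by apply: (exact_comp (BP n).1 (BP n).2); exact: exact_compl.
- by apply: exact_compr; [exact: fAi|exact: exact_compl].
- by apply: exact_compr; [exact: fBi|exact: (exact_comp (AP n).1 (AP n).2)].
Qed.

End TransportSequences.

Section HomPre.
Variables (G : topGroupType) (A B C : dmod G) (f : hom A B).

Lemma hom_pre_linear : linear (fun u : hom B C => hom_comp u f).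
Proof. by move=> a u v; apply: hom_ext. Qed.

Definition hom_pre : {linear hom B C -> hom A C} := linear_fun hom_pre_linear.

Lemma hom_preE u x : hom_fun (hom_pre u) x = hom_fun u (hom_fun f x).
Proof. by []. Qed.

End HomPre.

Section Decompositions.
Variables (G : topGroupType) (X : Type) (b : gaction G X).
Hypothesis bo : forall x, open (subgroup_set (stab b x)).
Variables (J : Type) (s : J -> X) (K : J -> subgroup G).
Hypothesis KP : forall j g, subgroup_set (K j) g <-> b g (s j) = s j.
Hypothesis sP : forall x, exists! j, exists g, b g (s j) = x.
Variable M : dmod G.

Lemma orbit_stab_open j : open (subgroup_set (K j)).
Proof.
rewrite (_ : subgroup_set (K j) = subgroup_set (stab b (s j)))//.
by apply/seteqP; split=> g /KP.
Qed.

(** Shapiro's lemma for all orbits: termwise reciprocity, cohomology of a product of complexes, and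
    comparison of the restricted resolution with the prescribed one on each orbit. *)
Lemma cohomology_perm_iso (I : injective_resolution M)
    (IJ : forall j, injective_resolution (res M (K j))) n :
  lmod_iso (cohomology (fun k => hom_post (perm_mod bo (triv G)) (ires_d I k) : {linear _ -> _}) n)
           (dirprod (fun j => dcohomology (IJ j) n)).
Proof.
pose D j k : {linear hom (triv (K j)) (res (I k) (K j)) ->
    hom (triv (K j)) (res (I k.+1) (K j))} :=
  hom_post (triv (K j)) (res_hom (K j) (ires_d I k)).
apply: (@lmod_iso_trans _ _ (cohomology (fun k => dirprod_map (fun j => D j k)) n)).
  apply: (cohomology_iso (f := fun k => linear_fun (@hom_ev_linear _ _ _ bo _ s K KP (I k)))).
  - by move=> k u; apply: dirprod_ext => j; apply: hom_ext.
  - by move=> k u; exact: hom_ev_inj.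
  - by move=> k u; exact: hom_ev_surj.
apply: lmod_iso_trans (cohomology_dirprod_iso D n) _.
apply: dirprod_iso => j.
exact: (dcohomology_iso (ires_res (orbit_stab_open j) I) (IJ j)).
Qed.

(** The homological counterpart, in which comparison with [PJ] relies on the restricted resolution
    still being projective. *)
Lemma homology_perm_iso (hG : tdlc G) (P : projective_resolution (triv G))
    (PJ : forall j, projective_resolution (triv (K j))) n :
  lmod_iso (homology (fun k => tensor_map M (perm_map bo (pres_d P k))) n)
           (dirsum (fun j => dhomology (PJ j) (res M (K j)) n)).
Proof.
pose D j k := tensor_map (res M (K j)) (res_hom (K j) (pres_d P k)).
apply: (@lmod_iso_trans _ _ (homology (fun k => dirsum_map (fun j => D j k)) n)).
  apply: (homology_iso (f := fun k => tensor_split bo KP sP M (P k))).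
  - by move=> k u; exact: tensor_split_map.
  - move=> k u; have [g [fg gf]] := tensor_split_bij bo KP sP M (P k).
    by move=> u0; rewrite -[u]fg u0 -(linear0 (tensor_split bo KP sP M (P k))) fg.
  - move=> k u; have [g [fg gf]] := tensor_split_bij bo KP sP M (P k).
    by exists (g u).
apply: lmod_iso_trans (homology_dirsum_iso D n) _.
apply: dirsum_iso => j.
exact: (homology_tensor_iso (res M (K j)) (pres_res (orbit_stab_open j) hG P) (PJ j)).
Qed.

End Decompositions.

(** * The long exact sequences of the tree *)

Section TreeSequences.
Variables (G : topGroupType) (T : graph) (a : gaction G (vertex T)).
Hypotheses (ha : graph_action a) (hT : is_tree T).
Notation edge := (set_type (@edges T)).
Variables (src tgt : edge -> vertex T).
Hypothesis oE : forall e, adj (src e) (tgt e) /\ val e = [set src e; tgt e].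
Hypothesis oG : forall g e,
  src (edge_action ha g e) = a g (src e) /\ tgt (edge_action ha g e) = a g (tgt e).
Hypothesis vo : forall v, open (subgroup_set (stab a v)).
Hypothesis eo : forall e, open (subgroup_set (stab (edge_action ha) e)).
Notation bd P := (boundary oG vo eo P).
Notation aug P := (augment vo P).

Lemma boundary_natural (P Q : dmod G) (f : hom P Q) x :
  hom_fun (bd Q) (hom_fun (perm_map eo f) x) = hom_fun (perm_map vo f) (hom_fun (bd P) x).
Proof.
move: x; apply: perm_ext => [c u v|c u v|e p].
- by rewrite !linearP.
- by rewrite !linearP.
- by rewrite perm_map_pin !boundaryE linearB /= !perm_map_pin.
Qed.

Lemma augment_natural (P Q : dmod G) (f : hom P Q) x :
  hom_fun (aug Q) (hom_fun (perm_map vo f) x) = hom_fun f (hom_fun (aug P) x).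
Proof.
move: x; apply: perm_ext => [c u v|c u v|v p].
- by rewrite !linearP.
- by rewrite !linearP.
- by rewrite perm_map_pin !augmentE.
Qed.

(** Tensoring with [M] preserves split exactness but in general not injections. A section [s] of the
    augmentation exists by projectivity; the retraction [r] solves [bd w = u - s (aug u)], and
    inherits linearity and equivariance from the injectivity of the boundary. *)
Lemma boundary_split (P : dmod G) : projective_object P ->
  exists (s : hom P (perm_mod vo P)) (r : hom (perm_mod vo P) (perm_mod eo P)),
    [/\ forall p, hom_fun (aug P) (hom_fun s p) = p,
        forall u, hom_fun r (hom_fun (bd P) u) = u &
        forall u, hom_fun (bd P) (hom_fun r u) + hom_fun s (hom_fun (aug P) u) = u].
Proof.
move=> Pproj; have [|s sP] := projective_lift (f := aug P) (u := hom_id P) Pproj.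
  exact: augment_surj.
have bd_inj u v : hom_fun (bd P) u = hom_fun (bd P) v -> u = v.
  move=> uv; apply/eqP; rewrite -subr_eq0; apply/eqP/(boundary_inj hT oE (oG := oG) (vo := vo)).
  by rewrite linearB /= uv subrr.
have /choice[r rP] : forall u, exists w,
    hom_fun (bd P) w = u - hom_fun s (hom_fun (aug P) u).
  move=> u; apply: (augment_ker hT oE).
  by rewrite linearB /= sP subrr.
have rl : linear r.
  move=> c u v; apply: bd_inj; rewrite [RHS]linearP /= !rP.
  by rewrite (linearP (hom_fun (aug P))) (linearP (hom_fun s)) scalerBr opprD addrACA.
have rG g u : r (dact (perm_mod vo P) g u) = dact (perm_mod eo P) g (r u).
  by apply: bd_inj; rewrite hom_equivariant !rP !hom_equivariant dactB.
exists s, (mk_hom rl rG); split=> [//|u|u].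
- apply: bd_inj; rewrite -[hom_fun (mk_hom _ _) _]/(r (hom_fun (bd P) u)) rP.
  by rewrite augment_boundary linear0 subr0.
- by rewrite -[hom_fun (mk_hom _ _) _]/(r u) rP subrK.
Qed.

(** Contravariance puts the augmentation first and the boundary second. Exactness in the middle and
    on the right are extension problems into the injective terms of [I]. *)
Lemma tree_cohomology_les (M : dmod G) (I : injective_resolution M) :
  exists (alpha : forall n, {linear dcohomology I n ->
      cohomology (fun k => hom_post (perm_mod vo (triv G)) (ires_d I k) : {linear _ -> _}) n})
    (beta : forall n, {linear
      cohomology (fun k => hom_post (perm_mod vo (triv G)) (ires_d I k) : {linear _ -> _}) n ->
      cohomology (fun k => hom_post (perm_mod eo (triv G)) (ires_d I k) : {linear _ -> _}) n})
    (delta : forall n, {linear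
      cohomology (fun k => hom_post (perm_mod eo (triv G)) (ires_d I k) : {linear _ -> _}) n ->
      dcohomology I n.+1}),
  [/\ injective (alpha 0%N), forall n, is_exact (alpha n) (beta n),
      forall n, is_exact (beta n) (delta n) & forall n, is_exact (delta n) (alpha n.+1)].
Proof.
apply: (@cohomology_les _ _ _ _ _ _ _ (fun n => hom_pre (I n) (aug (triv G)))
  (fun n => hom_pre (I n) (bd (triv G)))).
- by move=> n u; apply: hom_ext => x; exact: ires_dd.
- by move=> n u; apply: hom_ext.
- by move=> n u; apply: hom_ext.
- move=> n u u0; apply: hom_ext => q; have [x <-] := augment_surj hT vo q.
  by rewrite -hom_preE u0.
- move=> n u; apply: hom_ext => x; rewrite !hom_preE.
  by rewrite augment_boundary linear0.
- move=> n u u0; have [|w wP] := injective_extension (f := aug (triv G)) (u := u)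
      (@ires_injective _ _ I n).
    move=> x /(augment_ker hT oE oG eo)[y <-].
    by rewrite -hom_preE u0.
  by exists w; apply: hom_ext.
- move=> n u; have [|w wP] := injective_extension (f := bd (triv G)) (u := u)
      (@ires_injective _ _ I n).
    by move=> x /(boundary_inj hT oE) ->; rewrite linear0.
  by exists w; apply: hom_ext.
Qed.

Lemma tree_homology_les (M : dmod G) (P : projective_resolution (triv G)) :
  exists (alpha : forall n, {linear
      homology (fun k => tensor_map M (perm_map eo (pres_d P k))) n ->
      homology (fun k => tensor_map M (perm_map vo (pres_d P k))) n})
    (beta : forall n, {linear
      homology (fun k => tensor_map M (perm_map vo (pres_d P k))) n -> dhomology P M n})
    (delta : forall n, {linear dhomology P M n.+1 ->
      homology (fun k => tensor_map M (perm_map eo (pres_d P k))) n}),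
  [/\ forall x, exists y, beta 0%N y = x, forall n, is_exact (alpha n) (beta n),
      forall n, is_exact (beta n.+1) (delta n) & forall n, is_exact (delta n) (alpha n)].
Proof.
apply: (@homology_les _ _ _ _ _ _ _ (fun n => tensor_map M (bd (P n)))
  (fun n => tensor_map M (aug (P n)))).
- move=> n x; rewrite -tensor_map_comp; apply: tensor_map_eq0 => y.
  rewrite hom_compE; apply: dcoef_inj => v; exact: pres_dd.
- move=> n x; rewrite -!tensor_map_comp; congr (tensor_map M _ x).
  by apply: hom_ext => y; rewrite !hom_compE boundary_natural.
- move=> n x; rewrite -!tensor_map_comp; congr (tensor_map M _ x).
  by apply: hom_ext => y; rewrite !hom_compE augment_natural.
- move=> n x x0; have [s [r [_ rb _]]] := boundary_split (@pres_projective _ _ P n).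
  rewrite -[x]tensor_map_id (_ : hom_id _ = hom_comp r (bd (P n))).
    by rewrite tensor_map_comp x0 linear0.
  by apply: hom_ext => y; rewrite hom_compE rb.
- move=> n x; rewrite -tensor_map_comp; apply: tensor_map_eq0 => y.
  by rewrite hom_compE augment_boundary.
- move=> n y y0; have [s [r [_ _ brs]]] := boundary_split (@pres_projective _ _ P n).
  exists (tensor_map M r y); rewrite -[RHS]tensor_map_id -tensor_map_comp.
  rewrite (_ : hom_id _ = 1 *: hom_comp (bd (P n)) r + hom_comp s (aug (P n))).
    by rewrite tensor_mapP scale1r [X in _ + X]tensor_map_comp y0 linear0 addr0.
  by apply: hom_ext => z; rewrite homPE scale1r !hom_compE brs.
- move=> n z; have [s [r [sP _ _]]] := boundary_split (@pres_projective _ _ P n).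
  exists (tensor_map M s z); rewrite -tensor_map_comp -[RHS]tensor_map_id.
  by congr (tensor_map M _ z); apply: hom_ext => y; rewrite hom_compE sP.
Qed.

End TreeSequences.

Theorem theorem2p20 (G : topGroupType) (hG : tdlc G)
  (T : graph) (hT : is_tree T) (a : gaction G (vertex T))
  (ha : graph_action a) (hinv : without_inversion a)
  (hopen : open_stabilisers a)
  (V : set (vertex T)) (hV : orbit_representatives a setT V)
  (E : set (set (vertex T)))
  (hE : orbit_representatives (set_gaction a) (@edges T) E)
  (M : dmod G) :
  (forall (I : injective_resolution M)
     (IV : forall v : V, injective_resolution (res M (stab a (val v))))
     (IE : forall e : E,
       injective_resolution (res M (stab (set_gaction a) (val e)))),
   exists
     (alpha : forall n, {linear dcohomology I n ->
                                dirprod (fun v => dcohomology (IV v) n)})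
     (beta : forall n, {linear dirprod (fun v => dcohomology (IV v) n) ->
                               dirprod (fun e => dcohomology (IE e) n)})
     (delta : forall n, {linear dirprod (fun e => dcohomology (IE e) n) ->
                                dcohomology I n.+1}),
     [/\ injective (alpha 0%N),
         forall n, is_exact (alpha n) (beta n),
         forall n, is_exact (beta n) (delta n) &
         forall n, is_exact (delta n) (alpha n.+1)])
  /\
  (forall (P : projective_resolution (triv G))
     (PV : forall v : V, projective_resolution (triv (stab a (val v))))
     (PE : forall e : E,
       projective_resolution (triv (stab (set_gaction a) (val e)))),
   exists
     (alpha : forall n,
        {linear dirsum (fun e =>
                  dhomology (PE e) (res M (stab (set_gaction a) (val e))) n) ->
                dirsum (fun v => dhomology (PV v) (res M (stab a (val v))) n)})
     (beta : forall n,
        {linear dirsum (fun v => dhomology (PV v) (res M (stab a (val v))) n) ->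
                dhomology P M n})
     (delta : forall n,
        {linear dhomology P M n.+1 ->
                dirsum (fun e =>
                  dhomology (PE e) (res M (stab (set_gaction a) (val e))) n)}),
     [/\ forall x, exists y, beta 0%N y = x,
         forall n, is_exact (alpha n) (beta n),
         forall n, is_exact (beta n.+1) (delta n) &
         forall n, is_exact (delta n) (alpha n)]).
Proof.
have sV x : exists! v : V, exists g, a g (val v) = x.
  have [v [[Vv gv] vu]] := hV.2 x I.
  exists (SigSub (mem_set Vv)); split=> // w gw; apply: val_inj.
  by apply: vu; split=> //; exact: set_mem (valP w).
have KV (v : V) g : subgroup_set (stab a (val v)) g <-> a g (val v) = val v by [].
have vo := hopen.1.
have eo e : open (subgroup_set (stab (edge_action ha) e)).
  by rewrite edge_stab; apply: hopen.2; exact: edgesP.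
(* The prescribed representatives of the edge orbits are also those at which the orientation is
   chosen. *)
have [src [tgt [oE oG]]] := edge_orientation ha hE hinv.
split=> [I IV IE|P PV PE].
  have [al [be [de ex]]] := tree_cohomology_les hT oE oG vo eo I.
  apply: cohomology_les_transport ex => n.
    exact: (cohomology_perm_iso vo KV sV I IV).
  exact: (cohomology_perm_iso eo (edge_rep_stab ha hE) (edge_rep_unique ha hE) I IE).
have [al [be [de ex]]] := tree_homology_les hT oE oG vo eo M P.
apply: homology_les_transport ex => n.
  exact: (homology_perm_iso eo (edge_rep_stab ha hE) (edge_rep_unique ha hE) M hG P PE).
exact: (homology_perm_iso vo KV sV M hG P PV).
Qed.
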